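(* Let $k\ge 2$ be fixed. Let $\kappa$ be a kernel on a vertex space $\mathcal V=(\mathcal S,\mu,(\mathbf x_n))$. Suppose that $\kappa$ is continuous almost everywhere on $\mathcal S\times\mathcal S$, that $\int_{\mathcal S\times\mathcal S}\kappa(x,y)\,d\mu(x)\,d\mu(y)<\infty$, and that $\frac1n\mathbb E\, e(G^{\mathcal V}(n,\kappa))\to\frac12\iint_{\mathcal S^2}\kappa(x,y)\,d\mu(x)\,d\mu(y)$ as $n\to\infty$. Suppose in addition that: (i) (continuity from below) there exist a sequence $(\kappa_m)$ of regular finitary kernels with $\kappa_m(x,y)\le\kappa(x,y)$ for all $x,y$, and real numbers $c_m<1$, such that $\beta^+(c_m\kappa_m)\to\beta^+(\kappa)$ as $m\to\infty$; (ii) there is an increasing sequence $(\kappa'_m)$ of regular finitary kernels with $\kappa'_m\le\kappa$ pointwise, together with couplings $G^{\mathcal V}(n,\kappa'_m)\subset G^{\mathcal V}(n,\kappa)$, such that for every $\ell\ge1$ and $\varepsilon>0$ there is $m_0=m_0(\ell,\varepsilon)$ with $\Pr(|V_{\ell,m}|\ge\varepsilon n)\le\varepsilon$ for all $m\ge m_0$ and all sufficiently large $n$, where $V_{\ell,m}$ is the set of vertices that are endpoints of a path of length $\ell$ in $G^{\mathcal V}(n,\kappa)$ not present in $G^{\mathcal V}(n,\kappa'_m)$. Then \[ \frac1n\,c_k\bigl(G^{\mathcal V}(n,\kappa)\bigr)\ \to\ \beta^+(\kappa)\quad\text{in probability as } n\to\infty . \]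
   Context: A vertex space is a triple $(\mathcal S,\mu,(\mathbf x_n))$: $\mathcal S$ a separable metric space, $\mu$ a Borel probability measure on $\mathcal S$, and for each $n$ a random sequence $\mathbf x_n=(x^{(n)}_1,\dots,x^{(n)}_n)$ in $\mathcal S$ with $\#\{i:x^{(n)}_i\in A\}/n\to\mu(A)$ in probability for every Borel $A$ with $\mu(\partial A)=0$. A kernel is a symmetric non-negative measurable function on $\mathcal S\times\mathcal S$. Given $\mathbf x_n$, $G^{\mathcal V}(n,\kappa)$ is the random graph on $[n]$ with edges $ij$ present independently with probability $\min\{\kappa(x^{(n)}_i,x^{(n)}_j)/n,1\}$; $e(G)$ is its number of edges. A kernel is regular finitary if there is a partition of $\mathcal S$ into finitely many Borel sets $S_i$ with $\mu(\partial S_i)=0$ such that the kernel is constant on each $S_i\times S_j$. $X_\kappa$ is the multi-type Galton--Watson process from one particle $x_0$ with type distributed as $\mu$, where a particle of type $x$ has children whose types form a Poisson process on $\mathcal S$ of intensity $\kappa(x,y)\,d\mu(y)$, independently. $\beta^+(\kappa)$ is the probability that $x_0$ has at least $k$ children each of which is the root of an infinite $(k-1)$-ary subtree of its descendants (equivalently, $x_0$ lies in an infinite $k$-regular subtree of $X_\kappa$). $c_k(G)$ is the number of vertices of the $k$-core of $G$, its maximal subgraph of minimum degree at least $k$. *)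

(* Defs.v *)
From HB Require Import structures.
From mathcomp Require Import all_boot all_order all_algebra.
From mathcomp Require Import all_classical all_reals all_analysis.
Set Implicit Arguments. Unset Strict Implicit. Unset Printing Implicit Defensive.
Import Order.TTheory GRing.Theory Num.Theory.
Import numFieldNormedType.Exports.
Local Open Scope classical_set_scope.
Local Open Scope ring_scope.

Definition SB {R : realType} (S : pseudoPMetricType R) := g_sigma_algebraType (@open S).

Definition separable {R : realType} (S : pseudoPMetricType R) : Prop :=
  exists D : set S, countable D /\ closure D = setT.

Definition bdry {T : topologicalType} (A : set T) : set T := closure A `\` A°.

Section VertexSpace.
Variables (R : realType) (S : pseudoPMetricType R) (mu : probability (SB S) R).
Variables (d : measure_display) (Om : measurableType d) (P : probability Om R).

Definition vertex_space (x : forall n : nat, Om -> 'I_n -> S) : Prop :=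
  (forall n (i : 'I_n), measurable_fun setT (fun w => (x n w i : SB S))) /\
  forall A : set S, measurable (A : set (SB S)) -> mu (bdry A : set (SB S)) = 0%E ->
  forall eps : R, 0 < eps ->
    (fun n : nat => P [set w | eps < `| (#|[set i : 'I_n | `[< A (x n w i) >]]|%:R / n%:R)
                                     - fine (mu (A : set (SB S))) | ]) @ \oo --> 0%E.

Definition is_kernel (kap : S -> S -> R) : Prop :=
  (forall a b, kap a b = kap b a) /\ (forall a b, 0 <= kap a b) /\
  measurable_fun setT (fun z : (SB S * SB S)%type => kap z.1 z.2).

Definition regular_finitary (kap : S -> S -> R) : Prop :=
  is_kernel kap /\
  exists (r : nat) (part : 'I_r -> set S),
    (forall i, measurable (part i : set (SB S))) /\
    (forall i, mu (bdry (part i) : set (SB S)) = 0%E) /\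
    (forall i j, i != j -> part i `&` part j = set0) /\
    (forall a, exists i, part i a) /\
    (forall i j a b a' b', part i a -> part i a' -> part j b -> part j b' ->
        kap a b = kap a' b').

(* A graph on [n] = 'I_n is an edge set E of pairs (i,j) with i < j. *)
Definition pairsn (n : nat) : {set 'I_n * 'I_n} := [set p : 'I_n * 'I_n | (p.1 < p.2)%N].

Definition edgep (kap : S -> S -> R) (n : nat) (y : 'I_n -> S) (p : 'I_n * 'I_n) : R :=
  Num.min (kap (y p.1) (y p.2) / n%:R) 1.

Definition gweight (kap : S -> S -> R) (n : nat) (y : 'I_n -> S) (E : {set 'I_n * 'I_n}) : R :=
  \prod_(p in pairsn n) (if p \in E then edgep kap y p else 1 - edgep kap y p).

Definition graphE (kap : S -> S -> R) (x : forall n : nat, Om -> 'I_n -> S) (n : nat)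
  (f : {set 'I_n * 'I_n} -> R) : \bar R :=
  (\int[P]_w (\sum_(E in powerset (pairsn n)) gweight kap (x n w) E * f E)%:E)%E.

Definition graphPr (kap : S -> S -> R) (x : forall n : nat, Om -> 'I_n -> S) (n : nat)
  (Q : {set 'I_n * 'I_n} -> bool) : \bar R :=
  graphE kap x (fun E => (Q E)%:R).

End VertexSpace.

Definition adj n (E : {set 'I_n * 'I_n}) (i j : 'I_n) : bool :=
  ((i, j) \in E) || ((j, i) \in E).

(* vertex set of the k-core: the union of all vertex sets inducing a subgraph
   of minimum degree >= k, i.e. the vertex set of the maximal such subgraph *)
Definition kcore (k : nat) n (E : {set 'I_n * 'I_n}) : {set 'I_n} :=
  \bigcup_(U : {set 'I_n} | [forall v in U, (k <= #|[set w in U | adj E v w]|)%N]) U.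

Definition ck (k : nat) n (E : {set 'I_n * 'I_n}) : nat := #|kcore k E|.

Definition is_path n (l : nat) (E : {set 'I_n * 'I_n}) (t : l.+1.-tuple 'I_n) : bool :=
  uniq t && [forall i : 'I_l, adj E (tnth t (inord i)) (tnth t (inord i.+1))].

Definition Vset n (l : nat) (E' E : {set 'I_n * 'I_n}) : {set 'I_n} :=
  [set v | [exists t : l.+1.-tuple 'I_n,
      [&& is_path E t, ~~ is_path E' t &
          (v == tnth t ord0) || (v == tnth t ord_max)]]].

(* Particles are labelled by Ulam-Harris words u : seq nat; the children of
   an existing particle u are rcons u i, i < N u.  T u is the type of u.
   The process is characterised by its finite-dimensional distributions:
   for every finite exploration shape t (a tree whose leaves [Unexp] are
   particles whose offspring is not inspected) and every family of Borel
   sets B u, the probability that the exploration has shape t with types in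
   the B u is the integral of the Poisson-process densities:  a particle of
   type a has exactly c children with (ordered) types in dy_1..dy_c with
   density exp(-lambda(a)) / c! * prod_i kap(a,y_i) dmu(y_i), where
   lambda(a) = int kap(a,y) dmu(y). *)

Inductive shape := Unexp | Node of seq shape.

Section GW.
Variables (R : realType) (S : pseudoPMetricType R) (mu : probability (SB S) R).
Variable kap : S -> S -> R.

Definition lam (a : S) : \bar R := (\int[mu]_y (kap a y)%:E)%E.

Fixpoint gw_density (B : seq nat -> set S) (t : shape) (u : seq nat) (a : S)
  {struct t} : \bar R :=
  match t with
  | Unexp => 1%E
  | Node ts =>
    (expeR (- lam a) * ((size ts)`!%:R^-1)%:E *
     (fix dens (ts : seq shape) (i : nat) {struct ts} : \bar R :=
        match ts with
        | [::] => 1%E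
        | t' :: ts' =>
          (\int[mu]_(y in (B (rcons u i) : set (SB S)))
              ((kap a y)%:E * gw_density B t' (rcons u i) y)) * dens ts' i.+1
        end) ts 0%N)%E
  end.

Variables (d : measure_display) (Om : measurableType d).

Fixpoint gw_event (T : seq nat -> Om -> S) (N : seq nat -> Om -> nat)
  (B : seq nat -> set S) (t : shape) (u : seq nat) (w : Om) {struct t} : Prop :=
  match t with
  | Unexp => B u (T u w)
  | Node ts =>
    B u (T u w) /\ N u w = size ts /\
    (fix evs (ts : seq shape) (i : nat) {struct ts} : Prop :=
       match ts with
       | [::] => True
       | t' :: ts' => gw_event T N B t' (rcons u i) w /\ evs ts' i.+1
       end) ts 0%N
  end.

Definition is_GW (P : probability Om R) (T : seq nat -> Om -> S) (N : seq nat -> Om -> nat) :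
  Prop :=
  (forall u, measurable_fun setT (fun w => (T u w : SB S))) /\
  (forall u, measurable_fun setT (N u)) /\
  forall (B : seq nat -> set S) (t : shape),
    (forall u, measurable (B u : set (SB S))) ->
    P [set w | gw_event T N B t [::] w] =
      (\int[mu]_(a in (B [::] : set (SB S))) gw_density B t [::] a)%E.

(* particle u (if it exists) is the root of an infinite j-ary subtree
   of its descendants (for j >= 1) *)
Definition inf_subtree (N : seq nat -> Om -> nat) (j : nat) (u : seq nat) (w : Om) : Prop :=
  exists D : set (seq nat), D u /\
    forall v, D v -> (j <= #|[set i : 'I_(N v w) | `[< D (rcons v i) >]]|)%N.

Definition beta_event (k : nat) (N : seq nat -> Om -> nat) : set Om :=
  [set w | (k <= #|[set i : 'I_(N [::] w) | `[< inf_subtree N k.-1 [:: val i] w >]]|)%N].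

End GW.

Definition is_beta_plus {R : realType} {S : pseudoPMetricType R}
  (mu : probability (SB S) R) (k : nat) (kap : S -> S -> R) (b : R) : Prop :=
  (exists (d : measure_display) (Om : measurableType d) (P : probability Om R)
          (T : seq nat -> Om -> S) (N : seq nat -> Om -> nat), is_GW mu kap P T N) /\
  (forall (d : measure_display) (Om : measurableType d) (P : probability Om R)
          (T : seq nat -> Om -> S) (N : seq nat -> Om -> nat), is_GW mu kap P T N ->
     measurable (beta_event k N) /\ P (beta_event k N) = b%:E).

Arguments graphE {R S d Om} P kap x n f.
Arguments graphPr {R S d Om} P kap x n Q.

(* Main.v *)
(** Call "the tree event of depth l" the event that a vertex has k children, each the root of a
    (k-1)-ary tree of depth l; its probability in the branching process decreases to beta+
    because the process is locally finite, and for a finitary kernel it is given by the recursion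
    q -> P(Poisson(K q) >= k-1).

    Upper bound: outside the endpoints of short paths missing from the finitary subgraph, and
    outside the few vertices close to a short cycle, a vertex of the k-core satisfies the tree
    event in the finitary subgraph.  The frequency of the tree event is computed by a second
    moment argument and Poisson approximation, and the finitary kernel is dominated by kappa.

    Lower bound: for a finitary kernel K and c < 1, vertices are required to be robust, that is to
    keep the tree property when one child is lost at every vertex.  Requiring this again after
    each block of d generations gives a decreasing sequence of vertex sets, and by pigeonhole two
    consecutive ones nearly coincide.  Close the exceptional set to a set H such that no vertex
    outside H sees H in two directions; since sparse random graphs have no small dense subgraphs,
    H stays small.  The robust vertices which do not see H span minimum degree at least k.  The
    factor c < 1 absorbs the cost of robustness, since a robust vertex is only slightly rarer
    than a vertex that survives thinning by c.

    Convergence of E(c_k / n) from above and of c_k / n in probability from below imply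
    convergence in probability, as c_k / n is bounded. *)

Require Import Defs.
From HB Require Import structures.
From mathcomp Require Import all_boot all_order all_algebra.
From mathcomp Require Import reals sequences exp.
From mathcomp Require boolp all_classical all_reals all_analysis measurable_realfun.
From mathcomp Require Import ring lra zify.
Set Implicit Arguments. Unset Strict Implicit. Unset Printing Implicit Defensive.
Import Order.TTheory GRing.Theory Num.Theory.
Local Open Scope ring_scope.

(** * Random subsets with independent elements *)

(** Survival of a deep tree below a vertex does not put it in the core: survival must persist beyond
    every fixed depth, where the graph is no longer a tree. The core is therefore built from a
    condition on oriented edges which reproduces itself after one block ([closed_core]). This uses
    the non-backtracking exploration [gr], while probabilities are computed for the self-avoiding
    [loc], whose branches can be separated into disjoint edge sets; [loc_gr] passes from one to the
    other without any hypothesis on cycles. The block length [d] comes from the finite-type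
    recursion alone and serves every number [T] of blocks. This order matters: the radius of the
    closure and the admissible size of the exceptional set depend on [d], and [T] is chosen
    afterwards to make the pigeonhole loss small enough. Given the types, graph probabilities are
    finite weighted sums over edge sets; integration over the types comes only at the end. *)

Section FiniteProduct.
Variables (R : realFieldType) (I : finType).
Implicit Types (p : I -> R) (A B E F : {set I}) (f g : {set I} -> R).

Definition wt p A E : R := \prod_(i in A) (if i \in E then p i else 1 - p i).

(** With [A = pairsn n] and [p = edgep kap y] this is, by conversion, the conditional mean given the
    types that appears inside [graphE]. *)
Definition Ex p A f : R := \sum_(E in powerset A) wt p A E * f E.

Lemma eq_Ex p A f g : (forall E, E \subset A -> f E = g E) -> Ex p A f = Ex p A g.
Proof.
by move=> fg; apply: eq_bigr => E; rewrite powersetE => EA; rewrite fg.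
Qed.

Lemma Ex0 p f : Ex p set0 f = f set0.
Proof.
rewrite /Ex powerset0 big_set1 /wt big1 ?mul1r// => i.
by rewrite inE.
Qed.

Lemma ExD p A f g : Ex p A (fun E => f E + g E) = Ex p A f + Ex p A g.
Proof. by rewrite /Ex -big_split; apply: eq_bigr => E _; rewrite mulrDr. Qed.

Lemma ExZ p A c f : Ex p A (fun E => c * f E) = c * Ex p A f.
Proof. by rewrite /Ex mulr_sumr; apply: eq_bigr => E _; rewrite mulrCA. Qed.

Lemma ExZr p A c f : Ex p A (fun E => f E * c) = Ex p A f * c.
Proof. by rewrite /Ex mulr_suml; apply: eq_bigr => E _; rewrite mulrA. Qed.

Lemma ExN p A f : Ex p A (fun E => - f E) = - Ex p A f.
Proof. by rewrite /Ex -sumrN; apply: eq_bigr => E _; rewrite mulrN. Qed.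

Lemma ExB p A f g : Ex p A (fun E => f E - g E) = Ex p A f - Ex p A g.
Proof. by rewrite ExD ExN. Qed.

Lemma Ex_sum p A (J : Type) (s : seq J) (P : pred J) (f : J -> {set I} -> R) :
  Ex p A (fun E => \sum_(j <- s | P j) f j E) = \sum_(j <- s | P j) Ex p A (f j).
Proof.
rewrite /Ex exchange_big /=; apply: eq_bigr => E _.
by rewrite mulr_sumr.
Qed.

(** Conditioning on one element; together with [set_ind] it plays the role of the product
    measure. *)
Lemma Ex_setU1 p A i f : i \notin A ->
  Ex p (i |: A) f =
  p i * Ex p A (fun E => f (i |: E)) + (1 - p i) * Ex p A f.
Proof.
move=> iA; rewrite /Ex (bigID (fun E : {set I} => i \in E)) /=; congr (_ + _).
- rewrite (reindex_onto (fun E : {set I} => i |: E) (fun E : {set I} => E :\ i)) /=.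
    rewrite mulr_sumr; apply: eq_big => [E|E].
      rewrite !powersetE in_setU1 eqxx/= andbT.
      apply/andP/idP => [[sEA /eqP <-]|sEA].
        rewrite subDset (subset_trans (subsetUr [set i] _))//.
        by rewrite finset.setUA finset.setUid.
      split; first by rewrite finset.setUS.
      rewrite setU1K//; apply: contra iA; exact: (subsetP sEA).
    rewrite !powersetE => /andP[/andP[sEA _] /eqP EE].
    have iE : i \notin E by rewrite -EE !inE eqxx.
    rewrite mulrA; congr (_ * _); rewrite /wt big_setU1//= !inE eqxx/=.
    congr (_ * _); apply: eq_bigr => j jA; rewrite !inE.
    by case: eqP => // ji; rewrite -ji jA in iA.
  by move=> E /andP[_ iE]; rewrite finset.setD1K.
- rewrite mulr_sumr; apply: eq_big => [E|E].
    rewrite !powersetE; apply/andP/idP => [[sEA iE]|sEA].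
      apply/fintype.subsetP => j jE; move/fintype.subsetP: sEA => /(_ j jE).
      by rewrite !inE => /orP[/eqP ji|//]; rewrite -ji jE in iE.
    split; first by rewrite (subset_trans sEA)// subsetUr.
    by apply: contra iA; exact: (subsetP sEA).
  rewrite powersetE => /andP[sEA iE].
  rewrite mulrA; congr (_ * _); rewrite /wt big_setU1//= (negbTE iE).
  by [].
Qed.

Lemma set_ind (Q : {set I} -> Prop) : Q set0 ->
  (forall i A, i \notin A -> Q A -> Q (i |: A)) -> forall A, Q A.
Proof.
move=> Q0 QS A; have [n] := ubnP #|A|; elim: n A => // n IHn A.
have [->//|[i iA]] := set_0Vmem A.
rewrite (cardsD1 i) iA => /= lt; rewrite -(finset.setD1K iA).
by apply: QS; [rewrite !inE eqxx | apply: IHn].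
Qed.

Lemma Ex_cst p A c : Ex p A (fun=> c) = c.
Proof.
elim/set_ind: A => [|i A iA IH]; first by rewrite Ex0.
by rewrite Ex_setU1// IH; ring.
Qed.

Lemma Ex_setU p A B f : [disjoint A & B] ->
  Ex p (A :|: B) f = Ex p A (fun E => Ex p B (fun F => f (E :|: F))).
Proof.
elim/set_ind: A f => [|i A iA IH] f.
  by rewrite Ex0 finset.set0U => _; apply: eq_Ex => E _; rewrite finset.set0U.
rewrite disjoints_subset subUset sub1set inE => /andP[iB AB].
rewrite -finset.setUA Ex_setU1 ?inE ?negb_or ?iA// !IH ?disjoints_subset//.
rewrite Ex_setU1//; congr (_ * _ + _ * _).
by apply: eq_Ex => E _; apply: eq_Ex => F _; rewrite finset.setUA.
Qed.

Lemma Ex_marginal p A B f : B \subset A ->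
  (forall E, E \subset A -> f E = f (E :&: B)) -> Ex p A f = Ex p B f.
Proof.
move=> BA fB; rewrite -(finset.setID A B) (finset.setIidPr BA) Ex_setU; last first.
  by rewrite -finset.setI_eq0 finset.setDE finset.setICA finset.setICr finset.setI0.
apply: eq_Ex => E EB; rewrite -[RHS](Ex_cst p (A :\: B)); apply: eq_Ex => F FAB.
rewrite fB.
  congr f; rewrite finset.setIUl (finset.setIidPl EB).
  suff -> : F :&: B = set0 by rewrite finset.setU0.
  apply/finset.setP => j; rewrite !inE; apply/negP => /andP[jF jB].
  by move/fintype.subsetP: FAB => /(_ j jF); rewrite inE jB.
rewrite subUset (subset_trans EB BA)/=.
by rewrite (subset_trans FAB)// subsetDl.
Qed.

Section Order.
Variable p : I -> R.
Hypothesis p01 : forall i, 0 <= p i <= 1.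

Lemma wt_ge0 A E : 0 <= wt p A E.
Proof.
apply: prodr_ge0 => i _; have /andP[p0 p1] := p01 i.
by case: ifP; rewrite ?subr_ge0.
Qed.

Lemma ler_Ex A f g : (forall E, E \subset A -> f E <= g E) -> Ex p A f <= Ex p A g.
Proof.
move=> fg; apply: ler_sum => E; rewrite powersetE => EA.
by rewrite ler_wpM2l ?wt_ge0// fg.
Qed.

Lemma Ex_ge0 A f : (forall E, E \subset A -> 0 <= f E) -> 0 <= Ex p A f.
Proof. by move=> f0; rewrite -(Ex_cst p A 0); apply: ler_Ex. Qed.

End Order.

(** Replaces a monotone coupling of the two random sets: the probabilities are raised one element at
    a time. It carries the lower bound from a finitary kernel to a larger kernel. *)
Lemma ler_Ex_p p p' A f : (forall i, 0 <= p i) -> (forall i, p' i <= 1) ->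
  (forall i, p i <= p' i) ->
  (forall E F, E \subset F -> f F <= f E) -> Ex p' A f <= Ex p A f.
Proof.
move=> p0 p1 pp'; elim/set_ind: A f => [|i A iA IH] f fd; first by rewrite !Ex0.
have p01 j : 0 <= p j <= 1 by rewrite p0 (le_trans (pp' j)).
have p'01 j : 0 <= p' j <= 1 by rewrite p1 (le_trans (p0 j)).
rewrite !Ex_setU1//.
have h1 : Ex p' A (fun E => f (i |: E)) <= Ex p A (fun E => f (i |: E)).
  by apply: IH => E F EF; apply: fd; rewrite finset.setUS.
have h2 : Ex p A (fun E => f (i |: E)) <= Ex p A f.
  by apply: ler_Ex => // E _; apply: fd; rewrite subsetUr.
have h3 : Ex p' A f <= Ex p A f by apply: IH.
have le1 := ler_wpM2l (le_trans (p0 i) (pp' i)) h1.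
have le2 : (1 - p' i) * Ex p' A f <= (1 - p' i) * Ex p A f.
  by rewrite ler_wpM2l// subr_ge0.
have le3 : p i * (Ex p A f - Ex p A (fun E => f (i |: E))) <=
           p' i * (Ex p A f - Ex p A (fun E => f (i |: E))).
  by rewrite ler_wpM2r// subr_ge0.
lra.
Qed.

(** The second hypothesis says that [f] ignores the element [i], so this is independence of [i] from
    the rest. *)
Lemma Ex_edge p A i f : i \in A ->
  (forall E, f (i |: E) = f (E :\ i)) ->
  Ex p A (fun E => (i \in E)%:R * f E) = p i * Ex p A f.
Proof.
move=> iA fi; rewrite -(finset.setD1K iA) !Ex_setU1 ?inE ?eqxx//.
have fE E : E \subset A :\ i -> f (i |: E) = f E.
  move=> EA; rewrite fi; congr f; apply/finset.setDidPl.
  rewrite disjoint_sym disjoints_subset sub1set inE.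
  by apply/negP => /(fintype.subsetP EA); rewrite !inE eqxx.
rewrite [X in p i * X + _](_ : _ = Ex p (A :\ i) f); last first.
  by apply: eq_Ex => E EA; rewrite !inE eqxx/= mul1r fE.
rewrite [X in (1 - _) * X](_ : _ = 0); last first.
  rewrite -[RHS](Ex_cst p (A :\ i)); apply: eq_Ex => E EA.
  case: (boolP (i \in E)); last by rewrite mul0r.
  by move=> /(fintype.subsetP EA); rewrite !inE eqxx.
rewrite [X in p i * (p i * X + _)](_ : _ = Ex p (A :\ i) f); last first.
  by apply: eq_Ex => E EA; rewrite fE.
ring.
Qed.

Lemma Ex_subset p A F : F \subset A ->
  Ex p A (fun E => (F \subset E)%:R) = \prod_(i in F) p i.
Proof.
elim/set_ind: F => [_|i F iF IH].
  rewrite big_set0 -[RHS](Ex_cst p A); apply: eq_Ex => E _.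
  by rewrite finset.sub0set.
rewrite subUset sub1set => /andP[iA FA]; rewrite big_setU1//= -IH//.
rewrite -Ex_edge//.
  by apply: eq_Ex => E _; rewrite subUset sub1set -natrM mulnb.
move=> E; congr (_ %:R); congr nat_of_bool.
apply/idP/idP => /fintype.subsetP FE; apply/fintype.subsetP => j jF;
  have := FE j jF; rewrite !inE.
- by move=> /orP[/eqP ji|->]; [rewrite -ji jF in iF|rewrite andbT; apply: contraNneq iF => <-].
- by move=> /andP[_ ->]; rewrite orbT.
Qed.

End FiniteProduct.

(** Turns the random star of edges at a vertex into a random set of neighbours, on which [step]
    operates. *)
Lemma Ex_imset (R : realFieldType) (I J : finType) (h : I -> J) (p : J -> R) (A : {set I})
  (f : {set J} -> R) : {in A &, injective h} ->
  Ex p (h @: A) f = Ex (p \o h) A (fun C => f (h @: C)).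
Proof.
elim/set_ind: A f => [|i A iA IH] f hI.
  by rewrite imset0 !Ex0 imset0.
have hI' : {in A &, injective h}.
  by move=> x y xA yA; apply: hI; rewrite !inE ?xA ?yA orbT.
rewrite imsetU1 Ex_setU1; last first.
  apply/imsetP => -[j jA hij]; move: iA.
  by rewrite (hI i j) ?jA// !inE ?eqxx// jA orbT.
rewrite Ex_setU1// !IH//=; congr (_ * _ + _).
by apply: eq_Ex => E _; rewrite imsetU1.
Qed.

(** * Robust vertices and the core *)

Section Exploration.
Variables (V : finType) (e : rel V) (k : nat).
Hypothesis esym : symmetric e.

(* A status is a pair (alive, robust).  A vertex is robust if it stays alive whenever, along each
   branch below it, at most one child is killed at every vertex; [r = true] resets the notion: only
   robust children are then considered to be alive. *)
Definition step (r : bool) (m : nat) (C : {set V}) (st : V -> bool * bool) : bool * bool :=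
  let a w := if r then (st w).2 else (st w).1 in
  let s w := ~~ r && (st w).2 in
  ((m <= #|[set w in C | a w]|)%N,
   (m < #|[set w in C | a w]|)%N || (m <= #|[set w in C | s w]|)%N).

Definition le2 (x y : bool * bool) := (x.1 ==> y.1) && (x.2 ==> y.2).

Lemma card_sub_imply (C C' : {set V}) (P Q : pred V) : C \subset C' ->
  (forall w, w \in C -> P w -> Q w) ->
  (#|[set w in C | P w]| <= #|[set w in C' | Q w]|)%N.
Proof.
move=> CC' PQ; apply: subset_leq_card; apply/subsetP => w.
rewrite !inE => /andP[wC Pw]; rewrite (subsetP CC' _ wC)/=; exact: PQ.
Qed.

Lemma step_mono r m (C C' : {set V}) st st' : C \subset C' ->
  (forall w, w \in C -> le2 (st w) (st' w)) -> le2 (step r m C st) (step r m C' st').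
Proof.
move=> CC' le; have le_a : (#|[set w in C | if r then (st w).2 else (st w).1]| <=
    #|[set w in C' | if r then (st' w).2 else (st' w).1]|)%N.
  apply: card_sub_imply => // w wC; have /andP[/implyP h1 /implyP h2] := le w wC.
  by case: r.
have le_s : (#|[set w in C | ~~ r && (st w).2]| <= #|[set w in C' | ~~ r && (st' w).2]|)%N.
  apply: card_sub_imply => // w wC /andP[->/=].
  by have /andP[_ /implyP] := le w wC.
apply/andP; split; apply/implyP; rewrite /step /=.
  by move=> h; exact: leq_trans h le_a.
by move=> /orP[h|h]; apply/orP; [left|right]; [exact: leq_trans h le_a|exact: leq_trans h le_s].
Qed.

Lemma eq_step r m (C : {set V}) st st' : {in C, st =1 st'} -> step r m C st = step r m C st'.
Proof.
move=> eqst; rewrite /step.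
have -> : [set w in C | if r then (st w).2 else (st w).1] =
          [set w in C | if r then (st' w).2 else (st' w).1].
  by apply/setP => w; rewrite !inE; case: (boolP (w \in C)) => // /eqst ->.
suff -> : [set w in C | ~~ r && (st w).2] = [set w in C | ~~ r && (st' w).2] by [].
by apply/setP => w; rewrite !inE; case: (boolP (w \in C)) => // /eqst ->.
Qed.

(* [p] is the predecessor of [u], [None] at the root. *)
Definition thr (p : option V) := if p is None then k else k.-1.

Definition chd (p : option V) (u : V) := [set w | e u w & Some w != p].

Fixpoint gr (sch : seq bool) (p : option V) (u : V) : bool * bool :=
  if sch is r :: sch' then step r (thr p) (chd p u) (gr sch' (Some u)) else (true, true).

(* Unlike the non-backtracking exploration [gr], [loc] discards the vertices already met, so that
   its value depends only on the edges inside [U]. *)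
Fixpoint loc (sch : seq bool) (m : nat) (U : {set V}) (u : V) : bool * bool :=
  if sch is r :: sch' then
    step r m [set w in U | e u w] (fun w => loc sch' k.-1 (U :\ w) w)
  else (true, true).

(** [loc] offers fewer children than [gr] at every vertex, and [step] is monotone in the children.
    Cycles can only help here, which is why the lower bound has no term for short cycles. *)
Lemma loc_gr sch p (U : {set V}) u : (if p is Some q then q \notin U else true) -> u \notin U ->
  le2 (loc sch (thr p) U u) (gr sch p u).
Proof.
elim: sch p U u => [|r sch IH] p U u pU uU //.
apply: step_mono => [|w].
  apply/subsetP => w; rewrite !inE => /andP[wU ->] /=.
  case: p pU => // q qU; apply: contraNneq qU => -[<-]//.
rewrite inE => /andP[wU _]; apply: (IH (Some u)); rewrite !inE ?eqxx//.
by rewrite negb_and uU orbT.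
Qed.

(** A leaf of the block may itself be bad, and [one_bad_branch] does not forbid this at depth 0;
    hence the robust component of a leaf is [false]. *)
Fixpoint block_status (d : nat) (X : option V -> V -> bool) (p : option V) (u : V) : bool * bool :=
  if d is d'.+1 then step false (thr p) (chd p u) (block_status d' X (Some u)) else (X p u, false).

(** A reset step behaves as an ordinary step over children of status [(robust, false)], which are
    the leaves of a block. So [d] ordinary steps followed by a reset form a block of [d.+1]
    generations. *)
Lemma gr_block_status d sch p u :
  gr (nseq d false ++ true :: sch) p u = block_status d.+1 (fun p u => (gr sch p u).2) p u.
Proof.
elim: d p u => [//|d IH] p u.
exact: (@eq_step false (thr p) (chd p u) (gr (nseq d false ++ true :: sch) (Some u))
  (block_status d.+1 (fun p u => (gr sch p u).2) (Some u)) (fun w _ => IH (Some u) w)).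
Qed.

Lemma block_status_mono d (X X' : option V -> V -> bool) : (forall p u, X p u -> X' p u) ->
  forall p u, le2 (block_status d X p u) (block_status d X' p u).
Proof.
move=> XX'; elim: d => [|d IH] p u /=.
  by rewrite /le2/= andbT; apply/implyP; exact: XX'.
by apply: step_mono => // w _.
Qed.

Fixpoint sched (d T : nat) : seq bool :=
  if T is T'.+1 then nseq d false ++ true :: sched d T' else [::].

Definition stage d t p u := (gr (sched d t) p u).2.

Lemma stageS d t p u : stage d t.+1 p u = (block_status d.+1 (stage d t) p u).2.
Proof. by rewrite /stage /= gr_block_status. Qed.

(** Stage 0 holds everywhere, and each stage is the same monotone operator applied to the preceding
    one. *)
Lemma stage_dec d t p u : stage d t.+1 p u -> stage d t p u.
Proof.
elim: t p u => [//|t IH] p u; rewrite stageS => h; rewrite stageS.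
by have /andP[_ /implyP] := block_status_mono d.+1 IH p u; apply.
Qed.

Lemma stage_le d t t' p u : (t <= t')%N -> stage d t' p u -> stage d t p u.
Proof.
move=> /subnKC <-; elim: (t' - t)%N => [|j IH]; first by rewrite addn0.
by rewrite addnS => /stage_dec.
Qed.

Fixpoint regular_tree (j : nat) (X : option V -> V -> bool) p u : bool :=
  if j is j'.+1 then (thr p <= #|[set w in chd p u | regular_tree j' X (Some u) w]|)%N else X p u.

Fixpoint sees (j : nat) (bad : option V -> V -> bool) p u : bool :=
  if j is j'.+1 then [exists w in chd p u, sees j' bad (Some u) w] else bad p u.

Fixpoint one_bad_branch (j : nat) (bad : option V -> V -> bool) p u : bool :=
  if j is j'.+1 then
    (#|[set w in chd p u | sees j' bad (Some u) w]| <= 1)%N &&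
    [forall w in chd p u, one_bad_branch j' bad (Some u) w]
  else true.

Section Damage.
Variables (X bad : option V -> V -> bool).
Let Y p u := X p u && ~~ bad p u.

Lemma block_status_unseen j p u : (block_status j X p u).1 -> ~~ sees j bad p u -> regular_tree j Y p u.
Proof.
elim: j p u => [|j IH] p u /=; first by rewrite /Y => -> ->.
move=> le nsee; apply: (leq_trans le); apply: card_sub_imply => // w wC h.
apply: IH => //; apply: contra nsee => sw; apply/existsP; exists w; exact/andP.
Qed.

(** If the vertex has one alive child too many, that child is given up to the bad branch and the
    others see nothing bad. Otherwise enough children are robust, and the bad branch is handled
    below each of them. *)
Lemma block_status_robust j p u : (block_status j X p u).2 -> one_bad_branch j bad p u -> regular_tree j Y p u.
Proof.
elim: j p u => [//|j IH] p u /= /orP[|] h /andP[one /forallP atw].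
- have : (thr p < #|[set w in chd p u | (block_status j X (Some u) w).1]|)%N by [].
  set A := finset _; set Bd := finset _ in one => tA.
  have : (#|A :\: Bd| <= #|[set w in chd p u | regular_tree j Y (Some u) w]|)%N.
    apply: subset_leq_card; apply/subsetP => w; rewrite !inE => /andP[].
    move=> nb /andP[wC Ew]; rewrite wC/=; apply: block_status_unseen => //.
    by move: nb; rewrite wC.
  apply: leq_trans; rewrite cardsD.
  have := subset_leq_card (finset.subsetIr A Bd); move: tA one; lia.
- apply: (leq_trans h); apply: card_sub_imply => // w wC /= Sw; apply: IH => //.
  by have := atw w; rewrite wC.
Qed.

End Damage.

Definition valid (p : option V) (u : V) := if p is Some q then e q u else true.

(** A vertex of [Y] carries a tree with leaves in [Y], and the tree can be regrown at each leaf; in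
    the graph these infinite trees fold into the finite set [Z]. [Q] records that between 1 and
    [d.+1] generations remain before the next renewal. *)
Lemma closed_core d (Y : option V -> V -> bool) :
  (forall p u, valid p u -> Y p u -> regular_tree d.+1 Y p u) ->
  exists Z : {set V}, (forall v, v \in Z -> (k <= #|[set w in Z | e v w]|)%N) /\
    (forall u, Y None u -> u \in Z).
Proof.
move=> YM; pose Q p u := [exists j : 'I_d.+1, regular_tree j.+1 Y p u].
have YQ p u : valid p u -> Y p u -> Q p u.
  by move=> v y; apply/existsP; exists ord_max; exact: YM.
have QQ p u : Q p u -> (thr p <= #|[set w in chd p u | Q (Some u) w]|)%N.
  case/existsP => -[j jd] /= le; apply: (leq_trans le).
  apply: card_sub_imply => // w; rewrite inE => /andP[uw _].
  case: j jd le => [|j] jd _ h; first exact: YQ.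
  by apply/existsP; exists (Ordinal (ltnW jd)).
(* The states are vertices with their predecessor, since the number of children required depends on
   the direction of arrival. *)
pose ro (o o' : option V * V) :=
  [&& o'.1 == Some o.2, o'.2 \in chd o.1 o.2 & Q o'.1 o'.2].
pose Z := [set u | [exists r, Q None r && [exists p, connect ro (None, r) (p, u)]]].
have ZP p u r : Q None r -> connect ro (None, r) (p, u) -> u \in Z.
  by move=> Qr c; rewrite inE; apply/existsP; exists r; rewrite Qr; apply/existsP; exists p.
exists Z; split=> [v|u Yu]; last first.
  by apply: (ZP None u u); [exact: YQ|exact: connect0].
rewrite inE => /existsP[r /andP[Qr /existsP[p /connectP[s]]]].
case: (lastP s) => [_ [_ ->]|{}s o].
  apply: (leq_trans (QQ _ _ Qr)); apply: subset_leq_card.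
  apply/subsetP => w; rewrite !inE => /andP[/andP[rw _] Qw]; rewrite rw andbT.
  move: (ZP (Some r) w r Qr); rewrite inE; apply.
  by apply: connect1; rewrite /ro /= eqxx Qw inE rw.
rewrite rcons_path last_rcons => /andP[ps ro1] oE; subst o.
have c1 : connect ro (None, r) (last (None, r) s) by apply/connectP; exists s.
have c2 : connect ro (None, r) (p, v) by apply: connect_trans c1 (connect1 ro1).
case: (last _ _) ro1 c1 => q p' /= /and3P[/= /eqP pE vC Qv] c1; subst p.
have vp : e v p' by move: vC; rewrite inE esym => /andP[].
have := QQ _ _ Qv => /= le.
have p'N : p' \notin [set w in chd (Some p') v | Q (Some v) w].
  by rewrite !inE eqxx andbF.
(* A vertex reached from [p'] has [k.-1] children in [Z]; the [k]-th neighbour is [p'] itself, which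
   is not one of the children. *)
apply: (@leq_trans #|p' |: [set w in chd (Some p') v | Q (Some v) w]|).
  by rewrite cardsU1 p'N; move: le; lia.
apply: subset_leq_card; apply/subsetP => w; rewrite in_setU1 => /orP[/eqP ->|].
  by rewrite inE vp andbT; exact: ZP c1.
rewrite !inE => /andP[/andP[vw wp] Qw]; rewrite vw andbT.
move: (ZP (Some v) w r Qr); rewrite inE; apply; apply: connect_trans c2 _.
by apply: connect1; rewrite /ro /= eqxx Qw inE vw wp.
Qed.

Section Closed.
Variables (d : nat) (H : {set V}).

Definition inH (p : option V) (u : V) := u \in H.

Definition near_H p u := [exists j : 'I_d.+2, sees j inH p u].

(** The range [2 * d.+1] adds the length of a block to the radius within which [near_H] looks for
    [H]. *)
Definition closedH := forall y w1 w2 i j, y \notin H -> w1 != w2 -> e y w1 -> e y w2 ->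
  (i <= 2 * d.+1)%N -> (j <= 2 * d.+1)%N ->
  sees i inH (Some y) w1 -> sees j inH (Some y) w2 -> False.

Lemma sees_near j p u : sees j near_H p u ->
  exists i, (i <= j + d.+1)%N /\ sees i inH p u.
Proof.
elim: j p u => [|j IH] p u /=.
  by case/existsP => -[i /= ile] si; exists i; rewrite add0n; split => //; lia.
case/existsP => w /andP[wC /IH[i [ile si]]]; exists i.+1; split; first lia.
by apply/existsP; exists w; rewrite wC.
Qed.

(** Since [u] sees no vertex of [H] within the block, every vertex met inside it lies outside [H],
    and [closedH] forbids two bad directions there. *)
Lemma one_bad_branch_closed : closedH -> forall j p u, (j <= d.+1)%N ->
  (forall i, (i <= j)%N -> ~~ sees i inH p u) -> one_bad_branch j near_H p u.
Proof.
move=> cl; elim=> [//|j IH] p u jd nse /=; apply/andP; split.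
  rewrite leqNgt; apply/negP => /card_gt1P[w1 [w2 []]].
  rewrite !inE => /andP[/andP[uw1 _] /sees_near[i1 [i1le s1]]].
  move=> /andP[/andP[uw2 _] /sees_near[i2 [i2le s2]]] w12.
  by apply: (cl u w1 w2 i1 i2 (nse 0%N _)) => //; lia.
apply/forallP => w; apply/implyP => wC; apply: IH; first lia.
move=> i ij; apply/negP => si; have /negP := nse i.+1 ij; apply.
by apply/existsP; exists w; rewrite wC.
Qed.

(* Removing every vertex that sees [H] within distance [d.+1] kills at most one branch at each
   remaining vertex, which a robust vertex survives. *)
Lemma core_lower t (B : {set V}) : closedH -> B \subset H ->
  (forall p u, valid p u -> stage d t p u -> ~~ stage d t.+1 p u -> u \in B) ->
  exists Z : {set V}, (forall v, v \in Z -> (k <= #|[set w in Z | e v w]|)%N) /\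
    (forall u, stage d t None u -> ~~ near_H None u -> u \in Z).
Proof.
move=> cl BH XB; pose Y p u := stage d t p u && ~~ near_H p u.
have [|Z [Zk ZY]] := @closed_core d Y; last first.
  by exists Z; split => // u xu nu; apply: ZY; rewrite /Y xu.
move=> p u vpu /andP[Xu nu].
have nse i : (i <= d.+1)%N -> ~~ sees i inH p u.
  move=> id; apply: contra nu => si; apply/existsP.
  by exists (@Ordinal d.+2 i id).
apply: block_status_robust; last exact: one_bad_branch_closed.
rewrite -stageS; apply/negPn/negP => nX; have := nse 0%N isT.
by rewrite /= /inH (subsetP BH)//; exact: XB nX.
Qed.

End Closed.

(* The stages decrease, so some stage out of [T] loses few vertices. *)
Lemma bad_pigeonhole d T : (0 < T)%N ->
  exists t (B : {set V}), (t < T)%N /\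
   (forall p u, valid p u -> stage d t p u -> ~~ stage d t.+1 p u -> u \in B) /\
   (T * #|B| <= #|V| + \sum_(v : V) #|[set w | e v w]|)%N.
Proof.
move=> T0.
pose B t := [set u | [exists p, [&& valid p u, stage d t p u & ~~ stage d t.+1 p u]]].
(* Losses are counted over pairs of a vertex and a valid predecessor. Counting the root position
   too, there are [#|V|] plus the sum of the degrees of them. *)
have tot : (\sum_(t < T) #|B t| <= #|V| + \sum_(v : V) #|[set w | e v w]|)%N.
  have -> : (#|V| + \sum_(v : V) #|[set w | e v w]| = \sum_(o : option V * V) valid o.1 o.2)%N.
    rewrite -(pair_big predT predT (fun p u => nat_of_bool (valid p u)))/=.
    rewrite (bigD1 None)//= sum1_card; congr addn.
    rewrite (reindex_omap Some id) => [|[x|]//]; apply: eq_big => [x|v _]; first by rewrite eqxx.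
    by rewrite -sum1_card big_mkcond; apply: eq_bigr => w _; rewrite inE /=; case: (e v w).
  apply: (@leq_trans (\sum_(t < T) \sum_(o : option V * V)
     (valid o.1 o.2 && (stage d t o.1 o.2 && ~~ stage d t.+1 o.1 o.2)))).
    apply: leq_sum => t _.
    rewrite -(pair_big predT predT (fun p u => nat_of_bool (valid p u && (stage d t p u && ~~ stage d t.+1 p u))))/=.
    rewrite exchange_big/= -sum1_card big_mkcond; apply: leq_sum => u _.
    rewrite inE; case: ifP => // /existsP[p h].
    by rewrite (bigD1 p)//= h.
  rewrite exchange_big; apply: leq_sum => -[p u] _ /=.
  case: (valid p u) => /=; last by rewrite big1.
  (* As the stages decrease, each pair is lost at most once; the extra summand makes the induction
     go through. *)
  have h t' : (\sum_(t < t') (stage d t p u && ~~ stage d t.+1 p u) + stage d t' p u <= 1)%N.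
    elim: t' => [|t' IH]; first by rewrite big_ord0; case: stage.
    rewrite big_ord_recr/=; move: IH (@stage_dec d t' p u).
    case: (stage d t' p u); case: (stage d t'.+1 p u) => IH dec; move: IH; rewrite /= ?addn0 //.
    by have := dec isT.
  by apply: leq_trans (h T); rewrite leq_addr.
have [t tB] : exists t : 'I_T, forall t' : 'I_T, (#|B t| <= #|B t'|)%N.
  have := @arg_minnP _ (Ordinal T0) xpredT (fun t : 'I_T => #|B t|) isT.
  by case=> t _ h; exists t => t'; apply: h.
exists t, (B t); split => //; split.
  move=> p u v x nx; rewrite inE; apply/existsP; exists p; exact/and3P.
apply: leq_trans tot; rewrite -[T in (T * _)%N]card_ord -sum_nat_const.
by apply: leq_sum => t' _.
Qed.

End Exploration.

(** * Closing the exceptional set and controlling its neighbourhoods *)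

Section Closure.
Variables (V : finType) (e : rel V).
Hypothesis esym : symmetric e.

(** For a symmetric irreflexive relation this is twice the number of edges inside [A]. *)
Definition e2 (A : {set V}) : nat := \sum_(v in A) #|[set w in A | e v w]|.

(** [N] collects the walk from [u] up to its first visit to [H]. The walk does not backtrack, so
    predecessor and successor give two neighbours at each vertex of [N]. Vertices may repeat, which
    is harmless as only a set and its degrees are recorded. *)
Lemma sees_set (H : {set V}) j p u : e p u -> p \notin H -> sees e j (inH H) (Some p) u ->
  exists N : {set V}, [/\ (#|N| <= j)%N, [disjoint N & H], u \in N :|: H,
    (forall v, v \in N -> (2 <= #|[set w in N :|: H :|: [set p] | e v w]|)%N) &
    exists x y, [/\ x \in p |: N, y \in H & e x y]].
Proof.
elim: j p u => [|j IH] p u pu pH.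
  rewrite /= /inH => uH; exists finset.set0; split; rewrite ?cards0 ?finset.set0U//.
  - by rewrite -setI_eq0 finset.set0I.
  - by move=> v; rewrite inE.
  - by exists p, u; rewrite !inE eqxx.
have [uH _|uH] := boolP (u \in H).
  exists finset.set0; split; rewrite ?cards0 ?finset.set0U//.
  - by rewrite -setI_eq0 finset.set0I.
  - by move=> v; rewrite inE.
  - by exists p, u; rewrite !inE eqxx.
rewrite /= => /existsP[w /andP[]]; rewrite inE => /andP[uw wp] sw.
have [N [cN NH wN deg [x [y [xN yH xy]]]]] := IH u w uw uH sw.
exists (u |: N); split.
- by rewrite cardsU1; case: (_ \notin _) => /=; lia.
- by rewrite disjoints_subset subUset sub1set inE uH -disjoints_subset.
- by rewrite !inE eqxx.
- move=> v; rewrite in_setU1 => /orP[/eqP ->|/deg].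
    have sub : [set w; p] \subset [set w0 in u |: N :|: H :|: [set p] | e u w0].
      apply/subsetP => z; rewrite !inE => /orP[] /eqP ->.
        by rewrite uw andbT; move: wN; rewrite !inE => /orP[] ->; rewrite !orbT.
      by rewrite eqxx orbT/= esym.
    apply: leq_trans (subset_leq_card sub); rewrite cards2.
    by rewrite (_ : w != p)//; apply: contraNneq wp => ->.
  move=> h; apply: (leq_trans h); apply: subset_leq_card; apply/subsetP => z.
  by rewrite !inE => /andP[h1 ->]; rewrite andbT; move: h1 => /orP[/orP[]|] ->; rewrite ?orbT.
- by exists x, y; split => //; rewrite !inE; move: xN; rewrite !inE => /orP[] ->; rewrite ?orbT.
Qed.

(** [N] consists of [y] and the two walks. Each of its vertices has two neighbours in [H :|: N],
    whether or not the walks meet, and the final 1 is the degree gained by the endpoint in [H] of a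
    connecting edge. *)
Lemma excess_set (H : {set V}) y w1 w2 i j : y \notin H -> w1 != w2 -> e y w1 -> e y w2 ->
  sees e i (inH H) (Some y) w1 -> sees e j (inH H) (Some y) w2 ->
  exists N : {set V}, [/\ (0 < #|N|)%N, (#|N| <= i + j + 1)%N, [disjoint N & H] &
    (e2 H + 2 * #|N| + 1 <= e2 (H :|: N))%N].
Proof.
move=> yH w12 yw1 yw2 s1 s2.
have [N1 [cN1 NH1 wN1 deg1 [a [b [aN bH ab]]]]] := sees_set yw1 yH s1.
have [N2 [cN2 NH2 wN2 deg2 _]] := sees_set yw2 yH s2.
pose N := y |: (N1 :|: N2).
have NH : [disjoint N & H].
  by rewrite disjoints_subset !subUset sub1set inE yH -!disjoints_subset NH1.
exists N; split => //.
- by apply/card_gt0P; exists y; rewrite !inE eqxx.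
- have c1 : (#|N| <= 1 + #|N1 :|: N2|)%N by rewrite /N cardsU1 leq_add2r; case: (_ \notin _).
  have c2 : (#|N1 :|: N2| <= #|N1| + #|N2|)%N by rewrite cardsU leq_subr.
  by move: c1 c2 cN1 cN2; clear; lia.
have subN1 : N1 :|: H :|: [set y] \subset H :|: N.
  by apply/subsetP => z; rewrite !inE => /orP[/orP[]|] ->; rewrite ?orbT.
have subN2 : N2 :|: H :|: [set y] \subset H :|: N.
  by apply/subsetP => z; rewrite !inE => /orP[/orP[]|] ->; rewrite ?orbT.
have deg v : v \in N -> (2 <= #|[set w in H :|: N | e v w]|)%N.
  rewrite /N !inE => /or3P[/eqP ->|/deg1|/deg2] => [|h|h].
  - have sub : [set w1; w2] \subset [set w in H :|: N | e y w].
      apply/subsetP => z; rewrite in_set2 => /orP[/eqP ->|/eqP ->]; rewrite inE ?yw1 ?yw2 andbT.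
        by apply: (subsetP subN1); rewrite inE wN1.
      by apply: (subsetP subN2); rewrite inE wN2.
    by apply: leq_trans (subset_leq_card sub); rewrite cards2 w12.
  - by apply: (leq_trans h); apply: subset_leq_card; apply/subsetP => z /setIdP[/(subsetP subN1) zz ez]; rewrite inE zz.
  - by apply: (leq_trans h); apply: subset_leq_card; apply/subsetP => z /setIdP[/(subsetP subN2) zz ez]; rewrite inE zz.
rewrite {2}/e2 (eq_bigl [predU H & N]) => [|z]; last by rewrite !inE.
rewrite bigU/=; last by rewrite disjoint_sym.
have hN : (2 * #|N| <= \sum_(v in N) #|[set w in H :|: N | e v w]|)%N.
  by rewrite mulnC -sum_nat_const; apply: leq_sum => v; exact: deg.
suff hH : (e2 H + 1 <= \sum_(v in H) #|[set w in H :|: N | e v w]|)%N.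
  by move: hN hH; clear; lia.
have subH v : [set w in H | e v w] \subset [set w in H :|: N | e v w].
  by apply/subsetP => z; rewrite !inE => /andP[-> ->].
rewrite /e2 (bigD1 b)//= [leqRHS](bigD1 b)//=.
have aN' : a \in N.
  by move: aN; rewrite /N !inE => /orP[->//|->]; rewrite orbT.
have aH : a \notin H by move: NH; rewrite disjoints_subset => /subsetP/(_ _ aN'); rewrite inE.
have hb : (#|[set w in H | e b w]| < #|[set w in H :|: N | e b w]|)%N.
  apply: proper_card; apply/properP; split; first exact: subH.
  exists a; first by rewrite inE in_setU aN' orbT esym.
  by rewrite inE (negbTE aH).
have hr : (\sum_(v in H | v != b) #|[set w in H | e v w]| <=
     \sum_(v in H | v != b) #|[set w in H :|: N | e v w]|)%N.
  by apply: leq_sum => v _; exact/subset_leq_card/subH.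
by move: hb hr; clear; lia.
Qed.

(* Adding a connection between two branches which see [H] creates one more edge than vertices,
   so a closed superset of [B] must be small in a locally sparse graph. *)
Lemma closure_exists d a (B : {set V}) : a = (4 * d.+1 + 1)%N -> (0 < #|B|)%N ->
  (forall A : {set V}, (#|B| <= #|A|)%N -> (#|A| <= (1 + 6 * a) * #|B|)%N ->
     ((4 * a) * e2 A < 2 * (4 * a + 1) * #|A|)%N) ->
  exists H : {set V}, [/\ B \subset H, (#|H| <= (1 + 6 * a) * #|B|)%N & closedH e d H].
Proof.
move=> ha B0 sp.
(* [j] counts the additions made and [m] is fuel. An addition brings at most [a] vertices, by the
   bound [i + j + 1] of [excess_set] with both ranges at most [2 * d.+1], and increases [e2 H] by
   more than twice their number. *)
suff main m j (H : {set V}) : (#|~: H| < m)%N -> B \subset H -> (#|H| <= #|B| + a * j)%N ->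
   (j <= 6 * #|B|)%N -> (2 * #|H| + j <= e2 H + 2 * #|B|)%N ->
   exists H' : {set V}, [/\ B \subset H', (#|H'| <= (1 + 6 * a) * #|B|)%N & closedH e d H'].
  by apply: (main #|~: B|.+1 0%N B) => //; lia.
elim: m j H => // m IH j H Hm BH Ha j6 eH.
have bound i : (i <= 6 * #|B|)%N -> (a * i <= a * (6 * #|B|))%N by rewrite leq_mul2l orbC => ->.
have HM : (#|H| <= (1 + 6 * a) * #|B|)%N by have := bound j j6; lia.
have := sp H (subset_leq_card BH) HM => spH.
(* At [j = 6 * #|B|] the invariant gives [e2 H >= 2 * #|H| + 4 * #|B|]. With
   [#|H| <= (1 + 6 * a) * #|B|], sparsity would force [16 * a < 2 + 12 * a], which fails for
   [a >= 1]. *)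
have jlt : (j < 6 * #|B|)%N.
  rewrite ltnNge; apply/negP => j6'.
  have h1 : (4 * a * (2 * #|H| + 4 * #|B|) <= 4 * a * e2 H)%N.
    by rewrite leq_mul2l; apply/orP; right; lia.
  have h2 : (1 * #|B| <= a * #|B|)%N by rewrite leq_mul2r ha addn1 orbT.
  by move: spH HM h1 h2 B0; clear; lia.
have [cl|] := boolp.pselect (closedH e d H); first by exists H.
move=> ncl; have [y [w1 [w2 [i [i' [yH w12 yw1 yw2 [ile i'le s1 s2]]]]]]] :
    exists y w1 w2 i i', [/\ y \notin H, w1 != w2, e y w1, e y w2 &
     [/\ (i <= 2 * d.+1)%N, (i' <= 2 * d.+1)%N, sees e i (inH H) (Some y) w1 &
     sees e i' (inH H) (Some y) w2]].
  apply: boolp.contrapT => nex; apply: ncl => y w1 w2 i i' *; apply: nex.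
  by exists y, w1, w2, i, i'.
have [N [N0 cN NH eN]] := excess_set yH w12 yw1 yw2 s1 s2.
have cHN : #|H :|: N| = (#|H| + #|N|)%N.
  by rewrite cardsU (disjoint_setI0 _) ?cards0 ?subn0// disjoint_sym.
apply: (IH j.+1 (H :|: N)); rewrite ?cHN.
- by move: (cardsC (H :|: N)) (cardsC H) Hm N0; rewrite cHN; clear; lia.
- by apply: subset_trans BH _; rewrite finset.subsetUl.
- by move: cN ile i'le Ha; rewrite ha; clear; lia.
- exact: jlt.
- by move: eH eN; clear; lia.
Qed.

Definition N1 (H : {set V}) : {set V} := H :|: [set u | [exists w in H, e u w]].

Lemma sees_ball (H : {set V}) j p u : sees e j (inH H) p u -> u \in iter j N1 H.
Proof.
elim: j p u => [//|j IH] p u /= /existsP[w /andP[]]; rewrite inE => /andP[uw _] /IH wj.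
by rewrite /N1 !inE; apply/orP; right; apply/existsP; exists w; rewrite wj.
Qed.

Lemma iter_N1_mono (H : {set V}) i j : (i <= j)%N -> iter i N1 H \subset iter j N1 H.
Proof.
move=> /subnK <-; elim: (j - i)%N => [//|m IH]; rewrite addSn iterS.
by apply: subset_trans IH _; rewrite /N1 finset.subsetUl.
Qed.

Lemma card_near_H d (H : {set V}) :
  (#|[set u | near_H e d H None u]| <= #|iter d.+1 N1 H|)%N.
Proof.
apply: subset_leq_card; apply/subsetP => u; rewrite inE => /existsP[[i ile] /= /sees_ball].
have le : (i <= d.+1)%N := ile.
exact: (subsetP (iter_N1_mono H le)).
Qed.

(** A degree is either at most [A], or at most its square divided by [A]; [A] is optimised later. *)
Lemma card_N1 (H : {set V}) A : (A * #|N1 H| <= (A + A * A) * #|H| +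
   \sum_(v : V) #|[set w | e v w]| ^ 2)%N.
Proof.
have h1 : (#|N1 H| <= #|H| + \sum_(v in H) #|[set w | e v w]|)%N.
  rewrite /N1 cardsU; apply: leq_trans (leq_subr _ _) _; rewrite leq_add2l.
  have sub : [set u | [exists w in H, e u w]] \subset \bigcup_(v in H) [set w | e v w].
    apply/subsetP => u; rewrite inE => /existsP[w /andP[wH uw]].
    by apply/bigcupP; exists w => //; rewrite inE esym.
  apply: leq_trans (subset_leq_card sub) _.
  elim/big_rec2: _ => [|v m s _ le]; first by rewrite cards0.
  by rewrite cardsU; apply: leq_trans (leq_subr _ _) _; rewrite leq_add2l.
have h2 : (A * \sum_(v in H) #|[set w | e v w]| <= A * A * #|H| +
    \sum_(v in H) #|[set w | e v w]| ^ 2)%N.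
  rewrite mulnC big_distrl/= mulnC -sum_nat_const -big_split/=; apply: leq_sum => v _.
  rewrite -mulnn; case/orP: (leq_total A #|[set w | e v w]|) => le.
    by apply: (leq_trans _ (leq_addl _ _)); rewrite leq_mul2l le orbT.
  by apply: (leq_trans _ (leq_addr _ _)); rewrite leq_mul2r le orbT.
have h3 : (\sum_(v in H) #|[set w | e v w]| ^ 2 <= \sum_(v : V) #|[set w | e v w]| ^ 2)%N.
  by rewrite big_mkcond; apply: leq_sum => v _; case: ifP.
have h4 := leq_mul (leqnn A) h1; move: h2 h3 h4; rewrite mulnDr; lia.
Qed.

End Closure.

(** The bound on squared degrees makes high degrees negligible even on a set chosen depending on the
    graph. At each step the truncation level [A] is about [2 * L / eps], and the smallness of the
    preceding ball absorbs the rest. *)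
Lemma iter_N1_small (R : archiRealFieldType) (L : nat) j (eps : R) : 0 < eps ->
  exists2 delta : R, 0 < delta & forall (V : finType) (e : rel V) (H : {set V}), symmetric e ->
    (\sum_(v : V) #|[set w | e v w]| ^ 2 <= L * #|V|)%N ->
    #|H|%:R <= delta * #|V|%:R -> #|iter j (N1 e) H|%:R <= eps * #|V|%:R.
Proof.
elim: j eps => [|j IH] eps e0; first by exists eps.
pose A := (Num.bound (2 * L%:R / eps)).+1.
have A0 : 0 < A%:R :> R by rewrite ltr0n.
have LA : 2 * L%:R <= eps * A%:R.
  have h0 : 0 <= 2 * L%:R / eps by rewrite divr_ge0 ?mulr_ge0 ?ler0n// ltW.
  rewrite [leRHS]mulrC -ler_pdivrMr//; apply: (le_trans (ltW (archi_boundP h0))).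
  by rewrite ler_nat leqnSn.
have [|delta d0 IHd] := IH (eps / (2 * (1 + A%:R))).
  by rewrite divr_gt0// mulr_gt0// addr_gt0.
exists delta => // V e H es deg HV; have := IHd V e H es deg HV.
rewrite iterS; move: (iter j _ H) => X leX.
have := card_N1 es X A; rewrite -(ler_nat R) natrM natrD natrM natrD natrM => cN.
move: deg; rewrite -(ler_nat R) natrM => deg.
have {}leX : (1 + A%:R) * #|X|%:R <= eps / 2 * #|V|%:R.
  apply: (le_trans (ler_wpM2l _ leX)); first by rewrite addr_ge0.
  by rewrite le_eqVlt; apply/orP; left; apply/eqP; field; lra.
rewrite -(ler_pM2l A0); apply: (le_trans cN).
have h1 : A%:R * ((1 + A%:R) * #|X|%:R) <= A%:R * (eps / 2 * #|V|%:R).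
  by rewrite ler_wpM2l// ltW.
have h2 : 2 * L%:R * #|V|%:R <= eps * A%:R * #|V|%:R by rewrite ler_wpM2r.
lra.
Qed.

(** * Locality of the exploration *)

Section Locality.
Variables (V : finType) (k : nat).

Lemma loc_congr (e e' : rel V) sch m (U : {set V}) u : u \notin U ->
  (forall a b, a \in u |: U -> b \in u |: U -> a != b -> e a b = e' a b) ->
  loc e k sch m U u = loc e' k sch m U u.
Proof.
elim: sch m U u => [//|r sch IH] m U u uU ee' /=.
have -> : [set w in U | e u w] = [set w in U | e' u w].
  apply/setP => w; rewrite !inE; case wU: (w \in U) => //=.
  by apply: ee'; rewrite ?inE ?eqxx ?wU ?orbT//; apply: contraNneq uU => ->.
apply: eq_step => w; rewrite inE => /andP[wU _]; apply: IH => [|a b].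
  by rewrite !inE eqxx.
rewrite finset.setD1K// => aU bU; apply: ee'; rewrite inE ?aU ?bU orbT//.
Qed.

Lemma loc_stable (e : rel V) r sch m (U : {set V}) u z :
  loc e k (r :: sch) m U u != loc e k (r :: sch) m (U :\ z) u ->
  e u z \/ exists w, [/\ w \in U :\ z, e u w &
    loc e k sch k.-1 (U :\ w) w != loc e k sch k.-1 (U :\ w :\ z) w].
Proof.
move=> neq; have [uz|uz] := boolP (e u z); first by left.
right; have [/existsP[w /and3P[]]|] := boolP [exists w, [&& w \in U :\ z, e u w &
    loc e k sch k.-1 (U :\ w) w != loc e k sch k.-1 (U :\ w :\ z) w]].
  by exists w.
rewrite negb_exists => /forallP nex; case/eqP: neq => /=.
have -> : [set w in U :\ z | e u w] = [set w in U | e u w].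
  apply/setP => w; rewrite !inE; case: eqP => [->|//]; by rewrite (negbTE uz) !andbF.
apply: eq_step => w; rewrite inE => /andP[wU uw].
have wz : w != z by apply: contraNneq uz => <-.
have := nex w; rewrite !inE wz wU uw/= negbK => /eqP ->.
by congr loc; apply/setP => x; rewrite !inE andbCA.
Qed.

End Locality.

Section Edges.
Variable n : nat.
Implicit Types (u w a b : 'I_n) (U : {set 'I_n}) (E : {set 'I_n * 'I_n}).

(** Edges are stored as increasing pairs; this is the stored form of an unordered pair. *)
Definition ed u w : 'I_n * 'I_n := if (u < w)%N then (u, w) else (w, u).

Definition inner U : {set 'I_n * 'I_n} := [set q in pairsn n | (q.1 \in U) && (q.2 \in U)].

Lemma edC u w : ed u w = ed w u.
Proof.
rewrite /ed; case: ltngtP => // /eqP h.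
by rewrite (_ : u = w)//; apply/val_inj/eqP.
Qed.

Lemma ed_pairsn u w : u != w -> ed u w \in pairsn n.
Proof.
move=> uw; rewrite /ed inE; case: ifP => //= h.
by rewrite ltn_neqAle leqNgt h andbT eq_sym.
Qed.

Lemma ed_inj2 a b c d : ed a b = ed c d -> (a = c /\ b = d) \/ (a = d /\ b = c).
Proof. by rewrite /ed; case: ifP => _; case: ifP => _ [-> ->]; tauto. Qed.

Lemma adj_ed E u w : E \subset pairsn n -> adj E u w = (ed u w \in E).
Proof.
move=> /subsetP EP; rewrite /adj /ed; case: ltngtP => h.
- case: (boolP ((w, u) \in E)) => [/EP|]; last by rewrite orbF.
  by rewrite inE /= ltnNge ltnW.
- case: (boolP ((u, w) \in E)) => [/EP|//].
  by rewrite inE /= ltnNge ltnW.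
- by rewrite (_ : u = w) ?orbb//; apply/val_inj.
Qed.

Lemma adj_sym E : symmetric (adj E).
Proof. by move=> a b; rewrite /adj orbC. Qed.

Lemma adj_irr E u : E \subset pairsn n -> ~~ adj E u u.
Proof. by move=> /subsetP EP; apply/negP; rewrite /adj orbb => /EP; rewrite inE /= ltnn. Qed.

Lemma inner_sub U : inner U \subset pairsn n.
Proof. by apply/subsetP => q; rewrite inE => /andP[]. Qed.

Lemma ed_inner U a b : a != b -> (ed a b \in inner U) = (a \in U) && (b \in U).
Proof.
move=> ab; rewrite inE ed_pairsn//= /ed; case: ifP => _ //=.
by rewrite andbC.
Qed.

Lemma ed_injr u : injective (ed u).
Proof. by move=> w w' /ed_inj2 [[]//|[-> ->]]. Qed.

Lemma innerU1 u U : u \notin U -> inner (u |: U) = inner U :|: ed u @: U.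
Proof.
move=> uU; apply/setP => -[a b]; rewrite !inE /=.
apply/andP/orP => [[ab /andP[aU bU]]|].
- case/orP: aU => [/eqP au|aU].
    right; apply/imsetP; exists b; last by rewrite -au /ed ab.
    by case/orP: bU => // /eqP ba; rewrite au ba ltnn in ab.
  case/orP: bU => [/eqP bu|bU]; last by left; rewrite ab aU bU.
  right; apply/imsetP; exists a => //; rewrite -bu /ed ltnNge ltnW//.
- case=> [/and3P[-> -> ->]|/imsetP[w wU abE]]; first by rewrite !orbT.
  have uw : u != w by apply: contraNneq uU => ->.
  move: abE (ed_pairsn uw); rewrite /ed; case: ifP => _ [-> ->]; rewrite inE /= => ->;
    by rewrite !eqxx wU ?orbT.
Qed.

Lemma inner_star_disj u U : u \notin U -> [disjoint inner U & ed u @: U].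
Proof.
move=> uU; rewrite -setI_eq0; apply/eqP/setP => q; rewrite !inE.
apply/negP => /andP[/andP[_ /andP[q1 q2]] /imsetP[w wU qE]]; subst q.
by move: q1 q2 uU; rewrite /ed; case: ifP => _ /= q1 q2 /negP; apply.
Qed.

Lemma loc_inner k sch m U u E (X : {set 'I_n * 'I_n}) : E \subset pairsn n ->
  u \notin U -> inner (u |: U) \subset X ->
  loc (adj E) k sch m U u = loc (adj (E :&: X)) k sch m U u.
Proof.
move=> EP uU /subsetP iX; apply: loc_congr => // a b aU bU ab.
have sub : E :&: X \subset pairsn n by rewrite subIset// EP.
rewrite !adj_ed// inE; case: (ed a b \in E) => //=.
by rewrite iX// ed_inner// aU bU.
Qed.

End Edges.

(** * Effect of deleting one vertex on the exploration *)

Section Stability.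
Variables (R : realFieldType) (n : nat) (p : 'I_n * 'I_n -> R) (c : R) (k : nat).
Hypothesis p01 : forall q, 0 <= p q <= 1.
Hypothesis pc : forall q, p q <= c / n%:R.
Hypothesis n0 : (0 < n)%N.
Hypothesis c0 : 0 <= c.

Let cn0 : 0 <= c / n%:R. Proof. by rewrite divr_ge0. Qed.

Lemma sum_le_n (U : {set 'I_n}) (x : R) : 0 <= x -> \sum_(w in U) x <= n%:R * x.
Proof.
move=> x0; rewrite sumr_const -[leLHS]mulr_natl ler_wpM2r// ler_nat.
by rewrite -[leqRHS]card_ord max_card.
Qed.

Lemma Ex_adj (f : {set 'I_n * 'I_n} -> R) u w : u != w ->
  (forall E, f (ed u w |: E) = f (E :\ ed u w)) ->
  Ex p (pairsn n) (fun E => (adj E u w)%:R * f E) = p (ed u w) * Ex p (pairsn n) f.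
Proof.
move=> uw fE; rewrite -Ex_edge//; last exact: ed_pairsn.
by apply: eq_Ex => E EP; rewrite adj_ed.
Qed.

(** This is [c + c^2 + ... + c^h], a bound for [n] times the expected number of walks of length at
    most [h] to a prescribed vertex. *)
Fixpoint stab (h : nat) : R := if h is h'.+1 then c * (1 + stab h') else 0.

Lemma stab_ge0 h : 0 <= stab h.
Proof. by elim: h => //= h IH; rewrite mulr_ge0// addr_ge0. Qed.

Lemma adj_toggle (u w a b : 'I_n) E : (a != u) -> (b != u) ->
  adj (ed u w |: E) a b = adj (E :\ ed u w) a b.
Proof.
move=> au bu; rewrite /adj !inE.
have h x y : x != u -> y != u -> ((x, y) == ed u w) = false.
  move=> xu yu; apply/negbTE/eqP; rewrite /ed; case: ifP => _ [? ?].
    by subst; rewrite eqxx in xu.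
  by subst; rewrite eqxx in yu.
by rewrite !h.
Qed.

(** Deleting [z] matters only if the exploration reaches [z]. This is a first-moment bound over the
    walks from [u] to [z]. *)
Lemma loc_stability sch m (U : {set 'I_n}) u z : u \notin U -> z \in U ->
  Ex p (pairsn n) (fun E => (loc (adj E) k sch m U u != loc (adj E) k sch m (U :\ z) u)%:R)
    <= stab (size sch) / n%:R.
Proof.
elim: sch m U u => [|r sch IH] m U u uU zU.
  by rewrite /= mul0r Ex_cst.
have uz : u != z by apply: contraNneq uU => ->.
apply: (@le_trans _ _ (Ex p (pairsn n) (fun E => (adj E u z)%:R * 1 +
   \sum_(w in U :\ z) (adj E u w)%:R *
     (loc (adj E) k sch k.-1 (U :\ w) w != loc (adj E) k sch k.-1 (U :\ w :\ z) w)%:R))).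
  apply: ler_Ex => // E _; have [|] := boolP (_ != _); last first.
    by rewrite addr_ge0 ?mulr_ge0// sumr_ge0// => w _; rewrite mulr_ge0.
  case/loc_stable => [-> |[w [wU uw neq]]].
    by rewrite mulr1 lerDl sumr_ge0// => w _; rewrite mulr_ge0.
  rewrite (bigD1 w)//= uw neq !mulr1 addrCA lerDl addr_ge0// sumr_ge0// => w' _.
  by rewrite mulr_ge0.
rewrite ExD Ex_sum Ex_adj// Ex_cst mulr1.
have h w : w \in U :\ z -> Ex p (pairsn n) (fun E => (adj E u w)%:R *
     (loc (adj E) k sch k.-1 (U :\ w) w != loc (adj E) k sch k.-1 (U :\ w :\ z) w)%:R)
   <= c / n%:R * (stab (size sch) / n%:R).
  rewrite !inE => /andP[wz wU]; have uw : u != w by apply: contraNneq uU => ->.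
  (* Below [w] only edges inside [U] are inspected and [u] is not in [U], so the edge from [u] to
     [w] is independent of what follows. *)
  rewrite Ex_adj//; last first.
    move=> E; congr (nat_of_bool (~~ (_ == _)))%:R; apply: loc_congr;
      rewrite ?inE ?eqxx ?andbF//= => a b; rewrite !inE => aU bU _; apply: adj_toggle.
    - by apply: contraNneq uU => <-; case/orP: aU => [/eqP ->//|/andP[]].
    - by apply: contraNneq uU => <-; case/orP: bU => [/eqP ->//|/andP[]].
    - by apply: contraNneq uU => <-; case/orP: aU => [/eqP ->//|/and3P[]].
    - by apply: contraNneq uU => <-; case/orP: bU => [/eqP ->//|/and3P[]].
  have /andP[p0 _] := p01 (ed u w).
  apply: ler_pM => //; first by apply: Ex_ge0.
  by apply: IH; rewrite !inE ?eqxx// eq_sym wz zU.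
have hs : \sum_(w in U :\ z) Ex p (pairsn n) (fun E => (adj E u w)%:R *
     (loc (adj E) k sch k.-1 (U :\ w) w != loc (adj E) k sch k.-1 (U :\ w :\ z) w)%:R)
   <= n%:R * (c / n%:R * (stab (size sch) / n%:R)).
  by apply: (le_trans (ler_sum _ h)); apply: sum_le_n; rewrite mulr_ge0// divr_ge0// stab_ge0.
apply: (le_trans (lerD (pc _) hs)).
by rewrite le_eqVlt; apply/orP; left; apply/eqP => /=; field; rewrite pnatr_eq0 -lt0n.
Qed.

End Stability.

(** * Poisson tails and the limit recursion *)

Section PoissonTails.
Import all_classical all_reals all_analysis.
Import Order.TTheory GRing.Theory Num.Theory.
Import numFieldNormedType.Exports.
Local Open Scope classical_set_scope.
Local Open Scope ring_scope.

Section Poisson.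
Variable R : realType.
Implicit Types (y z t : R) (j m : nat).

Definition pois j y : R := expR (- y) * (y ^+ j / j`!%:R).

Definition pois1 j y : R := if j is j'.+1 then pois j' y else 0.

(* [psi m y] is the probability that a Poisson variable of mean [y] is at least [m] *)
Definition psi m y : R := 1 - \sum_(j < m) pois j y.

Lemma MVT_le (f df : R -> R) (a b : R) : a <= b ->
  (forall x, a <= x -> x <= b -> is_derive x 1 f (df x)) ->
  exists c, [/\ a <= c, c <= b & f b - f a = df c * (b - a)].
Proof.
move=> ab fd; have [||c] := MVT_segment (f := f) (df := df) ab.
- by move=> x; rewrite in_itv/= => /andP[ax xb]; apply: fd; exact: ltW.
- apply: derivable_within_continuous => x; rewrite in_itv/= => /andP[ax xb].
  by have [] := fd x ax xb.
- by rewrite in_itv/= => /andP[? ?] E; exists c.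
Qed.

Lemma pois_ge0 j y : 0 <= y -> 0 <= pois j y.
Proof. by move=> y0; rewrite mulr_ge0 ?expR_ge0// divr_ge0 ?exprn_ge0. Qed.

Lemma pois_le1 j y : 0 <= y -> pois j y <= 1.
Proof.
move=> y0; rewrite /pois expRN mulrC ler_pdivrMr ?expR_gt0// mul1r.
case: j => [|j]; first by rewrite expr0 fact0 divr1 -expR0 ler_expR.
by apply: le_trans (expR_ge1Dxn j y0); rewrite lerDr.
Qed.

Lemma pois1_ge0 j y : 0 <= y -> 0 <= pois1 j y.
Proof. by case: j => //= j; exact: pois_ge0. Qed.

Lemma pois1_le1 j y : 0 <= y -> pois1 j y <= 1.
Proof. by case: j => //= j; exact: pois_le1. Qed.

Let fact_neq0 j : j`!%:R != 0 :> R.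
Proof. by rewrite pnatr_eq0 -lt0n fact_gt0. Qed.

Lemma is_derive_powfact m (c : R) y :
  is_derive y 1 (fun x => c * (x ^+ m.+1 / m.+1`!%:R)) (c * (y ^+ m / m`!%:R)).
Proof.
have -> : (fun x : R => c * (x ^+ m.+1 / m.+1`!%:R)) =
    (c / m.+1`!%:R) \*: ((@idfun R) ^+ m.+1 : R -> R).
  by apply/funext => x; rewrite /= fctE /GRing.scale/=; ring.
apply: is_derive_eq; rewrite /GRing.scale/= factS natrM mulr1; field.
by rewrite fact_neq0/= addrC natr1 pnatr_eq0.
Qed.

Lemma is_derive_expN y : is_derive y 1 (fun x : R => expR (- x)) (- expR (- y)).
Proof.
have -> : (fun x : R => expR (- x)) = expR \o -%R by [].
by apply: is_derive_eq; rewrite mulrN1.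
Qed.

Lemma is_derive_pois j y : is_derive y 1 (pois j) (pois1 j y - pois j y).
Proof.
have h1 := is_derive_expN y.
case: j => [|j] /=.
  have -> : pois 0 = fun x => expR (- x).
    by apply/funext => x; rewrite /pois expr0 fact0 divr1 mulr1.
  by apply: is_derive_eq; rewrite sub0r.
have h2 := is_derive_powfact j 1 y.
have -> : pois j.+1 = (fun x => expR (- x)) * (fun x => 1 * (x ^+ j.+1 / j.+1`!%:R)).
  by apply/funext => x; rewrite /pois fctE mul1r.
apply: is_derive_eq; rewrite /pois /GRing.scale/= fctE; ring.
Qed.

Lemma is_derive_psi m y : is_derive y 1 (psi m) (pois1 m y).
Proof.
elim: m => [|m IH].
  have -> : psi 0 = cst 1 by apply/funext => x; rewrite /psi big_ord0 subr0.
  exact: is_derive_cst.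
have -> : psi m.+1 = psi m - pois m.
  by apply/funext => x; rewrite /psi fctE big_ord_recr/= opprD addrA.
have h := is_derive_pois m y; apply: is_derive_eq.
rewrite -[RHS]/(pois m y); ring.
Qed.

Lemma psi_mono m y z : 0 <= z -> z <= y -> psi m z <= psi m y.
Proof.
move=> z0 zy; have [c [zc _ E]] := MVT_le zy (fun x _ _ => is_derive_psi m x).
by rewrite -subr_ge0 E mulr_ge0 ?subr_ge0// pois1_ge0// (le_trans z0).
Qed.

Lemma psi_at0 m : psi m.+1 0 = 0.
Proof.
rewrite /psi big_ord_recl/= big1 ?addr0 => [|i _].
  by rewrite /pois oppr0 expR0 expr0 fact0 divr1 mulr1 subrr.
by rewrite /pois expr0n mul0r mulr0.
Qed.

Lemma psi_ge0 m y : 0 <= y -> 0 <= psi m y.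
Proof.
move=> y0; case: m => [|m]; first by rewrite /psi big_ord0 subr0.
by rewrite -(psi_at0 m) psi_mono.
Qed.

Lemma psi_le1 m y : 0 <= y -> psi m y <= 1.
Proof. by move=> y0; rewrite gerBl sumr_ge0// => j _; exact: pois_ge0. Qed.

Lemma psiS m y : psi m y = psi m.+1 y + pois m y.
Proof. by rewrite /psi big_ord_recr/=; ring. Qed.

Lemma pois_lip j y z : 0 <= y -> 0 <= z -> `|pois j y - pois j z| <= `|y - z|.
Proof.
wlog zy : y z / z <= y.
  move=> H y0 z0; case/orP: (le_total z y) => h; first exact: H.
  by rewrite distrC (distrC y); exact: H.
move=> y0 z0; have [c [zc cy ->]] := MVT_le zy (fun x _ _ => is_derive_pois j x).
have c0 := le_trans z0 zc.
rewrite normrM ler_piMl// ler_norml.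
have := pois_ge0 j c0; have := pois_le1 j c0; have := pois1_ge0 j c0.
have := pois1_le1 j c0; lra.
Qed.

Lemma pois1_lip j y z : 0 <= y -> 0 <= z -> `|pois1 j y - pois1 j z| <= `|y - z|.
Proof. by case: j => [|j]; [rewrite subrr normr0|exact: pois_lip]. Qed.

Lemma psi_lip m y z : 0 <= y -> 0 <= z -> `|psi m y - psi m z| <= `|y - z|.
Proof.
wlog zy : y z / z <= y.
  move=> H y0 z0; case/orP: (le_total z y) => h; first exact: H.
  by rewrite distrC (distrC y); exact: H.
move=> y0 z0; have [c [zc cy ->]] := MVT_le zy (fun x _ _ => is_derive_psi m x).
have c0 := le_trans z0 zc.
by rewrite normrM ler_piMl// ger0_norm ?pois1_ge0// pois1_le1.
Qed.

(** One step of Le Cam's method: a Bernoulli variable of mean [t] replaces a Poisson one. The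
    derivative of [pois j] varies by at most [2 * t] over an interval of length [t]. *)
Lemma pois_step j y t : 0 <= y -> 0 <= t ->
  `|pois j (y + t) - ((1 - t) * pois j y + t * pois1 j y)| <= 2 * t ^+ 2.
Proof.
move=> y0 t0; have [|c [yc cy E]] := @MVT_le (pois j) (fun x => pois1 j x - pois j x) y (y + t) _
  (fun x _ _ => is_derive_pois j x); first by rewrite lerDl.
have -> : pois j (y + t) - ((1 - t) * pois j y + t * pois1 j y) =
   ((pois1 j c - pois1 j y) - (pois j c - pois j y)) * t.
  by have -> : pois j (y + t) = pois j y + (pois1 j c - pois j c) * (y + t - y);
    [rewrite -E; ring|ring].
rewrite normrM (ger0_norm t0) expr2 mulrA ler_wpM2r//.
have c0 := le_trans y0 yc.
have h1 := pois_lip j c0 y0; have h2 := pois1_lip j c0 y0.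
apply: (le_trans (ler_normB _ _)); apply: (le_trans (lerD h2 h1)).
by rewrite ger0_norm ?subr_ge0//; lra.
Qed.

(** The derivative of [psi m.+1] at [x] is [expR (- x) * x ^+ m / m!]; for [x <= y] the exponential
    is bounded below by [expR (- y)] and the power is integrated exactly. *)
Lemma psi_gap m y z : 0 <= z -> z <= y ->
  expR (- y) * ((y ^+ m.+1 - z ^+ m.+1) / m.+1`!%:R) <= psi m.+1 y - psi m.+1 z.
Proof.
move=> z0 zy.
pose g x := psi m.+1 x - expR (- y) * (x ^+ m.+1 / m.+1`!%:R).
have gd (x : R) : is_derive x 1 g (pois m x - expR (- y) * (x ^+ m / m`!%:R)).
  have h1 := is_derive_psi m.+1 x; have h2 := is_derive_powfact m (expR (- y)) x.
  exact: is_deriveB.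
have [c [zc cy E]] := MVT_le zy (fun x _ _ => gd x).
have : 0 <= g y - g z.
  rewrite E mulr_ge0 ?subr_ge0// /pois ler_wpM2r ?ler_expR ?lerN2//.
  by rewrite divr_ge0// exprn_ge0// (le_trans z0).
rewrite /g; move: (psi _ _) (psi _ _) => p q; lra.
Qed.

Lemma psi_strict m y z : 0 <= z -> z < y -> psi m.+1 z < psi m.+1 y.
Proof.
move=> z0 zy; rewrite -subr_gt0; apply: lt_le_trans (psi_gap m z0 (ltW zy)).
by rewrite mulr_gt0 ?expR_gt0// divr_gt0 ?ltr0n ?fact_gt0// subr_gt0 ltrXn2r// ltW.
Qed.

Lemma powD_convex m u v t : 0 <= u -> 0 <= v -> 0 <= t -> t <= 1 ->
  (u + t * v) ^+ m <= (1 - t) * u ^+ m + t * (u + v) ^+ m.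
Proof.
move=> u0 v0 t0 t1; elim: m => [|m IH]; first by rewrite !expr0; lra.
rewrite !exprS.
have w0 : 0 <= u + t * v by rewrite addr_ge0// mulr_ge0.
apply: (le_trans (ler_wpM2l w0 IH)).
have h : 0 <= t * (1 - t) * (v * ((u + v) ^+ m - u ^+ m)).
  rewrite mulr_ge0 ?mulr_ge0 ?subr_ge0//.
  by rewrite lerXn2r// ?nnegrE ?addr_ge0// lerDl.
move: ((u + v) ^+ m) (u ^+ m) h => a b h; lra.
Qed.

(* Thinning: a vertex which just fails to be robust needs one pivotal child to survive. *)
Lemma psi_thin m u v t : 0 <= u -> 0 <= v -> 0 <= t -> t <= 1 ->
  psi m.+1 (u + t * v) <= t * psi m.+1 (u + v) +
    (1 - t) * (psi m.+2 (u + v) + expR (- (u + v)) * (u ^+ m.+1 / m.+1`!%:R)).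
Proof.
move=> u0 v0 t0 t1.
have le : u + t * v <= u + v by rewrite lerD2l ler_piMl.
have w0 : 0 <= u + t * v by rewrite addr_ge0// mulr_ge0.
have gap := psi_gap m w0 le; have cx := powD_convex m.+1 u0 v0 t0 t1.
have S := psiS m.+1 (u + v).
have F0 : 0 <= expR (- (u + v)) / m.+1`!%:R by rewrite divr_ge0 ?expR_ge0.
have := ler_wpM2l F0 cx; move: S gap; rewrite /pois.
set e := expR _; set f := (m.+1`!%:R)^-1; set p := (u + v) ^+ _; set q := (_ + _) ^+ _.
set r := u ^+ _; set a := psi _ _; set b := psi _ _; set c := psi _ _ => S gap h.
suff : e * (p * f) * (1 - t) <= (a - c) + (1 - t) * (e * (r * f)).
  rewrite S; lra.
lra.
Qed.

End Poisson.

(** * Limit recursion for alive and robust vertices *)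

Section Recursion.
Variables (R : realType) (r : nat) (kap : 'I_r -> 'I_r -> R) (mu : 'I_r -> R).
Hypothesis kap_ge0 : forall i j, 0 <= kap i j.
Hypothesis mu_ge0 : forall i, 0 <= mu i.

Definition Kop (q : 'I_r -> R) (i : 'I_r) : R := \sum_j kap i j * mu j * q j.

Lemma Kop_le q q' i : (forall j, q j <= q' j) -> Kop q i <= Kop q' i.
Proof. by move=> le; apply: ler_sum => j _; rewrite ler_wpM2l// mulr_ge0. Qed.

Lemma Kop_ge0 q i : (forall j, 0 <= q j) -> 0 <= Kop q i.
Proof. by move=> q0; apply: sumr_ge0 => j _; rewrite !mulr_ge0. Qed.

Lemma KopD q q' i : Kop (fun j => q j + q' j) i = Kop q i + Kop q' i.
Proof. by rewrite /Kop -big_split; apply: eq_bigr => j _; rewrite mulrDr. Qed.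

Lemma KopZ c q i : Kop (fun j => c * q j) i = c * Kop q i.
Proof. by rewrite /Kop mulr_sumr; apply: eq_bigr => j _; ring. Qed.

Lemma Kop0 i : Kop (fun=> 0) i = 0.
Proof. by rewrite /Kop big1// => j _; rewrite mulr0. Qed.

Variable k : nat.

(** The alive children are Poisson of mean [y] and the robust ones a thinning of mean [u]. A robust
    vertex has more than [m] alive children, or exactly [m] alive children, all robust; the latter
    has probability [expR (- (y - u))] times [pois m u]. After a reset no child counts as robust, so
    [u = 0]. *)
Fixpoint lim_loc (sch : seq bool) (m : nat) (i : 'I_r) : R * R :=
  if sch is b :: sch' then
    let y := Kop (fun j => if b then (lim_loc sch' k.-1 j).2 else (lim_loc sch' k.-1 j).1) i in
    let u := Kop (fun j => if b then 0 else (lim_loc sch' k.-1 j).2) i in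
    (psi m y, psi m.+1 y + expR (- y) * (u ^+ m / m`!%:R))
  else (1, 1).

Lemma lim_loc_bounds sch m i :
  [/\ 0 <= (lim_loc sch m i).2, (lim_loc sch m i).2 <= (lim_loc sch m i).1 &
      (lim_loc sch m i).1 <= 1].
Proof.
elim: sch m i => [|b sch IH] m i /=; first by rewrite ler01 !lexx.
set y := Kop _ i; set u := Kop _ i.
have u0 : 0 <= u.
  by apply: Kop_ge0 => j; case: (b) => //; have [] := IH k.-1 j.
have uy : u <= y.
  by apply: Kop_le => j; case: (b) => //; have [] := IH k.-1 j.
have y0 := le_trans u0 uy.
split; last exact: psi_le1.
  by rewrite addr_ge0 ?psi_ge0// mulr_ge0 ?expR_ge0// divr_ge0// exprn_ge0.
rewrite (psiS m y) lerD2l /pois ler_wpM2l ?expR_ge0// ler_wpM2r ?invr_ge0//.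
by rewrite lerXn2r ?nnegrE.
Qed.

Section Block.
Variables (a : R) (q : 'I_r -> R).
Hypotheses (a0 : 0 <= a) (a1 : a <= 1) (q0 : forall i, 0 <= q i).
Hypothesis k2 : (2 <= k)%N.

Fixpoint thinned (l : nat) : 'I_r -> R :=
  if l is l'.+1 then fun i => psi k.-1 (a * Kop (thinned l') i) else q.

Lemma thinned_ge0 l i : 0 <= thinned l i.
Proof.
by elim: l i => [//|l IH] i /=; rewrite psi_ge0// mulr_ge0// Kop_ge0.
Qed.

(** When edges are kept with probability [a], a vertex that is alive but not robust depends on one
    pivotal child in each of the [l.+1] generations, and keeping all of them has probability
    [a ^+ l.+1]. Analytically this is [psi_thin] iterated. *)
Lemma block_thinned sch (l m : nat) i : (0 < m)%N ->
  (forall j, q j <= (lim_loc sch k.-1 j).2) ->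
  psi m (a * Kop (thinned l) i) <=
  (lim_loc (nseq l false ++ true :: sch) m i).2 +
  a ^+ l.+1 * ((lim_loc (nseq l false ++ true :: sch) m i).1 -
               (lim_loc (nseq l false ++ true :: sch) m i).2).
Proof.
case: m => // m _ qS; elim: l m i => [|l IH] m i.
  rewrite [nseq _ _ ++ _]/= [lim_loc (_ :: _) _ _]/= Kop0.
  set y := Kop (fun j => (lim_loc sch k.-1 j).2) i.
  have le : Kop q i <= y by exact: Kop_le.
  have y0 : 0 <= y by apply: le_trans le; exact: Kop_ge0.
  have h : psi m.+1 (a * Kop q i) <= psi m.+1 (0 + a * y).
    by rewrite add0r psi_mono ?mulr_ge0 ?Kop_ge0// ler_wpM2l.
  apply: (le_trans h); apply: (le_trans (psi_thin m (lexx 0) y0 a0 a1)).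
  rewrite /= -/y !add0r expr1; lra.
rewrite [nseq _ _ ++ _]/= [lim_loc (_ :: _) _ _]/=.
set s := nseq l false ++ true :: sch.
set y := Kop (fun j => (lim_loc s k.-1 j).1) i.
set u := Kop (fun j => (lim_loc s k.-1 j).2) i.
have u0 : 0 <= u by apply: Kop_ge0 => j; have [] := lim_loc_bounds s k.-1 j.
have uy : u <= y by apply: Kop_le => j; have [] := lim_loc_bounds s k.-1 j.
set t := a ^+ l.+2.
have t0 : 0 <= t by rewrite exprn_ge0.
have t1 : t <= 1 by rewrite exprn_ile1.
have le : a * Kop (thinned l.+1) i <= u + t * (y - u).
  have h : Kop (thinned l.+1) i <= u + a ^+ l.+1 * (y - u).
    have -> : u + a ^+ l.+1 * (y - u) = Kop (fun j => (lim_loc s k.-1 j).2 +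
        a ^+ l.+1 * ((lim_loc s k.-1 j).1 + - 1 * (lim_loc s k.-1 j).2)) i.
      by rewrite KopD KopZ KopD KopZ mulN1r.
    apply: Kop_le => j; rewrite mulN1r /=.
    by have := IH k.-2 j; rewrite (_ : k.-2.+1 = k.-1) ?prednK//; lia.
  have := ler_wpM2l a0 h; rewrite mulrDr mulrA -exprS -/t => h2.
  by apply: (le_trans h2); rewrite lerD2r ler_piMl.
have w0 : 0 <= a * Kop (thinned l.+1) i.
  by rewrite mulr_ge0// Kop_ge0// => j; exact: thinned_ge0.
have yu0 : 0 <= y - u by rewrite subr_ge0.
apply: (le_trans (psi_mono m.+1 w0 le)); apply: (le_trans (psi_thin m u0 yu0 t0 t1)).
rewrite (_ : u + (y - u) = y); last by ring.
rewrite /= -/s -/y -/u; lra.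
Qed.

Lemma thinned_ge l i : (forall i, q i <= thinned 1 i) -> thinned l i <= thinned l.+1 i.
Proof.
move=> q1; elim: l i => [//|l IH] i.
rewrite [leRHS]/= [leLHS]/= psi_mono ?mulr_ge0 ?Kop_ge0//; first exact: thinned_ge0.
by rewrite ler_wpM2l// Kop_le.
Qed.

End Block.

Lemma exprn_small (a : R) (eps : R) : 0 <= a -> a < 1 -> 0 < eps ->
  exists N : nat, forall n, (N <= n)%N -> a ^+ n <= eps.
Proof.
move=> a0 a1 e0; have := @cvg_expr R a; rewrite ger0_norm// => /(_ a1).
move=> /cvgr0_norm_le/(_ _ e0)[N _ h].
exists N => n Nn; have := h n Nn; rewrite ger0_norm//; exact: exprn_ge0.
Qed.

(** An [a] strictly between [c] and 1 leaves a gap between [q] and its image wherever [q] is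
    positive. There are finitely many types, so one [d] makes [a ^+ d.+1] smaller than every gap.
    Then [q] stays below the robust probability from one block to the next, with the same [d] for
    all [T]. *)
Theorem robust_recursion (c : R) (q : 'I_r -> R) (eps : R) :
  (2 <= k)%N -> 0 <= c -> c < 1 -> (forall i, 0 <= q i) -> (forall i, q i <= 1) ->
  (forall i, q i <= psi k.-1 (c * Kop q i)) -> 0 < eps ->
  exists d, forall T i, psi k (c * Kop q i) - eps <= (lim_loc (sched d T) k i).2.
Proof.
move=> k2 c0 c1 q0 q1 qfix e0.
pose a := (c + 1) / 2.
have ca : c < a by rewrite /a; lra.
have a0 : 0 <= a by rewrite /a; lra.
have a1 : a < 1 by rewrite /a; lra.
have Kq0 i : 0 <= Kop q i by exact: Kop_ge0.
have up m i : psi m (c * Kop q i) <= psi m (a * Kop q i).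
  by rewrite psi_mono ?mulr_ge0// ler_wpM2r// ltW.
have t1 i : q i <= thinned a q 1 i by exact: le_trans (qfix i) (up _ i).
have k1E : k.-1 = k.-2.+1 by lia.
(* If [q i > 0] then [Kop q i > 0], because [psi k.-1] vanishes at 0 when [k >= 2]; strict
   monotonicity of [psi] then gives the gap. Where [q i = 0] there is nothing to preserve. *)
have gap i : exists N : nat, forall n, (N <= n)%N -> 0 < q i -> a ^+ n <= thinned a q 1 i - q i.
  have [qi|] := boolP (0 < q i); last by exists 0%N.
  have Ki : 0 < Kop q i.
    rewrite lt_neqAle Kq0 andbT eq_sym; apply/eqP => K0.
    by have := qfix i; rewrite K0 mulr0 k1E psi_at0 leNgt qi.
  have [|N h] := exprn_small a0 a1 (eps := thinned a q 1 i - q i).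
    rewrite subr_gt0; apply: le_lt_trans (qfix i) _ => /=; rewrite k1E.
    by rewrite psi_strict ?mulr_ge0// ltr_pM2r.
  by exists N => n Nn _; exact: h.
have [N gapN] := fin_all_exists gap.
have [N0 epsN] := exprn_small a0 a1 e0.
pose d := (N0 + \max_i N i)%N.
have dN i : (N i <= d.+1)%N.
  by rewrite /d; have := @leq_bigmax _ N i; lia.
exists d => T i.
have thin_up l : thinned a q 1 i <= thinned a q l.+1 i.
  by elim: l => // l IH; apply: le_trans IH _; exact: thinned_ge.
have qT T' j : q j <= (lim_loc (sched d T') k.-1 j).2.
  elim: T' j => [//|T' IH] j.
  have [S0 SE E1] := lim_loc_bounds (sched d T'.+1) k.-1 j.
  have [qj|qj] := boolP (0 < q j); last by apply: le_trans S0; rewrite leNgt.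
  have := @block_thinned a q a0 (ltW a1) q0 k2 (sched d T') d k.-1 j _ IH.
  rewrite -/(sched d T'.+1) => /(_ ltac:(lia)).
  rewrite -[psi _ _]/(thinned a q d.+1 j).
  have g := gapN j d.+1 (dN j) qj.
  have up1 l : thinned a q 1 j <= thinned a q l.+1 j.
    by elim: l => // l IHl; apply: le_trans IHl _; exact: thinned_ge.
  have := up1 d; have : a ^+ d.+1 * ((lim_loc (sched d T'.+1) k.-1 j).1 -
    (lim_loc (sched d T'.+1) k.-1 j).2) <= a ^+ d.+1.
    by rewrite ler_piMr ?exprn_ge0//; lra.
  lra.
have tq l j : q j <= thinned a q l j.
  elim: l j => [//|l IH] j; apply: le_trans (IH j) _; exact: thinned_ge.
case: T => [|T].
  have := @psi_le1 R k (c * Kop q i) (mulr_ge0 c0 (Kq0 i)) => /=; lra.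
(* The root needs [k] children instead of [k.-1], so the outermost block is treated apart and its
   loss is what [eps] pays for. *)
have [S0 SE E1] := lim_loc_bounds (sched d T.+1) k i.
have := @block_thinned a q a0 (ltW a1) q0 k2 (sched d T) d k i _ (qT T).
rewrite -/(sched d T.+1) => /(_ ltac:(lia)).
have h2 : a ^+ d.+1 * ((lim_loc (sched d T.+1) k i).1 -
    (lim_loc (sched d T.+1) k i).2) <= a ^+ d.+1.
  by rewrite ler_piMr ?exprn_ge0//; lra.
have h3 : a ^+ d.+1 <= eps by apply: epsN; rewrite /d; lia.
have h4 : psi k (c * Kop q i) <= psi k (a * Kop (thinned a q d) i).
  apply: le_trans (up k i) _; apply: psi_mono; first by rewrite mulr_ge0.
  apply: ler_wpM2l => //.
  by apply: Kop_le => j; exact: tq.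
lra.
Qed.

End Recursion.

(** * Limit of the survival probabilities for finitely many types *)

Section FixedPoint.
Variables (R : realType) (r : nat) (kap : 'I_r -> 'I_r -> R) (mu : 'I_r -> R).
Hypothesis kap_ge0 : forall i j, 0 <= kap i j.
Hypothesis mu_ge0 : forall i, 0 <= mu i.
Variable k : nat.

Fixpoint qseq (l : nat) : 'I_r -> R :=
  if l is l'.+1 then fun i => psi k.-1 (Kop kap mu (qseq l') i) else fun=> 1.

Lemma qseq_ge0 l i : 0 <= qseq l i.
Proof. by elim: l i => [//|l IH] i /=; rewrite psi_ge0// Kop_ge0. Qed.

Lemma qseq_le1 l i : qseq l i <= 1.
Proof. by case: l => //= l; rewrite psi_le1// Kop_ge0// => j; exact: qseq_ge0. Qed.

Lemma qseq_decS l i : qseq l.+1 i <= qseq l i.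
Proof.
elim: l i => [|l IH] i; first exact: qseq_le1.
rewrite [leLHS]/= [leRHS]/=; apply: psi_mono; last exact: Kop_le.
by apply: Kop_ge0 => // j; exact: (qseq_ge0 l.+1).
Qed.

Lemma qseq_dec l l' i : (l <= l')%N -> qseq l' i <= qseq l i.
Proof.
move=> /subnKC <-; elim: (l' - l)%N => [|j IH]; first by rewrite addn0.
by rewrite addnS; apply: le_trans (qseq_decS _ _) IH.
Qed.

(** [q] is the infimum of the decreasing iterates. The inequality between [q] and its image is the
    form that [robust_recursion] takes, and both claims pass to the limit because [psi] is
    1-Lipschitz. *)
Lemma qseq_limit : exists q : 'I_r -> R,
  [/\ forall i, 0 <= q i, forall i, q i <= 1,
      forall i, q i <= psi k.-1 (Kop kap mu q i) &
      forall beta, (forall l, beta <= \sum_i mu i * psi k (Kop kap mu (qseq l) i)) ->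
        beta <= \sum_i mu i * psi k (Kop kap mu q i)].
Proof.
pose A i := range (fun l => qseq l i).
have Ainf i : has_inf (A i).
  split; first by exists (qseq 0 i); exists 0%N.
  by exists 0 => _ [l _ <-]; exact: qseq_ge0.
pose q i := inf (A i).
have q_le l i : q i <= qseq l i by apply: ge_inf; [exact: (Ainf i).2|exists l].
have q0 i : 0 <= q i.
  by apply: lb_le_inf; [exact: (Ainf i).1|move=> _ [l _ <-]; exact: qseq_ge0].
pose C := \sum_i \sum_j kap i j * mu j.
have C0 : 0 <= C by apply: sumr_ge0 => i _; apply: sumr_ge0 => j _; rewrite mulr_ge0.
have close (eps : R) : 0 < eps -> exists l, forall m i,
    psi m (Kop kap mu (qseq l) i) <= psi m (Kop kap mu q i) + eps * C.
  move=> e0; have h i : exists l, qseq l i <= q i + eps.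
    by have [_ [l _ <-] /ltW] := inf_adherent e0 (Ainf i); exists l.
  have [L hL] := fin_all_exists h; exists (\max_i L i)%N => m i.
  have hl j : qseq (\max_i L i)%N j <= q j + eps.
    by apply: le_trans (hL j); apply: qseq_dec; exact: leq_bigmax.
  have Kq0 : 0 <= Kop kap mu q i by exact: Kop_ge0.
  have leK : Kop kap mu q i <= Kop kap mu (qseq (\max_i L i)%N) i by exact: Kop_le.
  have := @psi_lip R m _ _ (le_trans Kq0 leK) Kq0; rewrite ler_norml => /andP[_ lip].
  suff : `|Kop kap mu (qseq (\max_i L i)%N) i - Kop kap mu q i| <= eps * C by move: lip; lra.
  rewrite ger0_norm ?subr_ge0// lerBlDl.
  apply: (@le_trans _ _ (Kop kap mu (fun j => q j + eps * 1) i)).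
    by apply: Kop_le => // j; rewrite mulr1.
  rewrite KopD KopZ lerD2l; apply: ler_wpM2l; first exact: ltW.
  rewrite /C /Kop [leRHS](bigD1 i)//=.
  apply: ler_wpDr; last by apply: ler_sum => j _; rewrite mulr1.
  by apply: sumr_ge0 => i' _; apply: sumr_ge0 => j _; rewrite mulr_ge0.
have eps_le (x y D : R) : 0 <= D -> (forall eps, 0 < eps -> x <= y + eps * D) -> x <= y.
  move=> D0 h; rewrite leNgt; apply/negP => yx.
  have e0 : 0 < (x - y) / (2 * (D + 1)) by rewrite divr_gt0 ?subr_gt0//; lra.
  have := h _ e0; apply/negP; rewrite -ltNge -ltrBrDl.
  have -> : (x - y) / (2 * (D + 1)) * D = (x - y) * (D / (2 * (D + 1))) by field; lra.
  rewrite gtr_pMr ?subr_gt0// ltr_pdivrMr; lra.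
exists q; split => //.
- by move=> i; apply: le_trans (q_le 0%N i) _.
- move=> i; apply: (eps_le _ _ C) => // eps e0; have [l hl] := close eps e0.
  by apply: le_trans (hl k.-1 i); exact: (q_le l.+1).
- move=> beta hb; pose M := \sum_i mu i.
  have M0 : 0 <= M by apply: sumr_ge0.
  apply: (eps_le _ _ (C * M)); first exact: mulr_ge0.
  move=> eps e0; have [l hl] := close eps e0; apply: le_trans (hb l) _.
  rewrite /M mulrA mulr_sumr -big_split/=; apply: ler_sum => i _.
  by rewrite (mulrC (eps * C)) -mulrDr ler_wpM2l.
Qed.

End FixedPoint.

End PoissonTails.

(** * Law of large numbers for the exploration *)

Section LeCam.
Variables (R : realType) (V : finType) (p : V -> R).
Hypothesis p01 : forall i, 0 <= p i <= 1.
Implicit Types (X A B C : {set V}).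

Let p_ge0 i : 0 <= p i. Proof. by have /andP[] := p01 i. Qed.

(** Elements are added one at a time. Each costs [2 * p i ^+ 2] by [pois_step], and the earlier
    errors are averaged with weights [p i] and [1 - p i], hence not amplified. *)
Lemma le_cam X j :
  `|Ex p X (fun C => (#|C| == j)%:R) - pois j (\sum_(i in X) p i)| <=
  2 * \sum_(i in X) p i ^+ 2.
Proof.
elim/set_ind: X j => [|i X iX IH] j.
  rewrite Ex0 !big_set0 cards0 mulr0 /pois oppr0 expR0 expr0n mul1r eq_sym.
  by case: eqP => [->|]; rewrite ?fact0 ?divr1 ?mul0r subrr normr0.
rewrite Ex_setU1// !big_setU1//=.
set y := \sum_(l in X) p l; set s := \sum_(l in X) p l ^+ 2.
have y0 : 0 <= y by apply: sumr_ge0.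
pose E1 := if j is j'.+1 then Ex p X (fun C => (#|C| == j')%:R) else 0.
have -> : Ex p X (fun C => (#|i |: C| == j)%:R) = E1.
  rewrite /E1; case: (j) => [|j'].
    rewrite -[RHS](Ex_cst p X); apply: eq_Ex => C CX.
    by rewrite cardsU1; case: (i \in C) (subsetP CX i) => //= /(_ isT); rewrite (negbTE iX).
  apply: eq_Ex => C CX; rewrite cardsU1.
  by rewrite (_ : i \notin C) ?add1n ?eqSS//; apply: contra iX; exact: (subsetP CX).
have h1 : `|E1 - pois1 j y| <= 2 * s.
  rewrite /E1; case: (j) => [|j']; last exact: IH.
  by rewrite subrr normr0 mulr_ge0// sumr_ge0// => l _; rewrite sqr_ge0.
have h2 := IH j; have h3 := @pois_step R j y (p i) y0 (p_ge0 i).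
rewrite -/s -/y in h2; set E0 := Ex p X _ in h2 *; rewrite (addrC (p i) y).
have -> : p i * E1 + (1 - p i) * E0 - pois j (y + p i) =
   (p i * (E1 - pois1 j y) + (1 - p i) * (E0 - pois j y)) -
   (pois j (y + p i) - ((1 - p i) * pois j y + p i * pois1 j y)) by ring.
apply: (le_trans (ler_normB _ _)).
have /andP[pi0 pi1] := p01 i.
have h4 : `|p i * (E1 - pois1 j y) + (1 - p i) * (E0 - pois j y)| <= 2 * s.
  apply: (le_trans (ler_normD _ _)); rewrite !normrM (ger0_norm pi0).
  rewrite (ger0_norm (_ : 0 <= 1 - p i)) ?subr_ge0//.
  have pi1' : 0 <= 1 - p i by rewrite subr_ge0.
  have g1 := ler_wpM2l pi0 h1; have g2 := ler_wpM2l pi1' h2; lra.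
by rewrite [leRHS]mulrDr [leRHS]addrC; exact: lerD.
Qed.

Lemma le_cam_ge X m :
  `|Ex p X (fun C => (m <= #|C|)%N%:R) - psi m (\sum_(i in X) p i)| <=
  2 * m%:R * \sum_(i in X) p i ^+ 2.
Proof.
have -> : Ex p X (fun C => (m <= #|C|)%N%:R) =
    1 - \sum_(j < m) Ex p X (fun C => (#|C| == j)%:R).
  rewrite -Ex_sum -[X in X - _](Ex_cst p X) -ExB; apply: eq_Ex => C _.
  case: leqP => h.
    rewrite big1 ?subr0// => j _; rewrite (_ : _ == _ = false)//.
    by apply/negbTE; rewrite gtn_eqF//; apply: leq_trans h.
  rewrite (bigD1 (Ordinal h))//= eqxx big1 ?addr0 ?subrr// => j jh.
  by rewrite (_ : _ == _ = false)//; apply: contraNF jh => /eqP Cj; apply/eqP/val_inj.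
rewrite /psi opprB addrC addrA subrK -sumrB.
apply: (le_trans (ler_norm_sum _ _ _)).
apply: (le_trans (ler_sum _ (fun j _ => _ : _ <= 2 * \sum_(i in X) p i ^+ 2))).
  by move=> j _; rewrite distrC; exact: le_cam.
by rewrite sumr_const card_ord -mulr_natr; lra.
Qed.

Lemma Ex_restrict X A (f : {set V} -> R) : A \subset X ->
  Ex p X (fun C => f (C :&: A)) = Ex p A f.
Proof.
move=> AX; rewrite (@Ex_marginal _ _ p X A)// => [|E _].
  by apply: eq_Ex => C CA; rewrite (setIidPl CA).
by rewrite -setIA setIid.
Qed.

Section Step.
Variables (U : {set V}) (st : V -> bool * bool) (r : bool) (m : nat).
Hypothesis st_le : forall w, (st w).2 -> (st w).1.

Let a w := if r then (st w).2 else (st w).1.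
Let s w := ~~ r && (st w).2.
Let A := [set w in U | a w].
Let B := [set w in U | s w].

Let BA : B \subset A.
Proof.
apply/subsetP => w; rewrite !inE /s /a => /and3P[-> /negbTE -> /st_le ->].
by [].
Qed.

Let sq : R := \sum_(i in U) p i ^+ 2.

Let sq_le X : X \subset U -> \sum_(i in X) p i ^+ 2 <= sq.
Proof.
move=> /subsetP XU; rewrite /sq big_mkcond [leRHS]big_mkcond; apply: ler_sum => i _.
case: (boolP (i \in X)) => [/XU ->//|_]; case: ifP => // _; exact: sqr_ge0.
Qed.

Let AU : A \subset U. Proof. by apply/subsetP => w; rewrite inE => /andP[]. Qed.

Let stepE C : C \subset U ->
  step r m C st = ((m <= #|C :&: A|)%N, (m < #|C :&: A|)%N || (m <= #|C :&: B|)%N).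
Proof.
move=> /subsetP CU; rewrite /step.
have -> : [set w in C | if r then (st w).2 else (st w).1] = C :&: A.
  by apply/setP => w; rewrite !inE; case: (boolP (w \in C)) => //= /CU ->.
suff -> : [set w in C | ~~ r && (st w).2] = C :&: B by [].
by apply/setP => w; rewrite !inE; case: (boolP (w \in C)) => //= /CU ->.
Qed.

Lemma step_prob1 :
  `|Ex p U (fun C => (step r m C st).1%:R) - psi m (\sum_(i in A) p i)| <= 2 * m%:R * sq.
Proof.
rewrite (@eq_Ex _ _ p U _ (fun C => (fun C => (m <= #|C|)%N%:R) (C :&: A))) => [|C CU].
  rewrite (@Ex_restrict U A (fun C => (m <= #|C|)%N%:R) AU).
  apply: le_trans (le_cam_ge _ _) _.
  by rewrite ler_wpM2l ?mulr_ge0 ?sq_le.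
by rewrite stepE.
Qed.

(** Robust children are alive, so the event splits into more than [m] alive children, or no child in
    [A :\: B] and exactly [m] in [B]. The last two conditions concern disjoint sets and are
    independent; their Poisson approximations account for the summand 4. *)
Lemma step_prob2 :
  `|Ex p U (fun C => (step r m C st).2%:R) -
    (psi m.+1 (\sum_(i in A) p i) + pois 0 (\sum_(i in A) p i - \sum_(i in B) p i) *
       pois m (\sum_(i in B) p i))| <= (2 * m.+1%:R + 4) * sq.
Proof.
have AE : A = (A :\: B) :|: B by rewrite -[LHS](setID A B) (setIidPr BA) setUC.
have dAB : [disjoint A :\: B & B] by rewrite -setI_eq0 setDE -setIA (setIC _ B) setICr setI0.
have sumAB : \sum_(i in A) p i - \sum_(i in B) p i = \sum_(i in A :\: B) p i.
  by rewrite [X in X - _](big_setID B)/= (setIidPr BA); ring.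
have -> : Ex p U (fun C => (step r m C st).2%:R) =
    Ex p A (fun C => (m < #|C|)%N%:R) +
    Ex p (A :\: B) (fun C => (#|C| == 0)%N%:R) * Ex p B (fun C => (#|C| == m)%N%:R).
  rewrite -(@Ex_restrict U A _ AU) -ExZr.
  have -> : Ex p (A :\: B) (fun C => (#|C| == 0)%N%:R * Ex p B (fun C => (#|C| == m)%N%:R)) =
     Ex p U (fun C => (#|C :&: A :&: (A :\: B)| == 0)%N%:R * (#|C :&: A :&: B| == m)%N%:R).
    rewrite (@Ex_restrict U A (fun C => (#|C :&: (A :\: B)| == 0)%N%:R * (#|C :&: B| == m)%N%:R) AU).
    rewrite [X in _ = Ex p X _]AE Ex_setU//; apply: eq_Ex => C CAB /=.
    rewrite -ExZ; apply: eq_Ex => D DB.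
    have d1 : (C :|: D) :&: (A :\: B) = C.
      rewrite setIUl (setIidPl CAB) (_ : D :&: _ = set0) ?setU0//.
      by apply/eqP; rewrite -subset0 -(disjoint_setI0 dAB) setIC setIS.
    have d2 : (C :|: D) :&: B = D.
      rewrite setIUl (setIidPl DB) (_ : C :&: _ = set0) ?set0U//.
      by apply/eqP; rewrite -subset0 -(disjoint_setI0 dAB) setSI.
    by rewrite d1 d2.
  rewrite -ExD; apply: eq_Ex => C CU; rewrite stepE//=.
  have e1 : C :&: A :&: (A :\: B) = C :&: (A :\: B) by rewrite -setIA setIDA setIid.
  have e2 : C :&: A :&: B = C :&: B by rewrite -setIA (setIidPr BA).
  rewrite e1 e2.
  have cA : #|C :&: A| = (#|C :&: (A :\: B)| + #|C :&: B|)%N.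
    rewrite -(cardsID B (C :&: A)) -setIA (setIidPr BA) addnC; congr (_ + _)%N.
    by apply: eq_card => w; rewrite !inE; case: (w \in B); case: (w \in C); rewrite ?andbF /=.
  rewrite -natrM mulnb -natrD cA; congr _%:R.
  move: (#|_|) (#|C :&: B|) => x y; lia.
have h1 := le_cam_ge A m.+1; have h2 := le_cam (A :\: B) 0; have h3 := le_cam B m.
rewrite sumAB; set y := \sum_(i in A) p i in h1 *; set u := \sum_(i in B) p i in h3 *.
set v := \sum_(i in A :\: B) p i in h2 *.
have sA := sq_le AU; have sB := sq_le (subset_trans BA AU).
have sD := sq_le (subset_trans (subsetDl A B) AU).
have v0 : 0 <= v by apply: sumr_ge0.
have u0 : 0 <= u by apply: sumr_ge0.
set F := Ex p (A :\: B) _ in h2 *; set G := Ex p B _ in h3 *; set H := Ex p A _ in h1 *.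
have F1 : 0 <= F by apply: Ex_ge0.
have F2 : F <= 1.
  by rewrite -(Ex_cst p (A :\: B) 1); apply: ler_Ex => // E _; case: (_ == _).
have h4 : `|F * G - pois 0 v * pois m u| <= 4 * sq.
  have -> : F * G - pois 0 v * pois m u = F * (G - pois m u) + (F - pois 0 v) * pois m u by ring.
  apply: (le_trans (ler_normD _ _)).
  rewrite (normrM F) (normrM (F - _)) (ger0_norm F1) (ger0_norm (pois_ge0 m u0)).
  have := pois_le1 m u0 => pu1.
  have e1 : F * `|G - pois m u| <= 2 * sq.
    by apply: le_trans (ler_piMl (normr_ge0 _) F2) _; lra.
  have e2 : `|F - pois 0 v| * pois m u <= 2 * sq.
    by apply: le_trans (ler_piMr (normr_ge0 _) pu1) _; lra.
  lra.
have -> : H + F * G - (psi m.+1 y + pois 0 v * pois m u) =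
   (H - psi m.+1 y) + (F * G - pois 0 v * pois m u) by ring.
apply: (le_trans (ler_normD _ _)).
have : 2 * m.+1%:R * (\sum_(i in A) p i ^+ 2) <= 2 * m.+1%:R * sq.
  by rewrite ler_wpM2l// mulr_ge0.
lra.
Qed.

End Step.
End LeCam.

Lemma Ex_sq_sum (R : realFieldType) (I J : finType) (p : I -> R) (A : {set I}) (B : {set J})
  (f : J -> {set I} -> R) (eps : R) :
  (forall i, 0 <= p i <= 1) -> (forall j E, `|f j E| <= 1) -> 0 <= eps ->
  (forall j j', j \in B -> j' \in B -> j != j' -> Ex p A (fun E => f j E * f j' E) <= eps) ->
  Ex p A (fun E => (\sum_(j in B) f j E) ^+ 2) <= #|B|%:R + #|B|%:R ^+ 2 * eps.
Proof.
move=> p01 f1 e0 fe.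
have -> : Ex p A (fun E => (\sum_(j in B) f j E) ^+ 2) =
   \sum_(j in B) \sum_(j' in B) Ex p A (fun E => f j E * f j' E).
  transitivity (Ex p A (fun E => \sum_(j in B) \sum_(j' in B) f j E * f j' E)).
    apply: eq_Ex => E _; rewrite expr2 mulr_suml; apply: eq_bigr => j _.
    by rewrite mulr_sumr.
  by rewrite Ex_sum; apply: eq_bigr => j _; rewrite Ex_sum.
apply: (@le_trans _ _ (\sum_(j in B) (1 + #|B|%:R * eps))); last first.
  by rewrite sumr_const -[leLHS]mulr_natl; lra.
apply: ler_sum => j jB; rewrite (bigD1 j)//=; apply: lerD.
  rewrite -(Ex_cst p A 1); apply: ler_Ex => // E _.
  by apply: le_trans (ler_norm _) _; rewrite normrM mulr_ile1.
apply: (@le_trans _ _ (\sum_(i in B | i != j) eps)).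
  by apply: ler_sum => j' /andP[j'B jj']; apply: fe => //; rewrite eq_sym.
rewrite big_mkcondr/= [leRHS]mulr_natl -sumr_const.
by apply: ler_sum => j' _; case: ifP.
Qed.

Definition sel (T : Type) (b : bool) (x : T * T) : T := if b then x.2 else x.1.

Lemma loc_le (V : finType) (e : rel V) k sch m U u :
  (loc e k sch m U u).2 -> (loc e k sch m U u).1.
Proof.
elim: sch m U u => [//|r sch IH] m U u /=.
case/orP => [/ltnW //|le]; apply: leq_trans le _; apply: card_sub_imply => // w _.
by case: r => //=; exact: IH.
Qed.

(** * Conditional probabilities and covariances for fixed types *)

Section LLN.
Variables (R : realType) (r : nat) (kap : 'I_r -> 'I_r -> R) (mu : 'I_r -> R) (c : R) (k : nat).
Hypothesis kap_ge0 : forall i j, 0 <= kap i j.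
Hypothesis kap_le : forall i j, kap i j <= c.
Hypothesis kapC : forall i j, kap i j = kap j i.
Hypothesis mu_ge0 : forall i, 0 <= mu i.
Hypothesis c0 : 0 <= c.

Section FixedN.
Variables (n : nat) (tau : 'I_n -> 'I_r).
Hypothesis n0 : (0 < n)%N.
Hypothesis nc : c <= n%:R.

Definition tprob (q : 'I_n * 'I_n) : R := Num.min (kap (tau q.1) (tau q.2) / n%:R) 1.

(** The assumption [c <= n] removes the truncation at 1. *)
Lemma tprob_ed u w : tprob (ed u w) = kap (tau u) (tau w) / n%:R.
Proof.
have nn0 : 0 < n%:R :> R by rewrite ltr0n.
have -> : tprob (ed u w) = Num.min (kap (tau u) (tau w) / n%:R) 1.
  by rewrite /tprob /ed; case: ifP => _ //=; rewrite kapC.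
by apply/min_idPl; rewrite ler_pdivrMr// mul1r (le_trans (kap_le _ _)).
Qed.

Lemma tprob01 q : 0 <= tprob q <= 1.
Proof. by rewrite /tprob le_min ge_min lexx orbT ler01 divr_ge0. Qed.

Lemma tprob_le q : tprob q <= c / n%:R.
Proof. by rewrite /tprob ge_min ler_wpM2r ?invr_ge0. Qed.

(** The normalisation is by [n], not by [#|U|], so that the limit is [mu j] times the success
    probability and deleting a few vertices leaves it unchanged. *)
Definition avg (b : bool) sch m (j : 'I_r) (U : {set 'I_n}) (E : {set 'I_n * 'I_n}) : R :=
  n%:R^-1 * \sum_(w in U | tau w == j) (sel b (loc (adj E) k sch m (U :\ w) w))%:R.

Lemma avg_inner b sch m j U (E X : {set 'I_n * 'I_n}) : E \subset pairsn n ->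
  inner U \subset X -> avg b sch m j U E = avg b sch m j U (E :&: X).
Proof.
move=> EP UX; rewrite /avg; congr (_ * _); apply: eq_bigr => w /andP[wU _].
by rewrite (@loc_inner _ k sch m (U :\ w) w E X)// ?setD1K// !inE eqxx.
Qed.

(* the difference between the conditional success probability of a vertex attached to [U] and
   its limit is controlled by the empirical averages inside [U] *)
Definition dev sch (U : {set 'I_n}) (E : {set 'I_n * 'I_n}) : R :=
  \sum_j (`|avg false sch k.-1 j U E - mu j * (lim_loc kap mu k sch k.-1 j).1| +
          `|avg true sch k.-1 j U E - mu j * (lim_loc kap mu k sch k.-1 j).2|).

Lemma dev_ge0 sch U E : 0 <= dev sch U E.
Proof. by apply: sumr_ge0 => j _; rewrite addr_ge0. Qed.

Lemma sum_types (U : {set 'I_n}) (f : 'I_n -> bool) u :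
  \sum_(w in [set w in U | f w]) tprob (ed u w) =
  \sum_j kap (tau u) j * (n%:R^-1 * \sum_(w in U | tau w == j) (f w)%:R).
Proof.
rewrite (partition_big tau xpredT)//=; apply: eq_bigr => j _.
rewrite !mulr_sumr big_mkcond [RHS]big_mkcond; apply: eq_bigr => w _.
rewrite inE tprob_ed; case: (w \in U) => //=.
case: eqP => [<-|]; last by rewrite andbF.
by case: (f w) => /=; rewrite ?mulr1 ?mulr0.
Qed.

(** Given the edges inside [U], the statuses of the possible children are fixed, and the star at [u]
    selects among them independently. The Poisson approximation uses the empirical means; replacing
    these by their limits costs [c * dev] once for the [psi] term and three times for the product of
    Poisson probabilities. *)
Lemma star_prob b b' sch m (U : {set 'I_n}) u (E0 : {set 'I_n * 'I_n}) : u \notin U -> E0 \subset inner U ->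
  `|Ex tprob (ed u @: U) (fun E1 => (sel b (loc (adj (E0 :|: E1)) k (b' :: sch) m U u))%:R) -
    sel b (lim_loc kap mu k (b' :: sch) m (tau u))| <=
  (2 * m.+1%:R + 4) * c ^+ 2 / n%:R + 4 * c * dev sch U E0.
Proof.
move=> uU E0U.
rewrite Ex_imset; last by move=> ? ? _ _; exact: ed_injr.
pose st w := loc (adj E0) k sch k.-1 (U :\ w) w.
have -> : Ex (tprob \o ed u) U (fun C =>
    (sel b (loc (adj (E0 :|: ed u @: C)) k (b' :: sch) m U u))%:R) =
  Ex (tprob \o ed u) U (fun C => (sel b (step b' m C st))%:R).
  apply: eq_Ex => C CU; congr (nat_of_bool (sel b _))%:R.
  rewrite [LHS]/=; have sub : E0 :|: ed u @: C \subset pairsn n.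
    rewrite subUset (subset_trans E0U (inner_sub U))/=; apply/subsetP => _ /imsetP[w wC ->].
    by apply: ed_pairsn; apply: contraNneq uU => ->; exact: (subsetP CU).
  have -> : [set w in U | adj (E0 :|: ed u @: C) u w] = C.
    apply/setP => w; rewrite !inE adj_ed// inE.
    case: (boolP (w \in U)) => [wU|wU] /=; last first.
      by apply/esym/negP => /(subsetP CU); rewrite (negbTE wU).
    have uw : u != w by apply: contraNneq uU => ->.
    have -> : (ed u w \in E0) = false.
      by apply/negP => /(subsetP E0U); rewrite ed_inner// (negbTE uU).
    by rewrite mem_imset//; exact: ed_injr.
  apply: eq_step => w wC; have wU := subsetP CU _ wC.
  apply: loc_congr => [|a a']; first by rewrite !inE eqxx.
  rewrite setD1K// => aU a'U aa'; have E0P := subset_trans E0U (inner_sub U).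
  rewrite !adj_ed// inE orbC (_ : _ \in ed u @: C = false)//.
  apply/negP => /imsetP[w' _ /ed_inj2[[au _]|[_ au]]].
    by rewrite au (negbTE uU) in aU.
  by rewrite au (negbTE uU) in a'U.
have st_le w : (st w).2 -> (st w).1 by exact: loc_le.
have p01 w : 0 <= (tprob \o ed u) w <= 1 by exact: tprob01.
have sq : \sum_(i in U) (tprob \o ed u) i ^+ 2 <= c ^+ 2 / n%:R.
  apply: (@le_trans _ _ (\sum_(i in U) (c / n%:R) ^+ 2)).
    apply: ler_sum => w _; rewrite lerXn2r ?nnegrE ?divr_ge0//=.
      by have /andP[] := tprob01 (ed u w).
    exact: tprob_le.
  apply: le_trans (sum_le_n _ _) _; first exact: sqr_ge0.
  by rewrite le_eqVlt; apply/orP; left; apply/eqP; field; rewrite pnatr_eq0 -lt0n.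
have sq0 : 0 <= \sum_(i in U) (tprob \o ed u) i ^+ 2 by apply: sumr_ge0 => w _; exact: sqr_ge0.
set i := tau u.
pose a w := if b' then (st w).2 else (st w).1.
pose s w := ~~ b' && (st w).2.
pose la j := if b' then (lim_loc kap mu k sch k.-1 j).2 else (lim_loc kap mu k sch k.-1 j).1.
pose ls j := if b' then 0 else (lim_loc kap mu k sch k.-1 j).2.
set ye := \sum_(w in [set w in U | a w]) tprob (ed u w).
set ue := \sum_(w in [set w in U | s w]) tprob (ed u w).
pose y := Kop kap mu la i; pose v := Kop kap mu ls i.
have dK (f : 'I_n -> bool) (l : 'I_r -> R) :
    (forall j, `|n%:R^-1 * \sum_(w in U | tau w == j) (f w)%:R - mu j * l j| <=
      (`|avg false sch k.-1 j U E0 - mu j * (lim_loc kap mu k sch k.-1 j).1| +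
          `|avg true sch k.-1 j U E0 - mu j * (lim_loc kap mu k sch k.-1 j).2|)) ->
    `|\sum_(w in [set w in U | f w]) tprob (ed u w) - Kop kap mu l i| <= c * dev sch U E0.
  move=> h; rewrite sum_types /Kop -sumrB; apply: le_trans (ler_norm_sum _ _ _) _.
  rewrite /dev mulr_sumr; apply: ler_sum => j _.
  rewrite -mulrA -mulrBr normrM (ger0_norm (kap_ge0 _ _)).
  by apply: ler_pM => //; exact: h.
have hy : `|ye - y| <= c * dev sch U E0.
  apply: dK => j; rewrite /a /la; case: (b') => /=; first by rewrite lerDr.
  by rewrite lerDl.
have hu : `|ue - v| <= c * dev sch U E0.
  apply: dK => j; rewrite /s /ls; case: (b') => /=; last by rewrite lerDr.
  by rewrite big1// !mulr0 subrr normr0 addr_ge0.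
have ye0 : 0 <= ye by apply: sumr_ge0 => w _; have /andP[] := tprob01 (ed u w).
have ue0 : 0 <= ue by apply: sumr_ge0 => w _; have /andP[] := tprob01 (ed u w).
have uye : ue <= ye.
  rewrite /ue /ye big_mkcond [leRHS]big_mkcond; apply: ler_sum => w _.
  have p0 : 0 <= tprob (ed u w) by have /andP[] := tprob01 (ed u w).
  rewrite !inE /s /a; case: (w \in U) => //=; case: (b') => /=; first by case: ifP.
  by case: ifP => [/st_le ->//|_]; case: ifP.
have v0 : 0 <= v.
  by apply: Kop_ge0 => // j; rewrite /ls; case: (b') => //; have [] := lim_loc_bounds kap_ge0 mu_ge0 k sch k.-1 j.
have vy : v <= y.
  apply: Kop_le => // j; rewrite /ls /la; case: (b') => //;
    by have [? ? ?] := lim_loc_bounds kap_ge0 mu_ge0 k sch k.-1 j.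
have y0 : 0 <= y by exact: le_trans vy.
have dev0 := dev_ge0 sch U E0.
have m0 : 0 <= m%:R :> R by [].
have cd0 : 0 <= c * dev sch U E0 by exact: mulr_ge0.
case: b => /=.
- have h := @step_prob2 R _ (tprob \o ed u) p01 U st b' m st_le.
  rewrite -/a -/s -/ye -/ue in h.
  rewrite -/la -/ls -/y -/v.
  have -> : expR (- y) * (v ^+ m / m`!%:R) = pois 0 (y - v) * pois m v.
    by rewrite /pois expr0 fact0 divr1 mulr1 [RHS]mulrA -expRD; congr (expR _ * _); ring.
  set P := Ex _ _ _ in h *.
  have l1 := psi_lip m.+1 ye0 y0.
  have l2 := pois_lip m ue0 v0.
  have yv0 : 0 <= y - v by rewrite subr_ge0.
  have yue0 : 0 <= ye - ue by rewrite subr_ge0.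
  have l3 := pois_lip 0 yue0 yv0.
  have l4 : `|ye - ue - (y - v)| <= `|ye - y| + `|ue - v|.
    by rewrite (_ : ye - ue - (y - v) = (ye - y) - (ue - v)); [exact: ler_normB|ring].
  have -> : P - (psi m.+1 y + pois 0 (y - v) * pois m v) =
     (P - (psi m.+1 ye + pois 0 (ye - ue) * pois m ue)) + (psi m.+1 ye - psi m.+1 y) +
     (pois 0 (ye - ue) * (pois m ue - pois m v) + (pois 0 (ye - ue) - pois 0 (y - v)) * pois m v).
    by ring.
  apply: (le_trans (ler_normD _ _)).
  have e1 : `|pois 0 (ye - ue) * (pois m ue - pois m v) +
      (pois 0 (ye - ue) - pois 0 (y - v)) * pois m v| <= 3 * (c * dev sch U E0).
    apply: (le_trans (ler_normD _ _)); rewrite (normrM (pois 0 _)) (normrM (_ - _)).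
    rewrite (ger0_norm (pois_ge0 0 yue0)) (ger0_norm (pois_ge0 m v0)).
    have := ler_piMl (normr_ge0 (pois m ue - pois m v)) (pois_le1 0 yue0).
    have := ler_piMr (normr_ge0 (pois 0 (ye - ue) - pois 0 (y - v))) (pois_le1 m v0).
    lra.
  have e2 : `|P - (psi m.+1 ye + pois 0 (ye - ue) * pois m ue) + (psi m.+1 ye - psi m.+1 y)| <=
     (2 * m.+1%:R + 4) * c ^+ 2 / n%:R + c * dev sch U E0.
    apply: (le_trans (ler_normD _ _)); apply: lerD; last exact: le_trans hy.
    apply: (le_trans h); rewrite -mulrA ler_wpM2l//.
    by rewrite addr_ge0// mulr_ge0.
  lra.
- have h := @step_prob1 R _ (tprob \o ed u) p01 U st b' m.
  rewrite -/a -/ye in h.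
  rewrite -/la -/y.
  set P := Ex _ _ _ in h *.
  have l1 := psi_lip m ye0 y0.
  have -> : P - psi m y = (P - psi m ye) + (psi m ye - psi m y) by ring.
  apply: (le_trans (ler_normD _ _)).
  have e2 : 2 * m%:R * (\sum_(i in U) (tprob \o ed u) i ^+ 2) <= (2 * m.+1%:R + 4) * c ^+ 2 / n%:R.
    rewrite -[leRHS]mulrA; apply: ler_pM => //; first by rewrite mulr_ge0.
    by rewrite -natr1; lra.
  lra.
Qed.

(** Deleting [w] and [w'] from each other's exploration costs two stability terms. Given the edges
    inside the common remainder [U2], the two stars are then independent; one factor is small by
    [star_prob] and the other is at most 1 in absolute value. *)
Lemma pair_bound b b' sch m (U : {set 'I_n}) w w' j :
  w \in U -> w' \in U -> w != w' -> tau w = j -> tau w' = j ->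
  Ex tprob (pairsn n) (fun E =>
     ((sel b (loc (adj E) k (b' :: sch) m (U :\ w) w))%:R -
        sel b (lim_loc kap mu k (b' :: sch) m j)) *
     ((sel b (loc (adj E) k (b' :: sch) m (U :\ w') w'))%:R -
        sel b (lim_loc kap mu k (b' :: sch) m j))) <=
  (2 * stab c (size sch).+1 + (2 * m.+1%:R + 4) * c ^+ 2) / n%:R +
  4 * c * Ex tprob (pairsn n) (dev sch (U :\ w :\ w')).
Proof.
move=> wU w'U ww' tw tw'; set U2 := U :\ w :\ w'.
have UE : U :\ w' :\ w = U2 by apply/setP => x; rewrite !inE andbCA.
set l := sel b (lim_loc _ _ _ _ _ _).
have [l0 l01 l1] := lim_loc_bounds kap_ge0 mu_ge0 k (b' :: sch) m j.
have hl0 : 0 <= l by rewrite /l /sel; case: (b) => //; exact: le_trans l01.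
have hl1 : l <= 1 by rewrite /l /sel; case: (b) => //; exact: le_trans l1.
pose Z v (W : {set 'I_n}) E : R := (sel b (loc (adj E) k (b' :: sch) m W v))%:R.
have Zb v W E : 0 <= Z v W E <= 1 by rewrite /Z; case: (sel _ _); rewrite ?ler01 ?lexx.
have wU2 : w \notin U2 by rewrite !inE eqxx andbF.
have w'U2 : w' \notin U2 by rewrite !inE eqxx.
have ZZ v W z E : `|Z v W E - Z v (W :\ z) E| <=
   (loc (adj E) k (b' :: sch) m W v != loc (adj E) k (b' :: sch) m (W :\ z) v)%:R.
  rewrite /Z; case: eqP => [->|_]; first by rewrite subrr normr0.
  by case: (sel b _); case: (sel b _); rewrite ?subrr ?subr0 ?sub0r ?normrN ?normr1 ?normr0.
(* The factors are exchanged one at a time; each is a difference of two numbers in the unit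
   interval, so the remaining factor is at most 1. *)
have gen (z1 z2 z3 z4 x1 x2 : R) : 0 <= z1 <= 1 -> 0 <= z2 <= 1 -> 0 <= z3 <= 1 ->
    0 <= z4 <= 1 -> `|z3 - z1| <= x1 -> `|z4 - z2| <= x2 ->
    (z3 - l) * (z4 - l) <= (z1 - l) * (z2 - l) + (x1 + x2).
  move=> /andP[a1 a2] /andP[a3 a4] /andP[a5 a6] /andP[a7 a8] d1 d2.
  have -> : (z3 - l) * (z4 - l) =
    (z1 - l) * (z2 - l) + ((z3 - z1) * (z4 - l) + (z1 - l) * (z4 - z2)) by ring.
  rewrite lerD2l; apply: lerD.
    apply: le_trans (ler_norm _) _; rewrite normrM.
    apply: le_trans (ler_piMr (normr_ge0 _) _) _ => //; rewrite ler_norml; lra.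
  apply: le_trans (ler_norm _) _; rewrite normrM mulrC.
  by apply: le_trans (ler_piMr (normr_ge0 _) _) _ => //; rewrite ler_norml; lra.
apply: (@le_trans _ _ (Ex tprob (pairsn n) (fun E => (Z w U2 E - l) * (Z w' U2 E - l) +
   ((loc (adj E) k (b' :: sch) m (U :\ w) w != loc (adj E) k (b' :: sch) m U2 w)%:R +
    (loc (adj E) k (b' :: sch) m (U :\ w') w' != loc (adj E) k (b' :: sch) m U2 w')%:R)))).
  apply: ler_Ex => [|E _]; first exact: tprob01.
  apply: gen; [exact: Zb|exact: Zb|exact: (Zb w (U :\ w) E)|exact: (Zb w' (U :\ w') E)
    |exact: (ZZ w (U :\ w) w' E)|].
  by have := ZZ w' (U :\ w') w E; rewrite UE.
rewrite ExD ExD.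
have sw : Ex tprob (pairsn n) (fun E => (loc (adj E) k (b' :: sch) m (U :\ w) w !=
    loc (adj E) k (b' :: sch) m U2 w)%:R) <= stab c (size sch).+1 / n%:R.
  apply: (@loc_stability R n tprob c k tprob01 tprob_le n0 c0 (b' :: sch));
    by rewrite !inE ?eqxx// w'U eq_sym ww'.
have sw' : Ex tprob (pairsn n) (fun E => (loc (adj E) k (b' :: sch) m (U :\ w') w' !=
    loc (adj E) k (b' :: sch) m U2 w')%:R) <= stab c (size sch).+1 / n%:R.
  rewrite -UE; apply: (@loc_stability R n tprob c k tprob01 tprob_le n0 c0 (b' :: sch));
    by rewrite !inE ?eqxx// wU ww'.
suff main : Ex tprob (pairsn n) (fun E => (Z w U2 E - l) * (Z w' U2 E - l)) <=
    (2 * m.+1%:R + 4) * c ^+ 2 / n%:R + 4 * c * Ex tprob (pairsn n) (dev sch U2).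
  by rewrite mulrDl; lra.
pose I0 := inner U2; pose S1 := ed w @: U2; pose S2 := ed w' @: U2.

have SP v : v \notin U2 -> ed v @: U2 \subset pairsn n.
  move=> vU; apply/subsetP => _ /imsetP[x xU ->]; apply: ed_pairsn.
  by apply: contraNneq vU => ->.
have XP : I0 :|: (S1 :|: S2) \subset pairsn n.
  by rewrite !subUset inner_sub !SP.
have d12 : [disjoint S1 & S2].
  rewrite -setI_eq0; apply/eqP/setP => q; rewrite !inE; apply/negP.
  move=> /andP[/imsetP[x xU ->] /imsetP[x' x'U /ed_inj2[[ww _]|[wx _]]]].
    by rewrite ww eqxx in ww'.
  by rewrite wx x'U in wU2.
have d0 : [disjoint I0 & S1 :|: S2].
  by rewrite disjoint_sym disjoints_subset subUset -!disjoints_subset; apply/andP; split;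
    rewrite disjoint_sym inner_star_disj.
have ZX v (E : {set 'I_n * 'I_n}) : v \notin U2 -> ed v @: U2 \subset S1 :|: S2 -> E \subset pairsn n ->
    Z v U2 E = Z v U2 (E :&: (I0 :|: (S1 :|: S2))).
  move=> vU sS EP; rewrite /Z (loc_inner k (b' :: sch) m EP vU (X := I0 :|: (S1 :|: S2)))//.
  by rewrite innerU1// setUS.
rewrite (Ex_marginal tprob XP) => [|E EP]; last first.
  by rewrite (ZX w)// ?subsetUl// (ZX w')// ?subsetUr.
rewrite Ex_setU//.
(* [I0], [S1] and [S2] are pairwise disjoint edge sets, so with [E0] fixed the mean of the product
   is the product of the means. *)
have fac (E0 : {set 'I_n * 'I_n}) : E0 \subset I0 -> Ex tprob (S1 :|: S2) (fun F => (Z w U2 (E0 :|: F) - l) *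
     (Z w' U2 (E0 :|: F) - l)) =
   (Ex tprob S1 (fun F => Z w U2 (E0 :|: F)) - l) * (Ex tprob S2 (fun F => Z w' U2 (E0 :|: F)) - l).
  move=> E0I; rewrite Ex_setU//.
  transitivity (Ex tprob S1 (fun E1 => (Z w U2 (E0 :|: E1) - l) *
      Ex tprob S2 (fun F => Z w' U2 (E0 :|: F) - l))).
    apply: eq_Ex => E1 E1S; rewrite -ExZ; apply: eq_Ex => E2 E2S.
    have E0P : E0 \subset pairsn n := subset_trans E0I (inner_sub _).
    have EP : E0 :|: (E1 :|: E2) \subset pairsn n.
      by rewrite !subUset E0P (subset_trans E1S (SP _ wU2)) (subset_trans E2S (SP _ w'U2)).
    have e1 : Z w U2 (E0 :|: (E1 :|: E2)) = Z w U2 (E0 :|: E1).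
      rewrite /Z (loc_inner k (b' :: sch) m EP wU2 (X := I0 :|: S1)); last by rewrite innerU1.
      congr (nat_of_bool (sel b (loc (adj _) _ _ _ _ _)))%:R.
      rewrite setIUl (setIidPl (subset_trans E0I (subsetUl _ _))); congr (_ :|: _).
      rewrite setIUl (setIidPl (subset_trans E1S (subsetUr _ _))) (_ : E2 :&: _ = set0) ?setU0//.
      rewrite setIUr; apply/eqP; rewrite setU_eq0 -!subset0.
      rewrite (subset_trans (setSI _ (subset_trans E2S (subsetUr S1 S2))))/=; last first.
        by rewrite setIC (disjoint_setI0 d0).
      by rewrite (subset_trans (setSI _ E2S))// setIC (disjoint_setI0 d12).
    have e2 : Z w' U2 (E0 :|: (E1 :|: E2)) = Z w' U2 (E0 :|: E2).
      rewrite /Z (loc_inner k (b' :: sch) m EP w'U2 (X := I0 :|: S2)); last by rewrite innerU1.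
      congr (nat_of_bool (sel b (loc (adj _) _ _ _ _ _)))%:R.
      rewrite setIUl (setIidPl (subset_trans E0I (subsetUl _ _))); congr (_ :|: _).
      rewrite setIUl (setIidPl (subset_trans E2S (subsetUr _ _))) (_ : E1 :&: _ = set0) ?set0U//.
      rewrite setIUr; apply/eqP; rewrite setU_eq0 -!subset0.
      rewrite (subset_trans (setSI _ (subset_trans E1S (subsetUl S1 S2))))/=; last first.
        by rewrite setIC (disjoint_setI0 d0).
      by rewrite (subset_trans (setSI _ E1S))// (disjoint_setI0 d12).
    by rewrite e1 e2.
  by rewrite ExZr !ExB !Ex_cst.
rewrite (eq_Ex tprob fac) -[X in _ <= _ + _ * X](_ : Ex tprob I0 (dev sch U2) = _); last first.
  apply/esym/Ex_marginal; first exact: inner_sub.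
  move=> E EP; rewrite /dev; apply: eq_bigr => i _.
  by rewrite !(@avg_inner _ sch k.-1 i U2 E I0).
rewrite -(Ex_cst tprob I0 ((2 * m.+1%:R + 4) * c ^+ 2 / n%:R)) -ExZ -ExD.
apply: ler_Ex => [|E0 E0I]; first exact: tprob01.
have h := star_prob b b' sch m wU2 E0I; rewrite tw -/l in h.
apply: le_trans (ler_norm _) _; rewrite normrM.
apply: le_trans (ler_piMr (normr_ge0 _) _) h.
have g0 : 0 <= Ex tprob S2 (fun F => Z w' U2 (E0 :|: F)).
  by apply: Ex_ge0 => [|E _]; [exact: tprob01|have /andP[] := Zb w' U2 (E0 :|: E)].
have g1 : Ex tprob S2 (fun F => Z w' U2 (E0 :|: F)) <= 1.
  rewrite -(Ex_cst tprob S2 1); apply: ler_Ex => [|E _]; first exact: tprob01.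
  by have /andP[] := Zb w' U2 (E0 :|: E).
by rewrite ler_norml; lra.
Qed.

End FixedN.
End LLN.

Lemma inv_nat_small (R : archiRealFieldType) (x : R) : 0 < x ->
  exists N : nat, forall n, (N <= n)%N -> (0 < n)%N /\ n%:R^-1 <= x.
Proof.
move=> x0; exists (Num.bound x^-1).+1 => n Nn; have n0 : (0 < n)%N by apply: leq_trans Nn.
split => //; rewrite -[leRHS]invrK lef_pV2 ?posrE ?ltr0n ?invr_gt0//.
apply: le_trans (ltW (archi_boundP _)) _; first by rewrite invr_ge0 ltW.
by rewrite ler_nat ltnW.
Qed.

Section LLN.
Variables (R : realType) (r : nat) (kap : 'I_r -> 'I_r -> R) (mu : 'I_r -> R) (c : R) (k : nat).
Hypothesis kap_ge0 : forall i j, 0 <= kap i j.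
Hypothesis kap_le : forall i j, kap i j <= c.
Hypothesis kapC : forall i j, kap i j = kap j i.
Hypothesis mu_ge0 : forall i, 0 <= mu i.
Hypothesis c0 : 0 <= c.

Definition types_close n (tau : 'I_n -> 'I_r) (delta : R) :=
  forall j, `|#|[set w | tau w == j]|%:R / n%:R - mu j| <= delta.

Lemma count_types n (tau : 'I_n -> 'I_r) (U : {set 'I_n}) (delta : R) r0 j : (0 < n)%N ->
  types_close tau delta -> (#|~: U| <= r0)%N ->
  `|#|[set w in U | tau w == j]|%:R / n%:R - mu j| <= delta + r0%:R / n%:R.
Proof.
move=> n0 cl Ur; have nn0 : 0 < n%:R :> R by rewrite ltr0n.
have -> : #|[set w in U | tau w == j]|%:R / n%:R - mu j =
   (#|[set w | tau w == j]|%:R / n%:R - mu j) -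
   (#|[set w | tau w == j]|%:R - #|[set w in U | tau w == j]|%:R) / n%:R by ring.
apply: le_trans (ler_normB _ _) (lerD (cl j) _).
have h1 : (#|[set w in U | tau w == j]| <= #|[set w | tau w == j]|)%N.
  by apply: subset_leq_card; apply/subsetP => w; rewrite !inE => /andP[].
have h2 : (#|[set w | tau w == j]| <= #|[set w in U | tau w == j]| + #|~: U|)%N.
  rewrite -(cardsID U [set w | tau w == j]) leq_add//.
    by apply: subset_leq_card; apply/subsetP => w; rewrite !inE andbC.
  by apply: subset_leq_card; apply/subsetP => w; rewrite !inE => /andP[].
rewrite -natrB// ger0_norm ?divr_ge0// ler_wpM2r ?invr_ge0// ler_nat.
by rewrite leq_subLR (leq_trans h2)// leq_add2l.
Qed.

(** Induction on the schedule. The second moment at one depth involves the deviation at the previous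
    depth on a set with two more vertices removed, hence the uniformity over all [U] missing at most
    [r0] vertices. *)
Lemma LLN sch m (eps : R) r0 : 0 < eps -> exists (delta : R) (N : nat), 0 < delta /\
  forall n (tau : 'I_n -> 'I_r), (N <= n)%N -> types_close tau delta ->
  forall (U : {set 'I_n}) j b, (#|~: U| <= r0)%N ->
   Ex (tprob kap tau) (pairsn n) (fun E => `|avg R k tau b sch m j U E -
      mu j * sel b (lim_loc kap mu k sch m j)|) <= eps.
Proof.
elim: sch m eps r0 => [|b' sch IH] m eps r0 e0.
  have [|N HN] := @inv_nat_small R (eps / 2 / (r0%:R + 1)).
    by rewrite !divr_gt0// ltr_wpDl.
  exists (eps / 2), N; split; first by rewrite divr_gt0.
  move=> n tau /HN[n0 Nn] cl U j b Ur; rewrite -[leRHS](Ex_cst (tprob kap tau) (pairsn n)).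
  apply: ler_Ex => [|E _]; first exact: tprob01.
  rewrite /avg /=; have -> : sel b (1 : R, 1 : R) = 1 by case: b.
  have -> : \sum_(w in U | tau w == j) (sel b (true, true))%:R = #|[set w in U | tau w == j]|%:R :> R.
    rewrite -sum1_card natr_sum big_mkcond [RHS]big_mkcond; apply: eq_bigr => w _.
    by rewrite inE; case: b.
  rewrite mulr1 mulrC; apply: le_trans (count_types j n0 cl Ur) _.
  have : (r0%:R + 1) * n%:R^-1 <= eps / 2.
    by rewrite mulrC -ler_pdivlMr// ltr_wpDl.
  have : 0 <= n%:R^-1 :> R by rewrite invr_ge0.
  lra.
pose ct : R := 2 * stab c (size sch).+1 + (2 * m.+1%:R + 4) * c ^+ 2.
have ct0 : 0 <= ct.
  by rewrite addr_ge0 ?mulr_ge0 ?sqr_ge0 ?addr_ge0 ?mulr_ge0// ?stab_ge0// addr_ge0// stab_ge0.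
(* The second moment will be at most [3 * e1]; through [amgm] this contributes
   [eps / 4 + 3 * eps / 16], and the type frequencies take the remaining [eps / 2]. *)
pose e1 := eps ^+ 2 / 16.
have e10 : 0 < e1 by rewrite divr_gt0// exprn_gt0.
pose e2 := e1 / (8 * (c + 1) * (r%:R + 1)).
have e20 : 0 < e2 by rewrite divr_gt0// !mulr_gt0// ltr_wpDl.
have [dl [N1 [dl0 IH1]]] := IH k.-1 e2 r0.+2 e20.
have [|N2 HN2] := @inv_nat_small R (e1 / (ct + 1)); first by rewrite divr_gt0// ltr_wpDl.
have [|N3 HN3] := @inv_nat_small R (eps / 4 / (r0%:R + 1)).
  by rewrite !divr_gt0// ltr_wpDl.
exists (Num.min dl (eps / 4)), (maxn N1 (maxn N2 (maxn N3 (Num.bound c)))).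
split; first by rewrite lt_min dl0 divr_gt0.
move=> n tau; rewrite !geq_max => /and4P[n1 n2 n3 n4] cl U j b Ur.
have [n0 i2] := HN2 n n2; have [_ i3] := HN3 n n3.
have nn0 : 0 < n%:R :> R by rewrite ltr0n.
have nc : c <= n%:R by apply: le_trans (ltW (archi_boundP c0)) _; rewrite ler_nat.
have cl1 : types_close tau dl by move=> i; apply: le_trans (cl i) _; rewrite ge_min lexx.
have cl2 : types_close tau (eps / 4) by move=> i; apply: le_trans (cl i) _; rewrite ge_min lexx orbT.
have p01 := tprob01 kap_ge0 tau.
set l := sel b (lim_loc _ _ _ _ _ _).
have [l0 l01 l1] := lim_loc_bounds kap_ge0 mu_ge0 k (b' :: sch) m j.
have hl0 : 0 <= l by rewrite /l /sel; case: (b) => //; exact: le_trans l01.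
have hl1 : l <= 1 by rewrite /l /sel; case: (b) => //; exact: le_trans l1.
pose B := [set w in U | tau w == j].
pose f w E : R := (sel b (loc (adj E) k (b' :: sch) m (U :\ w) w))%:R - l.
have f1 w E : `|f w E| <= 1.
  by rewrite /f; case: (sel b (loc _ _ _ _ _ _)); rewrite ?mulr0n ?mulr1n ler_norml; lra.
have avgE E : avg R k tau b (b' :: sch) m j U E - mu j * l =
    n%:R^-1 * (\sum_(w in B) f w E) + (#|B|%:R / n%:R - mu j) * l.
  rewrite /avg /f sumrB sumr_const /B big_set -[l *+ _]mulr_natl.
  move: (\sum_(i | _) _) => s; rewrite -/B; ring.
have devE w w' : w \in U -> w' \in U -> w != w' ->
    Ex (tprob kap tau) (pairsn n) (dev kap mu k tau sch (U :\ w :\ w')) <= 2 * r%:R * e2.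
  move=> wU w'U ww'; rewrite /dev Ex_sum.
  apply: (@le_trans _ _ (\sum_(j < r) (e2 + e2))); last first.
    by rewrite sumr_const card_ord -[leLHS]mulr_natl; lra.
  have UU : (#|~: (U :\ w :\ w')| <= r0.+2)%N.
    rewrite (_ : ~: (U :\ w :\ w') = w' |: (w |: ~: U)); last first.
      by apply/setP => x; rewrite !inE !negb_and !negbK.
    by rewrite !cardsU1 -[r0.+2]/(1 + (1 + r0))%N !leq_add// leq_b1.
  by apply: ler_sum => i _; rewrite ExD; apply: lerD;
    [exact: (IH1 n tau n1 cl1 _ i false)|exact: (IH1 n tau n1 cl1 _ i true)].
have e2c : 4 * c * (2 * r%:R * e2) <= e1.
  have -> : e1 = e2 * (8 * (c + 1) * (r%:R + 1)).
    rewrite /e2 divfK//; apply: lt0r_neq0; rewrite !mulr_gt0// ltr_wpDl//.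
  have h : c * r%:R <= (c + 1) * (r%:R + 1).
    by apply: ler_pM => //; rewrite lerDl.
  have := ler_wpM2l (ltW e20) h; lra.
have ctn : ct / n%:R <= e1.
  have : (ct + 1) * n%:R^-1 <= e1.
    by rewrite mulrC -ler_pdivlMr// ltr_wpDl.
  have : 0 <= n%:R^-1 :> R by rewrite invr_ge0.
  lra.
have in1 : n%:R^-1 <= e1.
  apply: le_trans i2 _; rewrite ler_pdivrMr ?ltr_wpDl//.
  by rewrite ler_peMr ?(ltW e10)// lerDr.
have var : Ex (tprob kap tau) (pairsn n) (fun E => (\sum_(w in B) f w E) ^+ 2) <=
    #|B|%:R + #|B|%:R ^+ 2 * (2 * e1).
  apply: Ex_sq_sum => //; first by rewrite mulr_ge0// ltW.
  move=> w w'; rewrite !inE => /andP[wU /eqP tw] /andP[w'U /eqP tw'] ww'.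
  have pb := pair_bound k kap_ge0 kap_le kapC mu_ge0 c0 n0 nc b b' sch m wU w'U ww' tw tw'.
  apply: le_trans pb _.
  rewrite -/ct; have := devE w w' wU w'U ww' => dv.
  have := ler_wpM2l (_ : 0 <= 4 * c) dv; rewrite mulr_ge0// => /(_ isT); lra.
have Bn : #|B|%:R <= n%:R :> R by rewrite ler_nat -[leqRHS]card_ord max_card.
have var2 : Ex (tprob kap tau) (pairsn n) (fun E => (n%:R^-1 * \sum_(w in B) f w E) ^+ 2) <= 3 * e1.
  rewrite (_ : (fun E => _) = (fun E => n%:R^-2 * (\sum_(w in B) f w E) ^+ 2)); last first.
    by apply/boolp.funext => E; rewrite exprMn exprVn.
  rewrite ExZ; apply: (@le_trans _ _ (n%:R^-2 * (n%:R + n%:R ^+ 2 * (2 * e1)))).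
    rewrite ler_wpM2l ?invr_ge0 ?sqr_ge0//; apply: le_trans var _.
    apply: lerD => //; apply: ler_wpM2r; first by rewrite mulr_ge0// ltW.
    by apply: lerXn2r; rewrite ?nnegrE.
  have -> : n%:R^-2 * (n%:R + n%:R ^+ 2 * (2 * e1)) = n%:R^-1 + 2 * e1 :> R.
    by field; rewrite lt0r_neq0.
  lra.
have amgm (x : R) : `|x| <= eps / 4 + x ^+ 2 / eps.
  have h : 0 <= (`|x| - eps / 2) ^+ 2 by exact: sqr_ge0.
  rewrite -(ler_pM2r e0) mulrDl divfK ?lt0r_neq0//.
  rewrite -real_normK ?num_real//; move: h; rewrite expr2 expr2; lra.
apply: (@le_trans _ _ (Ex (tprob kap tau) (pairsn n) (fun E =>
   (eps / 4 + eps^-1 * (n%:R^-1 * \sum_(w in B) f w E) ^+ 2) + eps / 2))).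
  apply: ler_Ex => // E _; rewrite avgE; apply: le_trans (ler_normD _ _) _; apply: lerD.
    by rewrite (mulrC eps^-1); exact: amgm.
  rewrite normrM (ger0_norm hl0); apply: le_trans (ler_piMr (normr_ge0 _) hl1) _.
  apply: le_trans (count_types j n0 cl2 Ur) _.
  have : (r0%:R + 1) * n%:R^-1 <= eps / 4.
    by rewrite mulrC -ler_pdivlMr// ltr_wpDl.
  have : 0 <= n%:R^-1 :> R by rewrite invr_ge0.
  lra.
rewrite ExD Ex_cst ExD Ex_cst ExZ.
have ei : 0 <= eps^-1 by rewrite invr_ge0 ltW.
have := ler_wpM2l ei var2.
have -> : eps^-1 * (3 * e1) = 3 / 16 * eps by rewrite /e1; field; rewrite lt0r_neq0.
lra.
Qed.

End LLN.

(** * Sparsity of random graphs *)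

Lemma ffact_le_expn N m : (N ^_ m <= N ^ m)%N.
Proof. by elim: m => // m IH; rewrite ffactnSr expnSr leq_mul// leq_subr. Qed.

Lemma subset_of_card (T : finType) (A : {set T}) m : (m <= #|A|)%N ->
  exists2 F : {set T}, F \subset A & #|F| = m.
Proof.
move=> mA; exists [set x in take m (enum A)].
  by apply/subsetP => x; rewrite inE => /mem_take; rewrite mem_enum.
rewrite cardsE (card_uniqP (take_uniq _ (enum_uniq _))) size_take -cardE.
by rewrite ltn_neqAle mA andbT; case: eqP.
Qed.

Lemma e2_inner n (E : {set 'I_n * 'I_n}) (S : {set 'I_n}) : E \subset pairsn n ->
  (e2 (adj E) S <= 2 * #|E :&: inner S|)%N.
Proof.
move=> EP.
have h (f : 'I_n -> 'I_n -> bool) : (forall v w, f v w -> v \in S -> w \in S -> (v, w) \in E :&: inner S) ->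
   (\sum_(v in S) \sum_(w in S) f v w <= #|E :&: inner S|)%N.
  move=> fE; rewrite pair_big_dep/= -sum1_card big_mkcond [leqRHS]big_mkcond.
  apply: leq_sum => -[v w] _ /=; case: ifP => // /andP[vS wS].
  by case: (boolP (f v w)) => // /fE ->.
apply: (@leq_trans (\sum_(v in S) \sum_(w in S) ((v, w) \in E) +
                    \sum_(v in S) \sum_(w in S) ((w, v) \in E))).
  rewrite /e2 -big_split; apply: leq_sum => v _ /=.
  rewrite -big_split -sum1_card big_mkcond [leqRHS]big_mkcond/=; apply: leq_sum => w _.
  by rewrite inE; case: (w \in S) => //=; rewrite /adj; case: (_ \in E); case: (_ \in E).
rewrite mul2n -addnn leq_add//.
  apply: h => v w vwE vS wS; rewrite !inE vwE vS wS/= andbT.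
  by move/subsetP: EP => /(_ _ vwE); rewrite inE.
rewrite exchange_big; apply: h => v w vwE vS wS; rewrite !inE vwE vS wS/= andbT.
by move/subsetP: EP => /(_ _ vwE); rewrite inE.
Qed.

Section Sparse.
Variable R : realType.

Lemma powfact m : m%:R ^+ m <= expR 1 ^+ m * m`!%:R :> R.
Proof.
case: m => [|m]; first by rewrite !expr0 fact0 mul1r.
rewrite -ler_pdivrMr ?ltr0n ?fact_gt0// -expRM_natl mulr1.
by apply: le_trans (expR_ge1Dxn m (ler0n R m.+1)); rewrite lerDr.
Qed.

Lemma bin_le N m : (0 < m)%N -> 'C(N, m)%:R <= (expR 1 * N%:R / m%:R) ^+ m :> R.
Proof.
move=> m0; have mm : 0 < m%:R ^+ m :> R by rewrite exprn_gt0// ltr0n.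
rewrite expr_div_n ler_pdivlMr// exprMn.
apply: le_trans (ler_wpM2l (ler0n _ _) (powfact m)) _.
rewrite mulrCA ler_wpM2l ?exprn_ge0 ?expR_ge0// -natrM bin_ffact -natrX ler_nat.
exact: ffact_le_expn.
Qed.

Variables (c : R) (D : nat).
Hypothesis c1 : 1 <= c.
Hypothesis D0 : (0 < D)%N.

(** The ceiling of [(1 + 1 / D) * s]. *)
Definition excess_size s := ((D.+1 * s + D.-1) %/ D)%N.

Lemma excess_size_ge s : (D.+1 * s <= D * excess_size s)%N.
Proof.
have := ltn_ceil (D.+1 * s + D.-1) D0; rewrite -/(excess_size s) mulSn mulnC.
by move: D0; case: (D) => // d _; lia.
Qed.

Lemma excess_size_le s x : (D.+1 * s <= D * x)%N -> (excess_size s <= x)%N.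
Proof.
move=> h; rewrite /excess_size -ltnS ltn_divLR//.
by move: h D0; case: (D) => // d; lia.
Qed.

(** The largest ratio [r = s / n] for which [expR 1 ^+ (2 * D).+1 * c ^+ D.+1 * r <= 2^-1 ^+ D],
    which is what the first-moment bound reduces to. *)
Definition sparse_delta : R := 2^-1 ^+ D / (expR 1 ^+ (2 * D).+1 * c ^+ D.+1).

Lemma sparse_delta_gt0 : 0 < sparse_delta.
Proof.
apply: divr_gt0; first by apply: exprn_gt0; lra.
by apply: mulr_gt0; apply: exprn_gt0; [exact: expR_gt0|exact: lt_le_trans c1].
Qed.

(** The left side bounds the number of vertex sets of size [s] times the expected number of ways to
    find [excess_size s] edges inside one. Raising to the power [D] clears the fraction in the
    exponent and leaves one surplus factor [r]. *)
Lemma sparse_term n s : (0 < n)%N -> (0 < s)%N -> s%:R <= sparse_delta * n%:R ->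
  (expR 1 * n%:R / s%:R) ^+ s * (expR 1 * c * (s%:R / n%:R)) ^+ excess_size s <= 2^-1 ^+ s.
Proof.
move=> n0 s0 sd; set m := excess_size s; set A := expR 1.
have A0 : 0 < A by exact: expR_gt0.
have A1 : 1 <= A by rewrite -(expR0 R) ler_expR.
have c0 : 0 < c by exact: lt_le_trans c1.
have nn0 : 0 < n%:R :> R by rewrite ltr0n.
have ss0 : 0 < s%:R :> R by rewrite ltr0n.
pose r : R := s%:R / n%:R.
have r0 : 0 < r by rewrite divr_gt0.
have rd : r <= sparse_delta by rewrite ler_pdivrMr.
(* The base of the second power is then at most 1, so rounding its exponent up does no harm. *)
have Acd : A * c * sparse_delta <= 1.
  rewrite /sparse_delta -/A mulrA ler_pdivrMr ?mul1r; last by rewrite mulr_gt0 ?exprn_gt0.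
  rewrite exprS (exprS c) mulrACA; apply: ler_wpM2l; first by rewrite mulr_ge0// ltW.
  apply: (@le_trans _ _ 1); first by apply: exprn_ile1; lra.
  by rewrite -[1](mulr1 1); apply: ler_pM => //; exact: exprn_ege1.
have th1 : A * c * r <= 1.
  by apply: le_trans Acd; rewrite ler_wpM2l// mulr_ge0// ltW.
have A0' := ltW A0; have c0' := ltW c0; have r0' := ltW r0.
have Ac0 : 0 <= A * c by exact: mulr_ge0.
have th0 : 0 <= A * c * r by exact: mulr_ge0.
have Ar0 : 0 <= A / r by exact: divr_ge0.
have -> : A * n%:R / s%:R = A / r.
  by rewrite /r invf_div mulrA.
rewrite -/r; clearbody r.
have T0 : 0 <= (A / r) ^+ s * (A * c * r) ^+ m.
  by apply: mulr_ge0; exact: exprn_ge0.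
have half0 : 0 <= (2^-1 : R) by lra.
rewrite -(@ler_pXn2r R D)// ?nnegrE ?exprn_ge0//.
rewrite exprMn -!exprM.
apply: (@le_trans _ _ ((A / r) ^+ (s * D) * (A * c * r) ^+ (D.+1 * s))).
  rewrite ler_wpM2l ?exprn_ge0 ?divr_ge0 //.
  apply: ler_wiXn2l => //; rewrite [leqRHS]mulnC; exact: excess_size_ge.
rewrite (mulnC s D) (exprM _ D s) (exprM _ D.+1 s) (exprM _ D s) -exprMn.
have X0 : 0 <= (A / r) ^+ D * (A * c * r) ^+ D.+1 by apply: mulr_ge0; exact: exprn_ge0.
apply: lerXn2r; rewrite ?nnegrE //; first exact: exprn_ge0.
have -> : (A / r) ^+ D * (A * c * r) ^+ D.+1 = (A ^+ (2 * D).+1 * c ^+ D.+1) * r.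
  rewrite !exprMn exprVn (exprS A D) (exprS r D) (exprS A (2 * D)) mul2n -addnn (exprD A D D); field.
  by rewrite expf_neq0// lt0r_neq0.
rewrite mulrC -ler_pdivlMr//; first by rewrite mulr_gt0 ?exprn_gt0.
Qed.

Variables (n : nat) (p : 'I_n * 'I_n -> R).
Hypothesis p01 : forall q, 0 <= p q <= 1.
Hypothesis pc : forall q, p q <= c / n%:R.
Hypothesis n0 : (0 < n)%N.

(** Sets with fewer than [s0] vertices are exempt, because the geometric series of the union bound
    is small only from [s0] on; [core_size] pads its sets accordingly. *)
Definition dense_set (E : {set 'I_n * 'I_n}) (s0 : nat) :=
  [exists S : {set 'I_n}, [&& (s0 <= #|S|)%N, #|S|%:R <= sparse_delta * n%:R &
     (D.+1 * #|S| <= D * #|E :&: inner S|)%N]].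

(** Union bound over the sets [S] of each size and over the edge sets [F] of size [excess_size s]
    inside them. *)
Lemma dense_set_prob s0 : (0 < s0)%N ->
  Ex p (pairsn n) (fun E => (dense_set E s0)%:R) <= 2 * 2^-1 ^+ s0.
Proof.
move=> s00.
have c0 : 0 <= c by exact: le_trans c1.
have nn0 : 0 < n%:R :> R by rewrite ltr0n.
pose P s := (s0 <= s)%N && (s%:R <= sparse_delta * n%:R).
apply: (@le_trans _ _ (\sum_(s < n.+1 | P s) 2^-1 ^+ s)).
  apply: (@le_trans _ _ (Ex p (pairsn n) (fun E => \sum_(s < n.+1 | P s)
     \sum_(S in [set S : {set 'I_n} | #|S| == s])
     \sum_(F in [set F : {set 'I_n * 'I_n} | (F \subset inner S) && (#|F| == excess_size s)])
        (F \subset E)%:R))).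
    apply: ler_Ex => // E _; have [|_] := boolP (dense_set E s0); last first.
      by do 3 apply: sumr_ge0 => ? _.
    case/existsP => S /and3P[h1 h2 h3].
    have [F FS Fm] := subset_of_card (excess_size_le h3).
    move: FS; rewrite subsetI => /andP[FE FI].
    have Sn : (#|S| < n.+1)%N by rewrite ltnS -[leqRHS]card_ord max_card.
    rewrite (bigD1 (Ordinal Sn))/=; last by rewrite /P h1.
    rewrite (bigD1 S)/=; last by rewrite inE.
    rewrite (bigD1 F)/=; last by rewrite inE FI Fm eqxx.
    rewrite FE -!addrA lerDl !addr_ge0//; first by apply: sumr_ge0.
      by do 2 apply: sumr_ge0 => ? _.
    by do 3 apply: sumr_ge0 => ? _.
  rewrite Ex_sum; apply: ler_sum => s /andP[ss0 sd].
  have s1 : (0 < s)%N by exact: leq_trans ss0.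
  apply: le_trans (sparse_term n0 s1 sd).
  have hS (S : {set 'I_n}) : #|S| == s ->
     Ex p (pairsn n) (fun E => \sum_(F in [set F : {set 'I_n * 'I_n} |
        (F \subset inner S) && (#|F| == excess_size s)]) (F \subset E)%:R) <=
     (expR 1 * c * (s%:R / n%:R)) ^+ excess_size s.
    move=> /eqP Ss; rewrite Ex_sum; set m := excess_size s.
    have m0 : (0 < m)%N.
      by have := excess_size_ge s; rewrite -/m; move: s1 D0; case: (m) => //; lia.
    have sm : (s <= m)%N.
      rewrite -(leq_pmul2l D0); apply: leq_trans (excess_size_ge s); rewrite leq_mul2r leqnSn orbT//.
    apply: (@le_trans _ _ (\sum_(F in [set F : {set 'I_n * 'I_n} |
        (F \subset inner S) && (#|F| == m)]) (c / n%:R) ^+ m)).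
      apply: ler_sum => F; rewrite inE => /andP[FI /eqP Fm].
      rewrite Ex_subset; last exact: subset_trans FI (inner_sub _).
      rewrite -Fm -prodr_const; apply: ler_prod => q _.
      by have /andP[-> _] := p01 q; rewrite pc.
    rewrite sumr_const cards_draws -[leLHS]mulr_natl.
    apply: le_trans (ler_wpM2r _ (bin_le _ m0)) _; first by rewrite exprn_ge0// divr_ge0.
    rewrite -exprMn; have mm0 : 0 < m%:R :> R by rewrite ltr0n.
    have I2 : (#|inner S| <= s ^ 2)%N.
      rewrite -Ss -mulnn -cardsX; apply: subset_leq_card; apply/subsetP => q.
      by rewrite !inE => /andP[_].
    have Im : #|inner S|%:R / m%:R <= s%:R :> R.
      rewrite ler_pdivrMr// -natrM ler_nat; apply: leq_trans I2 _.
      by rewrite -mulnn leq_mul2l sm orbT.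
    apply: lerXn2r; [by rewrite nnegrE !(mulr_ge0, invr_ge0, expR_ge0)|by rewrite nnegrE !(mulr_ge0, invr_ge0, expR_ge0)|].
    have -> : expR 1 * #|inner S|%:R / m%:R * (c / n%:R) =
       (expR 1 * c / n%:R) * (#|inner S|%:R / m%:R) by ring.
    have -> : expR 1 * c * (s%:R / n%:R) = (expR 1 * c / n%:R) * s%:R by ring.
    by apply: ler_wpM2l => //; rewrite divr_ge0 ?mulr_ge0 ?expR_ge0.
  rewrite Ex_sum.
  apply: (@le_trans _ _ (\sum_(S in [set S : {set 'I_n} | #|S| == s])
     (expR 1 * c * (s%:R / n%:R)) ^+ excess_size s)).
    by apply: ler_sum => S; rewrite inE; exact: hS.
  rewrite sumr_const card_draws card_ord -[leLHS]mulr_natl.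
  apply: ler_wpM2r; last exact: bin_le.
  by rewrite exprn_ge0// !(mulr_ge0, invr_ge0, expR_ge0).
have half0 : 0 <= (2^-1 : R) by lra.
apply: (@le_trans _ _ (\sum_(s0 <= s < n.+1 + s0) 2^-1 ^+ s)).
  rewrite (big_ord_widen_cond _ P (fun s => 2^-1 ^+ s) (leq_addr s0 n.+1)).
  rewrite big_mkcond/= -(big_mkord xpredT (fun s => if P s && (s < n.+1)%N then 2^-1 ^+ s else 0)).
  rewrite (big_cat_nat (leq0n s0) (leq_addl n.+1 s0))/= big_nat big1 ?add0r.
    by apply: ler_sum => s _; case: ifP => // _; rewrite exprn_ge0.
  by move=> s /andP[_ ss0]; rewrite /P leqNgt ss0.
elim: n.+1 => [|N IH]; first by rewrite add0n big_geq// mulr_ge0// exprn_ge0.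
suff h N' : \sum_(s0 <= s < N' + s0) 2^-1 ^+ s <= 2 * 2^-1 ^+ s0 - 2 * 2^-1 ^+ (N' + s0) :> R.
  by apply: le_trans (h _) _; rewrite gerBl mulr_ge0// exprn_ge0.
elim: N' => [|N' IH']; first by rewrite add0n big_geq// subrr.
rewrite addSn big_nat_recr ?leq_addl//= exprS; move: IH'; set x := _ ^+ (N' + _); lra.
Qed.

End Sparse.

(** * Second moment of the degrees *)

Section Degrees.
Variables (R : realType) (n : nat) (p : 'I_n * 'I_n -> R) (c : R).
Hypothesis p01 : forall q, 0 <= p q <= 1.
Hypothesis pc : forall q, p q <= c / n%:R.
Hypothesis n0 : (0 < n)%N.
Hypothesis c0 : 0 <= c.

Definition sqdeg (E : {set 'I_n * 'I_n}) : nat := \sum_(v : 'I_n) #|[set w | adj E v w]| ^ 2.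

Lemma Ex_sqdeg : Ex p (pairsn n) (fun E => (sqdeg E)%:R) <= (c + c ^+ 2) * n%:R.
Proof.
have nn0 : 0 < n%:R :> R by rewrite ltr0n.
have cn0 : 0 <= c / n%:R by rewrite divr_ge0.
have one v w : Ex p (pairsn n) (fun E => (adj E v w)%:R) <= c / n%:R.
  have [->|vw] := eqVneq v w.
    rewrite (@eq_Ex _ _ p (pairsn n) _ (fun=> 0)) ?Ex_cst// => E EP.
    by rewrite (negbTE (adj_irr w EP)).
  rewrite (@eq_Ex _ _ p (pairsn n) _ (fun E => (adj E v w)%:R * 1)) => [|E _]; last by rewrite mulr1.
  by rewrite Ex_adj// Ex_cst mulr1.
have two v w w' : w != w' ->
    Ex p (pairsn n) (fun E => (adj E v w)%:R * (adj E v w')%:R) <= (c / n%:R) ^+ 2.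
  move=> ww'; have [->|vw] := eqVneq v w.
    rewrite (@eq_Ex _ _ p (pairsn n) _ (fun=> 0)) ?Ex_cst ?sqr_ge0// => E EP.
    by rewrite (negbTE (adj_irr w EP)) mul0r.
  rewrite Ex_adj//; last first.
    move=> E; rewrite /adj !inE.
    have h a b : ((a, b) == ed v w) -> (a == w) || (b == w).
      by move=> /eqP; rewrite /ed; case: ifP => _ [-> ->]; rewrite eqxx ?orbT.
    have e1 : ((v, w') == ed v w) = false.
      by apply/negP => /h; rewrite (negbTE vw) eq_sym (negbTE ww').
    have e2' : ((w', v) == ed v w) = false.
      by apply/negP => /h; rewrite (negbTE vw) eq_sym (negbTE ww').
    by rewrite e1 e2'.
  rewrite expr2; apply: ler_pM => //.
    by have /andP[] := p01 (ed v w).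
  by apply: Ex_ge0.
have sq E : (sqdeg E)%:R = \sum_(v : 'I_n) \sum_(w : 'I_n) \sum_(w' : 'I_n) (adj E v w)%:R * (adj E v w')%:R :> R.
  rewrite /sqdeg natr_sum; apply: eq_bigr => v _.
  have -> : #|[set w | adj E v w]|%N = (\sum_(w : 'I_n) adj E v w)%N.
    by rewrite -sum1_card big_mkcond; apply: eq_bigr => w _; rewrite inE; case: adj.
  rewrite -mulnn natrM natr_sum mulr_suml; apply: eq_bigr => w _.
  by rewrite mulr_sumr.
rewrite (@eq_Ex _ _ p (pairsn n) _ (fun E => \sum_(v : 'I_n) \sum_(w : 'I_n) \sum_(w' : 'I_n)
   (adj E v w)%:R * (adj E v w')%:R)); last by move=> E _; exact: sq.
rewrite Ex_sum.
apply: (@le_trans _ _ (\sum_(v : 'I_n) \sum_(w : 'I_n) (c / n%:R + n%:R * (c / n%:R) ^+ 2))).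
  apply: ler_sum => v _; rewrite Ex_sum; apply: ler_sum => w _; rewrite Ex_sum.
  rewrite (bigD1 w)//=; apply: lerD.
    rewrite (@eq_Ex _ _ p (pairsn n) _ (fun E => (adj E v w)%:R)) ?one// => E _.
    by case: adj; rewrite ?mulr1 ?mulr0.
  apply: (@le_trans _ _ (\sum_(w' in [set w' | w' != w]) (c / n%:R) ^+ 2)).
    rewrite big_set; apply: ler_sum => w' ww'; apply: two; by rewrite eq_sym.
  by apply: sum_le_n; exact: sqr_ge0.
rewrite !sumr_const card_ord -[leLHS]mulr_natl -[X in _ * X <= _]mulr_natl.
by rewrite le_eqVlt; apply/orP; left; apply/eqP; field; rewrite lt0r_neq0.
Qed.

Lemma sqdeg_prob (L : nat) : (0 < L)%N ->
  Ex p (pairsn n) (fun E => (L * n < sqdeg E)%N%:R) <= (c + c ^+ 2) / L%:R.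
Proof.
move=> L0; have nn0 : 0 < n%:R :> R by rewrite ltr0n.
have LL0 : 0 < L%:R :> R by rewrite ltr0n.
rewrite ler_pdivlMr// -(ler_pM2r nn0) -mulrA -ExZr.
apply: le_trans Ex_sqdeg; apply: ler_Ex => // E _.
case: ltnP => h; last by rewrite mul0r.
by rewrite mul1r -natrM ler_nat ltnW.
Qed.

End Degrees.

(** * Bounds for finitary kernels *)

Lemma ck_ge n k (E : {set 'I_n * 'I_n}) (Z : {set 'I_n}) :
  (forall v, v \in Z -> (k <= #|[set w in Z | adj E v w]|)%N) -> (#|Z| <= ck k E)%N.
Proof.
move=> h; apply: subset_leq_card; rewrite /kcore; apply: bigcup_sup.
by apply/forallP => v; apply/implyP; exact: h.
Qed.

(** The deterministic half of the lower bound: every vertex robust through [T] blocks is in the core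
    unless it is near [H]. The probabilistic half only has to make the hypotheses on degrees and
    density likely. *)
Lemma core_size n k d T s0 a L (R : realType) (c eps : R) (E : {set 'I_n * 'I_n})
    (delta : R) : E \subset pairsn n -> (0 < T)%N -> (0 < s0)%N -> (s0 <= n)%N ->
  a = (4 * d.+1 + 1)%N ->
  (forall (V : finType) (e : rel V) (H : {set V}), symmetric e ->
    (\sum_(v : V) #|[set w | e v w]| ^ 2 <= L * #|V|)%N ->
    #|H|%:R <= delta * #|V|%:R -> #|iter d.+1 (N1 e) H|%:R <= eps * #|V|%:R) ->
  (forall B : {set 'I_n}, (T * #|B| <= n + L * n)%N ->
    (1 + 6 * a)%:R * (#|B| + s0)%:R <= Num.min delta (sparse_delta c (4 * a)) * n%:R) ->
  (sqdeg E <= L * n)%N -> ~~ dense_set c (4 * a) E s0 ->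
  #|[set u | (loc (adj E) k (sched d T) k (setT :\ u) u).2]|%:R <= (ck k E)%:R + eps * n%:R.
Proof.
move=> EP T0 s00 s0n aE ball small dg nd.
have es := @adj_sym n E.
have [t [B [tT [XB TB]]]] := @bad_pigeonhole _ (adj E) k d T T0.
have degs : (\sum_(v : 'I_n) #|[set w | adj E v w]| <= L * n)%N.
  apply: leq_trans dg; apply: leq_sum => v _; rewrite -mulnn.
  by case: #|_| => // x; rewrite leq_pmulr.
have {}TB : (T * #|B| <= n + L * n)%N.
  by apply: leq_trans TB _; rewrite card_ord leq_add2l.
(* Padding the bad set by [s0] vertices makes it nonempty and large enough for the sparsity
   estimate. *)
have [B0 _ cB0] : exists2 F : {set 'I_n}, F \subset setT & #|F| = s0.
  by apply: subset_of_card; rewrite cardsT card_ord.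
pose B' := B :|: B0.
have B's0 : (s0 <= #|B'|)%N by rewrite -cB0 subset_leq_card ?subsetUr.
have B'c : (#|B'| <= #|B| + s0)%N by rewrite -cB0 cardsU leq_subr.
have Hsize (A : {set 'I_n}) : (#|A| <= (1 + 6 * a) * #|B'|)%N ->
    #|A|%:R <= Num.min delta (sparse_delta c (4 * a)) * n%:R.
  move=> hA; apply: le_trans (small B TB); rewrite -natrM ler_nat.
  by apply: leq_trans hA _; rewrite leq_mul2l B'c orbT.
have [||H [BH cH cl]] := @closure_exists _ (adj E) es d a B' aE.
- exact: leq_trans B's0.
- move=> A A1 A2; have /existsPn/(_ A) := nd.
  rewrite (leq_trans B's0 A1)/=.
  have -> /= : #|A|%:R <= sparse_delta c (4 * a) * n%:R.
    by apply: le_trans (Hsize A A2) _; rewrite ler_wpM2r// ge_min lexx orbT.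
  rewrite -ltnNge => lt; have := e2_inner A EP => e2A.
  have h1 : (4 * a * e2 (adj E) A <= 4 * a * (2 * #|E :&: inner A|))%N by rewrite leq_mul2l e2A orbT.
  have h2 : (2 * (4 * a * #|E :&: inner A|) < 2 * ((4 * a).+1 * #|A|))%N by rewrite ltn_pmul2l.
  by apply: leq_ltn_trans h1 _; rewrite mulnCA (leq_trans h2)// mulnA addn1.
have BsubH : B \subset H by apply: subset_trans BH; exact: subsetUl.
have [Z [Zk ZX]] := @core_lower _ (adj E) k es d H t B cl BsubH XB.
have cZ := ck_ge Zk.
have nH : #|[set u | near_H (adj E) d H None u]|%:R <= eps * n%:R.
  apply: (@le_trans _ _ #|iter d.+1 (N1 (adj E)) H|%:R); first by rewrite ler_nat card_near_H.
  rewrite -[n in X in _ <= X]card_ord; apply: ball => //; rewrite card_ord//.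
  by apply: le_trans (Hsize H cH) _; rewrite ler_wpM2r// ge_min lexx.
have sub : (#|[set u | (loc (adj E) k (sched d T) k (setT :\ u) u).2]| <=
   #|Z| + #|[set u | near_H (adj E) d H None u]|)%N.
  apply: leq_trans (_ : #|Z :|: [set u | near_H (adj E) d H None u]| <= _)%N; last first.
    by rewrite cardsU leq_subr.
  apply: subset_leq_card; apply/subsetP => u; rewrite !inE => lu.
  case: (boolP (near_H _ _ _ _ _)) => nu; first by rewrite orbT.
  rewrite orbF; apply: ZX => //; apply: (@stage_le _ _ _ _ _ T); first exact: ltnW.
  have uU : u \notin setT :\ u by rewrite !inE eqxx.
  have /andP[_ /implyP h] := @loc_gr _ (adj E) k (sched d T) None (setT :\ u) u isT uU.
  exact: h.
apply: (@le_trans _ _ (#|Z|%:R + #|[set u | near_H (adj E) d H None u]|%:R)).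
  by rewrite -natrD ler_nat.
by apply: lerD => //; rewrite ler_nat.
Qed.

Section Lower.
Variables (R : realType) (r : nat) (kap : 'I_r -> 'I_r -> R) (mu : 'I_r -> R) (c : R) (k : nat).
Hypothesis kap_ge0 : forall i j, 0 <= kap i j.
Hypothesis kap_le : forall i j, kap i j <= c.
Hypothesis kapC : forall i j, kap i j = kap j i.
Hypothesis mu_ge0 : forall i, 0 <= mu i.
Hypothesis c1 : 1 <= c.
Hypothesis k2 : (2 <= k)%N.

(** The constants are chosen in this order: [d] from the recursion, [L] and [s0] from the failure
    probabilities, the admissible size [dB] of a bad set from [d], [L] and the sparsity, then [T] to
    make the pigeonhole set smaller than that, and finally [delta] and [N] from the law of large
    numbers at depth [d.+1] times [T]. *)
Theorem finitary_core_lower (x : R) (q : 'I_r -> R) (eps : R) :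
  0 <= x -> x < 1 -> (forall i, 0 <= q i) -> (forall i, q i <= 1) ->
  (forall i, q i <= psi k.-1 (x * Kop kap mu q i)) -> 0 < eps ->
  exists (delta : R) (N : nat), 0 < delta /\
  forall n (tau : 'I_n -> 'I_r), (N <= n)%N -> types_close mu tau delta ->
    Ex (tprob kap tau) (pairsn n) (fun E =>
      ((ck k E)%:R < (\sum_i mu i * psi k (x * Kop kap mu q i) - eps) * n%:R)%R%:R) <= eps.
Proof.
move=> x0 x1 q0 q1 qfix e0.
set bc := \sum_i _.
have c0 : 0 <= c by exact: le_trans c1.
pose e4 := eps / 4.
have e40 : 0 < e4 by rewrite /e4 divr_gt0.
pose M := \sum_i mu i.
have M0 : 0 <= M by apply: sumr_ge0.
have [|d hd] := @robust_recursion R r kap mu kap_ge0 mu_ge0 k x q (e4 / (M + 1)) k2 x0 x1 q0 q1 qfix.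
  by rewrite divr_gt0// ltr_wpDl.
have limT T : bc - e4 <= \sum_i mu i * (lim_loc kap mu k (sched d T) k i).2.
  apply: (@le_trans _ _ (\sum_i mu i * (psi k (x * Kop kap mu q i) - e4 / (M + 1)))).
    rewrite (eq_bigr (fun i => mu i * psi k (x * Kop kap mu q i) - mu i * (e4 / (M + 1)))); last first.
      by move=> i _; rewrite mulrBr.
    rewrite sumrB -mulr_suml -/bc -/M lerD2l lerN2 mulrCA ler_piMr ?(ltW e40)//.
    by rewrite ler_pdivrMr ?ltr_wpDl// mul1r lerDl.
  by apply: ler_sum => i _; rewrite ler_wpM2l.
have cc0 : 0 < c + c ^+ 2 by rewrite ltr_wpDr ?sqr_ge0// (lt_le_trans _ c1).
have [L1 hL1] := @inv_nat_small R (e4 / (c + c ^+ 2)) ltac:(by rewrite divr_gt0).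
pose L := L1.+1.
have [_ LE] := hL1 L (leqnSn _).
pose a := (4 * d.+1 + 1)%N.
have [s1 hs1] := @exprn_small R (2^-1) (e4 / 2) ltac:(lra) ltac:(lra) ltac:(by rewrite divr_gt0).
pose s0 := s1.+1.
have s0E := hs1 s0 (leqnSn _).
have [dH dH0 ball] := @iter_N1_small R L d.+1 e4 e40.
have D0 : (0 < 4 * a)%N by rewrite /a addn1.
have sd0 := @sparse_delta_gt0 R c (4 * a) c1.
pose dm := Num.min dH (sparse_delta c (4 * a)).
have dm0 : 0 < dm by rewrite lt_min dH0.
pose dB := dm / (1 + 6 * a)%:R.
have a60 : 0 < (1 + 6 * a)%:R :> R by rewrite ltr0n.
have dB0 : 0 < dB by rewrite divr_gt0.
have [T1 hT1] := @inv_nat_small R (dB / 2 / (1 + L)%:R) ltac:(by rewrite !divr_gt0// ltr0n).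
pose T := T1.+1.
have [_ TE] := hT1 T (leqnSn _).
have [N2 hN2] := @inv_nat_small R (dB / 2 / s0%:R) ltac:(by rewrite !divr_gt0// ltr0n).
(* Summed over the types this bounds the mean of [F] by [e4 ^+ 2], so by Markov's inequality [F]
   exceeds [e4] with probability at most [e4]. *)
pose e' := e4 ^+ 2 / (r%:R + 1).
have r10 : 0 < r%:R + 1 :> R by rewrite ltr_wpDl.
have e'0 : 0 < e' by rewrite divr_gt0// exprn_gt0.
have [dl [N1' [dl0 hLLN]]] := @LLN R r kap mu c k kap_ge0 kap_le kapC mu_ge0 c0 (sched d T) k e' 0 e'0.
exists dl, (maxn N1' (maxn N2 (maxn s0 1))); split => // n tau.
rewrite !geq_max => /and4P[n1 n2 n3 n0] cl.
have nn0 : 0 < n%:R :> R by rewrite ltr0n.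
have [_ nE] := hN2 n n2.
have p01 := tprob01 kap_ge0 tau.
have pc := @tprob_le R r kap c kap_le n tau.
pose av j E := avg R k tau true (sched d T) k j setT E.
pose lj j := (lim_loc kap mu k (sched d T) k j).2.
pose F E : R := \sum_j `|av j E - mu j * lj j|.
have ExF : Ex (tprob kap tau) (pairsn n) F <= e4 ^+ 2.
  rewrite /F Ex_sum; apply: (@le_trans _ _ (\sum_(j < r) e')).
    apply: ler_sum => j _; apply: (hLLN n tau n1 cl setT j true).
    by rewrite setCT cards0.
  rewrite sumr_const card_ord -[leLHS]mulr_natl /e' mulrCA ler_piMr ?sqr_ge0//.
  by rewrite ler_pdivrMr// mul1r lerDl.
have F0 E : 0 <= F E by apply: sumr_ge0.
(* A small core forces one of three failures: large degrees, a dense set, or [F E > e4]; the last is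
   charged as [F E / e4]. *)
apply: (@le_trans _ _ (Ex (tprob kap tau) (pairsn n) (fun E =>
   ((L * n < sqdeg E)%N%:R + (dense_set c (4 * a) E s0)%:R) + e4^-1 * F E))).
  apply: ler_Ex => // E EP; case: (boolP (_ < _)%R) => [bad|_]; last first.
    by rewrite !addr_ge0// mulr_ge0// invr_ge0 ltW.
  have [dg|dg] := ltnP (L * n) (sqdeg E).
    by rewrite -addrA lerDl addr_ge0// mulr_ge0// invr_ge0 ltW.
  have [dn|dn] := boolP (dense_set c (4 * a) E s0).
    by rewrite add0r lerDl mulr_ge0// invr_ge0 ltW.
  rewrite !add0r; case: (leP (F E) e4) => FE; last first.
    by rewrite mulrC ler_pdivlMr// mul1r ltW.
  suff : (bc - eps) * n%:R <= (ck k E)%:R by rewrite leNgt bad.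
  have := @core_size n k d T s0 a L R c e4 E dH EP isT isT n3 erefl ball _ dg dn.
  have smallB (B : {set 'I_n}) : (T * #|B| <= n + L * n)%N ->
    (1 + 6 * a)%:R * (#|B| + s0)%:R <= Num.min dH (sparse_delta c (4 * a)) * n%:R.
    rewrite -(ler_nat R) natrM natrD natrM => TB.
    rewrite -/dm mulrC -ler_pdivlMr// mulrAC -/dB natrD.
    have TT0 : 0 < T%:R :> R by rewrite ltr0n.
    have L10 : 0 < (1 + L)%:R :> R by rewrite ltr0n.
    have h1 : #|B|%:R <= dB / 2 * n%:R.
      rewrite -(ler_pM2l TT0); apply: le_trans TB _.
      have : (1 + L)%:R * T%:R^-1 <= dB / 2 by rewrite mulrC -ler_pdivlMr.
      move=> h; have := ler_wpM2r (ltW nn0) h; rewrite -(ler_pM2l TT0).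
      have -> : T%:R * ((1 + L)%:R / T%:R * n%:R) = n%:R + L%:R * n%:R :> R.
        by rewrite natrD; field; rewrite lt0r_neq0.
      by [].
    have h2 : s0%:R <= dB / 2 * n%:R.
      have ss0 : 0 < s0%:R :> R by rewrite ltr0n.
      have : s0%:R * n%:R^-1 <= dB / 2 by rewrite mulrC -ler_pdivlMr.
      by rewrite ler_pdivrMr.
    lra.
  move=> /(_ smallB).
  have -> : #|[set u | (loc (adj E) k (sched d T) k (setT :\ u) u).2]|%:R = n%:R * \sum_j av j E.
    rewrite mulr_sumr -sum1_card natr_sum big_mkcond/= (partition_big tau xpredT)//=.
    apply: eq_bigr => j _; rewrite /av /avg mulrA divff ?lt0r_neq0// mul1r.
    rewrite [LHS]big_mkcond [RHS]big_mkcond; apply: eq_bigr => u _.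
    by rewrite !inE /=; case: (tau u == j) => //; case: (loc _ _ _ _ _ _).2.
  have h3 : \sum_j mu j * lj j - e4 <= \sum_j av j E.
    rewrite lerBlDr -lerBlDl -sumrB; apply: le_trans FE; rewrite /F.
    by apply: ler_sum => j _; rewrite distrC ler_norm.
  have h4 := limT T; rewrite -/lj in h4.
  have h5 : bc - e4 - e4 <= \sum_j av j E by apply: le_trans h3; rewrite lerD2r.
  have h6 := ler_wpM2l (ltW nn0) h5.
  move=> h7; have h8 : 0 <= e4 * n%:R by rewrite mulr_ge0// ltW.
  have e4E : eps = 4 * e4 by rewrite /e4; field.
  rewrite e4E; lra.
rewrite ExD ExD ExZ.
have g1 : Ex (tprob kap tau) (pairsn n) (fun E => (L * n < sqdeg E)%N%:R) <= e4.
  apply: le_trans (@sqdeg_prob R n (tprob kap tau) c p01 pc n0 c0 L isT) _.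
  by rewrite mulrC -ler_pdivlMr.
have g2 : Ex (tprob kap tau) (pairsn n) (fun E => (dense_set c (4 * a) E s0)%:R) <= e4.
  apply: le_trans (@dense_set_prob R c (4 * a) c1 D0 n (tprob kap tau) p01 pc n0 s0 isT) _.
  lra.
have g3 : e4^-1 * Ex (tprob kap tau) (pairsn n) F <= e4.
  rewrite mulrC ler_pdivrMr//; apply: le_trans ExF _; by rewrite expr2.
have e4E : eps = 4 * e4 by rewrite /e4; field.
rewrite e4E; lra.
Qed.

End Lower.

(** * Short cycles and the upper bound *)

Section Chord.
Variables (V : finType).

(* [chord e h F P U u]: some walk of at most [h] new vertices of [U] starting at [u] reaches a
   vertex with an edge back to an earlier vertex which is not its predecessor; [F] and [P] are
   the earlier vertices, [P] containing only the predecessor of [u]. *)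
Fixpoint chord (e : rel V) (h : nat) (F P U : {set V}) (u : V) : bool :=
  [exists f in F, e u f] ||
  (if h is h'.+1 then [exists w in U, e u w && chord e h' (F :|: P) [set u] (U :\ w) w]
   else false).

Lemma chord_congr (e e' : rel V) h (F P U : {set V}) u :
  (forall x y, x \in U -> e x y = e' x y) ->
  (forall y, y \in F :|: U -> e u y = e' u y) ->
  chord e h F P U u = chord e' h F P U u.
Proof.
elim: h F P U u => [|h IH] F P U u eU eu /=; congr (_ || _).
- by apply: eq_existsb => f; case: (boolP (f \in F)) => //= fF; rewrite eu// inE fF.
- by apply: eq_existsb => f; case: (boolP (f \in F)) => //= fF; rewrite eu// inE fF.
- apply: eq_existsb => w; case: (boolP (w \in U)) => //= wU; rewrite eu ?inE ?wU ?orbT//.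
  congr (_ && _); apply: IH => [x y|y _]; last exact: eU.
  by rewrite inE => /andP[_ xU]; exact: eU.
Qed.

End Chord.

Lemma adj_toggle2 n (u w a b : 'I_n) (E : {set 'I_n * 'I_n}) : ed a b != ed u w ->
  adj (ed u w |: E) a b = adj (E :\ ed u w) a b.
Proof.
move=> neq; rewrite /adj !inE.
have h x y : ed x y != ed u w -> ((x, y) == ed u w) = false.
  move=> xy; apply/negbTE; apply: contra xy => /eqP xyE; apply/eqP.
  have [[-> ->]|[-> ->]] : (x = u /\ y = w) \/ (x = w /\ y = u); last exact: edC; last by [].
  by move: xyE; rewrite /ed; case: ifP => _ [-> ->]; [left|right].
by rewrite !h// edC.
Qed.

Section ChordProb.
Variables (R : realFieldType) (n : nat) (p : 'I_n * 'I_n -> R) (c : R).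
Hypothesis p01 : forall q, 0 <= p q <= 1.
Hypothesis pc : forall q, p q <= c / n%:R.
Hypothesis n0 : (0 < n)%N.
Hypothesis c0 : 0 <= c.

Fixpoint chord_bound (h f : nat) : R :=
  c * f%:R + (if h is h'.+1 then c * chord_bound h' f.+1 else 0).

Lemma chord_bound_ge0 h f : 0 <= chord_bound h f.
Proof. by elim: h f => [|h IH] f /=; rewrite addr_ge0 ?mulr_ge0. Qed.

(** First moment: each step of the walk costs [c / n] against at most [n] new vertices, while the
    closing edge has at most [f] targets and leaves a factor [1 / n]. The predecessor joins the
    targets at the next step, so [f] grows by one. *)
Lemma chord_prob h f (F P U : {set 'I_n}) u : (#|F| <= f)%N -> (#|P| <= 1)%N ->
  u \notin U -> u \notin F -> u \notin P -> [disjoint F :|: P & U] ->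
  Ex p (pairsn n) (fun E => (chord (adj E) h F P U u)%:R) <= chord_bound h f / n%:R.
Proof.
have nn0 : 0 < n%:R :> R by rewrite ltr0n.
have cn0 : 0 <= c / n%:R by rewrite divr_ge0.
elim: h f F P U u => [|h IH] f F P U u Ff P1 uU uF uP FU.
  apply: (@le_trans _ _ (Ex p (pairsn n) (fun E => \sum_(x in F) (adj E u x)%:R * 1))).
    apply: ler_Ex => // E _; rewrite /= orbF; case: existsP => [[x /andP[xF ux]]|_].
      by rewrite (bigD1 x)//= ux mulr1 lerDl sumr_ge0// => i _; rewrite mulr_ge0.
    by rewrite sumr_ge0// => i _; rewrite mulr_ge0.
  rewrite Ex_sum /= addr0; apply: (@le_trans _ _ (\sum_(x in F) c / n%:R)).
    apply: ler_sum => x xF; rewrite Ex_adj// ?Ex_cst ?mulr1//.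
    by apply: contraNneq uF => ->.
  rewrite sumr_const -[leLHS]mulr_natl mulrCA mulrA ler_wpM2r ?invr_ge0//.
  by rewrite ler_wpM2l// ler_nat.
apply: (@le_trans _ _ (Ex p (pairsn n) (fun E => \sum_(x in F) (adj E u x)%:R * 1 +
   \sum_(w in U) (adj E u w)%:R * (chord (adj E) h (F :|: P) [set u] (U :\ w) w)%:R))).
  apply: ler_Ex => // E _; have g1 : 0 <= \sum_(x in F) (adj E u x)%:R * 1 :> R.
    by apply: sumr_ge0 => i _; rewrite mulr_ge0.
  have g2 : 0 <= \sum_(w in U) (adj E u w)%:R * (chord (adj E) h (F :|: P) [set u] (U :\ w) w)%:R :> R.
    by apply: sumr_ge0 => i _; rewrite mulr_ge0.
  case: (boolP (chord _ _ _ _ _ _)) => [|_]; last by rewrite addr_ge0.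
  case/orP => [/existsP[x /andP[xF ux]]|/existsP[w /and3P[wU uw ch]]].
    rewrite (bigD1 x)//= ux mulr1 -addrA lerDl addr_ge0//.
    by apply: sumr_ge0 => i _; rewrite mulr_ge0.
  have {}ch : chord (adj E) h (F :|: P) [set u] (U :\ w) w by exact: ch.
  rewrite addrC (bigD1 w)//= uw ch mulr1 -addrA lerDl addr_ge0//.
  by apply: sumr_ge0 => i _; rewrite mulr_ge0.
rewrite ExD !Ex_sum.
have s1 : \sum_(x in F) Ex p (pairsn n) (fun E => (adj E u x)%:R * 1) <= c * f%:R / n%:R.
  apply: (@le_trans _ _ (\sum_(x in F) c / n%:R)).
    apply: ler_sum => x xF; rewrite Ex_adj// ?Ex_cst ?mulr1//.
    by apply: contraNneq uF => ->.
  rewrite sumr_const -[leLHS]mulr_natl mulrCA mulrA ler_wpM2r ?invr_ge0//.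
  by rewrite ler_wpM2l// ler_nat.
have s2 : \sum_(w in U) Ex p (pairsn n) (fun E => (adj E u w)%:R *
    (chord (adj E) h (F :|: P) [set u] (U :\ w) w)%:R) <= c * chord_bound h f.+1 / n%:R.
  apply: (@le_trans _ _ (\sum_(w in U) c / n%:R * (chord_bound h f.+1 / n%:R))).
    apply: ler_sum => w wU; have uw : u != w by apply: contraNneq uU => ->.
    have wFP : w \notin F :|: P.
      by apply/negP => wFP; move: FU; rewrite disjoints_subset => /subsetP/(_ _ wFP); rewrite inE wU.
    rewrite Ex_adj//; last first.
      move=> E; congr (nat_of_bool _)%:R; apply: chord_congr => [x y xU|y yF]; apply: adj_toggle2.
        move: xU; rewrite !inE => /andP[xw xU]; apply/eqP => /ed_inj2[[xu _]|[xw' _]].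
          by rewrite -xu xU in uU.
        by rewrite xw' eqxx in xw.
      apply/eqP => /ed_inj2[[wu _]|[_ yu]]; first by rewrite wu eqxx in uw.
      by move: yF; rewrite yu !inE (negbTE uF) (negbTE uP) (negbTE uU) andbF.
    have /andP[q0 q1] := p01 (ed u w).
    apply: ler_pM => //; first by apply: Ex_ge0.
    apply: IH; rewrite ?cards1 ?inE ?eqxx//.
    - by apply: leq_trans (leq_card_setU F P) _; rewrite -addn1 leq_add.
    - by rewrite -in_setU.
    - by rewrite eq_sym.
    - rewrite disjoints_subset subUset sub1set !inE (negbTE uU) andbF/= andbT.
      move: FU; rewrite disjoints_subset => /subset_trans; apply.
      by rewrite setCS subD1set.
  apply: le_trans (sum_le_n _ _) _; first by rewrite mulr_ge0// divr_ge0// chord_bound_ge0.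
  by rewrite le_eqVlt; apply/orP; left; apply/eqP; field; rewrite lt0r_neq0.
by apply: le_trans (lerD s1 s2) _; rewrite -mulrDl.
Qed.

End ChordProb.

Section CoreLoc.
Variables (n k H : nat) (E' E : {set 'I_n * 'I_n}) (v : 'I_n).
Hypothesis EE : E' \subset E.
Hypothesis EP : E \subset pairsn n.
Hypothesis vV : forall j, (0 < j)%N -> (j <= H)%N -> v \notin Vset j E' E.

(** Paths are kept oriented towards [v]; as [v] is an endpoint of no missing path of length at most
    [H], all their edges lie in [E']. *)
Lemma path_subgraph u s : path (adj E) u s -> uniq (u :: s) -> last u s = v ->
  (size s <= H)%N -> path (adj E') u s.
Proof.
case: s => // w s pE un lv sH; apply/negPn/negP => np.
have sz : size (u :: w :: s) == (size s).+2 by [].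
have /negP := vV (ltn0Sn (size s)) sH; apply; rewrite inE; apply/existsP.
exists (Tuple sz).
have isP (X : {set 'I_n * 'I_n}) : is_path X (Tuple sz) = path (adj X) u (w :: s).
  rewrite /is_path un andTb; apply/forallP/idP => [h|/(pathP u) h i].
    apply/(pathP u) => i il; have := h (Ordinal il).
    have il' : (i < (size s).+2)%N by rewrite ltnS ltnW.
    have il'' : (i.+1 < (size s).+2)%N by rewrite ltnS.
    by rewrite !(tnth_nth u) /= (inordK il') (inordK il'').
  have il := ltn_ord i.
  have il' : (i < (size s).+2)%N by rewrite ltnS ltnW.
  have il'' : (i.+1 < (size s).+2)%N by rewrite ltnS.
  by rewrite !(tnth_nth u) /= (inordK il') (inordK il''); exact: (h i il).
rewrite !isP pE np/=; apply/orP; right.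
by rewrite (tnth_nth u)/= -lv eq_sym (last_nth u).
Qed.

Lemma core_nbrs u : u \in kcore k E -> (k <= #|[set w in kcore k E | adj E u w]|)%N.
Proof.
move=> /bigcupP[U /forallP Uk uU]; have := Uk u; rewrite uU/= => le.
apply: leq_trans le _; apply: subset_leq_card; apply/subsetP => w; rewrite !inE => /andP[wU ->].
rewrite andbT; apply/bigcupP; exists U => //; exact/forallP.
Qed.

(** [s] lists the way back from [u] to [v]. A core vertex has [k] core neighbours; those other than
    the predecessor are new, since the subgraph has no chord here, and the edges to them lie in [E']
    by [path_subgraph], so the tree grows inside the subgraph. *)
Lemma core_loc h u s : path (adj E) u s -> uniq (u :: s) -> last u s = v ->
  (size s + h <= H)%N -> u \in kcore k E ->
  ~~ chord (adj E') h [set x in behead s] [set x | ohead s == Some x]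
       [set x | x \notin u :: s] u ->
  (loc (adj E') k (nseq h false) (if s is [::] then k else k.-1)
     [set x | x \notin u :: s] u).1.
Proof.
elim: h u s => [//|h IH] u s pE un lv sH uc nch /=.
move: nch; rewrite /= negb_or => /andP[/existsPn nF /existsPn nU].
have key w : w \in kcore k E -> adj E u w -> Some w != ohead s ->
    [/\ w \notin u :: s, adj E' u w &
      (loc (adj E') k (nseq h false) k.-1 ([set x | x \notin u :: s] :\ w) w).1].
  move=> wc uw ws.
  have wu : w != u by apply: contraTneq uw => ->; exact: adj_irr.
  (* If [w] were an earlier vertex, the path from [u] through [w] on to [v] would place the edge
     from [u] to [w] in [E'], where it would be a chord. *)
  have ws' : w \notin s.
    apply/negP => wS; case: s pE un lv sH {nU} nF ws wS => // x s pE un lv sH nF ws wS.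
    have {}wS : w \in s by move: wS ws; rewrite inE => /orP[/eqP -> /=|//]; rewrite eqxx.
    have /negP := nF w; apply; rewrite inE /= wS/=.
    case/splitPr: wS pE un lv sH => s1 s2 pE un lv sH.
    have : path (adj E') u (w :: s2).
      apply: path_subgraph.
      - by move: pE; rewrite /= cat_path /= uw => /and3P[_ _ /andP[]].
      - move: un; rewrite /= !inE mem_cat !inE cat_uniq /= => /andP[].
        rewrite !negb_or => /and4P[_ _ -> ->] /andP[_ /and3P[_ _ /andP[-> ->]]].
        by [].
      - by rewrite -lv /= last_cat.
      - by move: sH; rewrite /= size_cat /=; clear; lia.
    by rewrite /= => /andP[].
  have wus : w \notin u :: s by rewrite inE negb_or wu.
  have wuns : uniq (w :: u :: s) by rewrite cons_uniq wus.
  have pw : path (adj E) w (u :: s) by rewrite /= adj_sym uw.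
  have uw' : adj E' u w.
    have : path (adj E') w (u :: s).
      by apply: path_subgraph => //; move: sH; rewrite /=; clear; lia.
    by rewrite /= adj_sym => /andP[].
  split => //.
  have Uw : [set x | x \notin u :: s] :\ w = [set x | x \notin w :: u :: s].
    by apply/setP => x; rewrite !inE !negb_or.
  rewrite Uw; apply: (IH w (u :: s)) => //; first by move: sH; rewrite /=; clear; lia.
  have /= := nU w; rewrite inE wus /= uw' /= Uw.
  rewrite (_ : [set x in behead s] :|: [set x | ohead s == Some x] = [set x in s]); last first.
    case: (s) => [|y s'] /=; apply/setP => x; rewrite !inE//.
    by rewrite orbC; congr (_ || _); apply/eqP/eqP => [[->]|->].
  rewrite (_ : [set x | Some u == Some x] = [set u]); last first.
    by apply/setP => x; rewrite !inE; apply/eqP/eqP => [[->]|->].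
  by [].
have sub : [set w in kcore k E | adj E u w] :\: [set x | ohead s == Some x] \subset
   [set w in [set w in [set x | x \notin u :: s] | adj E' u w] |
      (loc (adj E') k (nseq h false) k.-1 ([set x | x \notin u :: s] :\ w) w).1].
  apply/subsetP => w; rewrite !in_setD !inE => /andP[ws /andP[wc uw]].
  have [|w1 w2 w3] := key w wc uw; first by rewrite eq_sym.
  by move: w1; rewrite inE => ->; rewrite w2 w3.
apply: leq_trans (subset_leq_card sub); rewrite cardsD.
have kn := core_nbrs uc.
case: (s) => [|y s'] /=.
  rewrite (_ : _ :&: _ = set0) ?cards0 ?subn0//.
  by apply/setP => x; rewrite !inE andbF.
rewrite -subn1; apply: leq_sub kn _.
rewrite -(cards1 y); apply: subset_leq_card; apply/subsetP => x.
by rewrite !inE => /andP[_ /eqP[->]].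
Qed.

End CoreLoc.

Lemma ck_le n k H (E' E : {set 'I_n * 'I_n}) : E' \subset E -> E \subset pairsn n ->
  (ck k E <= \sum_(j < H) #|Vset j.+1 E' E| +
     #|[set v | chord (adj E') H set0 set0 (setT :\ v) v]| +
     #|[set v | (loc (adj E') k (nseq H false) k (setT :\ v) v).1]|)%N.
Proof.
move=> EE EP.
have h1 : (#|\bigcup_(j < H) Vset j.+1 E' E| <= \sum_(j < H) #|Vset j.+1 E' E|)%N.
  elim/big_rec2: _ => [|j m s _ le]; first by rewrite cards0.
  by rewrite cardsU; apply: leq_trans (leq_subr _ _) _; rewrite leq_add2l.
apply: (@leq_trans #|\bigcup_(j < H) Vset j.+1 E' E :|:
     [set v | chord (adj E') H set0 set0 (setT :\ v) v] :|:
     [set v | (loc (adj E') k (nseq H false) k (setT :\ v) v).1]|); last first.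
  apply: leq_trans (leq_card_setU _ _) _; rewrite leq_add2r.
  by apply: leq_trans (leq_card_setU _ _) _; rewrite leq_add2r.
apply: subset_leq_card; apply/subsetP => v vc; rewrite !in_setU.
case: (boolP (v \in \bigcup_(j < H) Vset j.+1 E' E)) => //= nV.
rewrite !in_set; case: (boolP (chord _ _ _ _ _ _)) => //= nch.
have vV j : (0 < j)%N -> (j <= H)%N -> v \notin Vset j E' E.
  case: j => // j _ jH; apply: contra nV => vj; apply/bigcupP; by exists (Ordinal jH).
have U0 : [set x | x \notin [:: v]] = setT :\ v by apply/setP => x; rewrite !inE andbT.
have C0 : chord (adj E') H [set x in behead (@nil 'I_n)] [set x | ohead (@nil 'I_n) == Some x]
    [set x | x \notin [:: v]] v = chord (adj E') H set0 set0 (setT :\ v) v.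
  by rewrite U0; congr chord; apply/setP => x; rewrite !inE.
have := @core_loc n k H E' E v EP vV H v [::] isT isT erefl (leqnn _) vc.
by rewrite C0 U0; apply.
Qed.

Section Upper.
Variables (R : realType) (r : nat) (kap : 'I_r -> 'I_r -> R) (mu : 'I_r -> R) (c : R) (k : nat).
Hypothesis kap_ge0 : forall i j, 0 <= kap i j.
Hypothesis kap_le : forall i j, kap i j <= c.
Hypothesis kapC : forall i j, kap i j = kap j i.
Hypothesis mu_ge0 : forall i, 0 <= mu i.
Hypothesis c0 : 0 <= c.

(** Without resets the first component never consults robustness, so it follows the plain survival
    recursion. *)
Lemma lim_loc_qseq l m i :
  (lim_loc kap mu k (nseq l.+1 false) m i).1 = psi m (Kop kap mu (qseq kap mu k l) i).
Proof.
have E : (fun j => (lim_loc kap mu k (nseq l false) k.-1 j).1) = qseq kap mu k l.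
  elim: l => [//|l IH]; apply/boolp.funext => j.
  rewrite -[RHS]/(psi k.-1 (Kop kap mu (qseq kap mu k l) j)) -IH.
  by [].
by rewrite -E.
Qed.

Theorem finitary_core_upper (l : nat) (eps : R) : 0 < eps ->
  exists (delta : R) (N : nat), 0 < delta /\
  forall n (tau : 'I_n -> 'I_r), (N <= n)%N -> types_close mu tau delta ->
    Ex (tprob kap tau) (pairsn n) (fun E =>
     (#|[set v | chord (adj E) l.+1 set0 set0 (setT :\ v) v]| +
      #|[set v | (loc (adj E) k (nseq l.+1 false) k (setT :\ v) v).1]|)%:R / n%:R) <=
    \sum_i mu i * psi k (Kop kap mu (qseq kap mu k l) i) + eps.
Proof.
move=> e0.
have r10 : 0 < r%:R + 1 :> R by rewrite ltr_wpDl.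
pose e' := eps / 2 / (r%:R + 1).
have e'0 : 0 < e' by rewrite !divr_gt0.
have [dl [N1 [dl0 hLLN]]] :=
  @LLN R r kap mu c k kap_ge0 kap_le kapC mu_ge0 c0 (nseq l.+1 false) k e' 0 e'0.
pose cb := chord_bound c l.+1 0.
have cb0 : 0 <= cb := chord_bound_ge0 c0 l.+1 0.
have [N2 hN2] := @inv_nat_small R (eps / 2 / (cb + 1)) ltac:(by rewrite !divr_gt0// ltr_wpDl).
exists dl, (maxn N1 N2); split => // n tau; rewrite geq_max => /andP[n1 n2] cl.
have [n0 nE] := hN2 n n2.
have nn0 : 0 < n%:R :> R by rewrite ltr0n.
have p01 := tprob01 kap_ge0 tau.
have pc := @tprob_le R r kap c kap_le n tau.
pose av j E := avg R k tau false (nseq l.+1 false) k j setT E.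
rewrite (@eq_Ex _ _ _ _ _ (fun E => n%:R^-1 *
   (\sum_v (chord (adj E) l.+1 set0 set0 (setT :\ v) v)%:R) + \sum_j av j E)); last first.
  move=> E _; rewrite natrD mulrDl mulrC; congr (_ * _ + _).
    rewrite -sum1_card natr_sum big_mkcond; apply: eq_bigr => v _.
    by rewrite inE; case: chord.
  rewrite mulrC /av /avg -mulr_sumr; congr (_ * _).
  rewrite -sum1_card natr_sum big_mkcond (partition_big tau xpredT)//=.
  apply: eq_bigr => j _; rewrite big_mkcond [RHS]big_mkcond; apply: eq_bigr => v _.
  rewrite [in RHS]inE /= [in LHS]inE; case: (tau v == j) => //.
  by case: (_ <= _)%N.
rewrite ExD ExZ Ex_sum Ex_sum.
have h1 : n%:R^-1 * (\sum_v Ex (tprob kap tau) (pairsn n)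
    (fun E => (chord (adj E) l.+1 set0 set0 (setT :\ v) v)%:R)) <= eps / 2.
  apply: (@le_trans _ _ (n%:R^-1 * (\sum_(v : 'I_n) cb / n%:R))).
    rewrite ler_wpM2l ?invr_ge0//; apply: ler_sum => v _.
    apply: chord_prob => //; rewrite ?cards0 ?inE ?eqxx//.
    by rewrite setU0 -setI_eq0 set0I.
  rewrite sumr_const card_ord -[(cb / _) *+ n]mulr_natl mulKf ?lt0r_neq0//.
  have : (cb + 1) * n%:R^-1 <= eps / 2 by rewrite mulrC -ler_pdivlMr// ltr_wpDl.
  have : 0 <= n%:R^-1 :> R by rewrite invr_ge0.
  lra.
have h2 : \sum_j Ex (tprob kap tau) (pairsn n) (av j) <=
   \sum_i mu i * psi k (Kop kap mu (qseq kap mu k l) i) + eps / 2.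
  apply: (@le_trans _ _ (\sum_(j < r) (mu j * psi k (Kop kap mu (qseq kap mu k l) j) + e'))).
    apply: ler_sum => j _; rewrite -lerBlDl -lim_loc_qseq.
    rewrite -[X in _ - X](Ex_cst (tprob kap tau) (pairsn n)) -ExB.
    apply: le_trans (hLLN n tau n1 cl setT j false _); last by rewrite setCT cards0.
    by apply: ler_Ex => // E _; exact: ler_norm.
  rewrite big_split/= sumr_const card_ord -[e' *+ r]mulr_natl lerD2l /e' mulrCA.
  rewrite ler_piMr ?divr_ge0 ?(ltW e0)// ler_pdivrMr// mul1r lerDl//.
by apply: le_trans (lerD h1 h2) _; rewrite addrCA -splitr.
Qed.

End Upper.

(** Summing over the coupling lets [ck_le] act on each pair of graphs. A proportion of missing-path
    endpoints below [e] is charged as [e], any other as 1. *)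
Lemma coupling_core_le (R : realFieldType) n k H
  (q : {set 'I_n * 'I_n} -> {set 'I_n * 'I_n} -> R) (g g' X : {set 'I_n * 'I_n} -> R) (e : R) :
  (0 < n)%N -> 0 <= e -> (forall E' E, 0 <= q E' E) ->
  (forall E' E : {set 'I_n * 'I_n}, q E' E != 0 -> [/\ E' \subset E & E \subset pairsn n]) ->
  (forall E' : {set 'I_n * 'I_n}, E' \subset pairsn n -> \sum_(E in powerset (pairsn n)) q E' E = g' E') ->
  (forall E : {set 'I_n * 'I_n}, E \subset pairsn n -> \sum_(E' in powerset (pairsn n)) q E' E = g E) ->
  \sum_(E' in powerset (pairsn n)) g' E' = 1 ->
  (forall E' : {set 'I_n * 'I_n}, E' \subset pairsn n ->
     (#|[set v | chord (adj E') H set0 set0 (setT :\ v) v]| +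
      #|[set v | (loc (adj E') k (nseq H false) k (setT :\ v) v).1]|)%:R / n%:R <= X E') ->
  \sum_(E in powerset (pairsn n)) g E * ((ck k E)%:R / n%:R) <=
  H%:R * e + (\sum_(j < H) \sum_(E' in powerset (pairsn n)) \sum_(E in powerset (pairsn n))
      q E' E * (if e * n%:R <= #|Vset j.+1 E' E|%:R then 1 else 0)) +
  \sum_(E' in powerset (pairsn n)) g' E' * X E'.
Proof.
move=> n0 e0 q0 qs qg' qg g1 XP; have nn0 : 0 < n%:R :> R by rewrite ltr0n.
set W := powerset _.
pose Y (j : nat) (E' E : {set 'I_n * 'I_n}) : R := if e * n%:R <= #|Vset j.+1 E' E|%:R then 1 else 0.
have Y0 j E' E : 0 <= Y j E' E by rewrite /Y; case: ifP.
have VY j E' E : #|Vset j.+1 E' E|%:R / n%:R <= e + Y j E' E.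
  rewrite ler_pdivrMr// /Y; case: ifPn => [_|]; last by rewrite -ltNge addr0 => /ltW.
  apply: (@le_trans _ _ (#|'I_n|%:R)); first by rewrite ler_nat max_card.
  by rewrite card_ord ler_peMl// lerDr.
have le E' E : E' \in W -> E \in W ->
    q E' E * ((ck k E)%:R / n%:R) <= q E' E * (H%:R * e + \sum_(j < H) Y j E' E + X E').
  move=> E'W EW; have [->|qn0] := eqVneq (q E' E) 0; first by rewrite !mul0r.
  have [EE EP] := qs _ _ qn0.
  rewrite ler_wpM2l//; apply: le_trans (lerD (_ : _ <= _) (XP E' _)); last first.
  - by rewrite -powersetE.
  - apply: (@le_trans _ _ (\sum_(j < H) (#|Vset j.+1 E' E|%:R / n%:R))); last first.
      have -> : H%:R * e = \sum_(j < H) e by rewrite sumr_const card_ord mulr_natl.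
      rewrite -big_split.
      by apply: ler_sum => j _; exact: VY.
    exact: lexx.
  - rewrite -mulr_suml -natr_sum -mulrDl -natrD ler_wpM2r ?invr_ge0// ler_nat addnA.
    exact: ck_le.
apply: (@le_trans _ _ (\sum_(E in W) \sum_(E' in W) q E' E * ((ck k E)%:R / n%:R))).
  apply: ler_sum => E EW; rewrite -mulr_suml qg//; by rewrite -powersetE.
rewrite exchange_big /=.
apply: (@le_trans _ _ (\sum_(E' in W) \sum_(E in W)
    q E' E * (H%:R * e + \sum_(j < H) Y j E' E + X E'))).
  by apply: ler_sum => E' E'W; apply: ler_sum => E EW; exact: le.
rewrite le_eqVlt; apply/orP; left; apply/eqP.
transitivity (\sum_(E' in W) (g' E' * (H%:R * e) + \sum_(j < H) \sum_(E in W) q E' E * Y j E' E +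
   g' E' * X E')).
  apply: eq_bigr => E' E'W; rewrite exchange_big -qg'; last by rewrite -powersetE.
  rewrite !mulr_suml -!big_split; apply: eq_bigr => E EW /=.
  by rewrite !mulrDr mulr_sumr.
by rewrite !big_split /= -mulr_suml g1 mul1r [X in _ + X + _]exchange_big.
Qed.

Lemma ck_mono k n (E F : {set 'I_n * 'I_n}) : E \subset F -> (ck k E <= ck k F)%N.
Proof.
move=> EF; apply: subset_leq_card; apply/bigcupsP => U hU; apply: bigcup_sup.
apply/forallP => v; apply/implyP => vU; apply: leq_trans (implyP (forallP hU v) vU) _.
apply: subset_leq_card; apply/subsetP => w; rewrite !inE => /andP[-> /=].
by rewrite /adj => /orP[] /(subsetP EF) ->; rewrite ?orbT.
Qed.

(** * The Galton-Watson process *)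

From mathcomp Require Import all_classical all_reals all_analysis.
From mathcomp Require Import measurable_realfun.
Import Order.TTheory GRing.Theory Num.Theory.
Import numFieldNormedType.Exports.
Local Open Scope classical_set_scope.
Local Open Scope ring_scope.
Local Open Scope ereal_scope.
Local Notation tree := Defs.shape.

Section ShapeSums.
Variable R : realType.
Implicit Types (f : tree -> \bar R).

(** Sums over shapes are iterated level by level and child by child, mirroring the recursion of the
    density, so that Tonelli and the binomial formula apply one coordinate at a time. *)
Fixpoint sum_seqs (S1 : (tree -> \bar R) -> \bar R) (c : nat) (g : seq tree -> \bar R) : \bar R :=
  if c is c'.+1 then S1 (fun t => sum_seqs S1 c' (fun ts => g (t :: ts))) else g [::].

(* sum of a non-negative function over the shapes all of whose branches have length exactly [l],
   as an iterated series *)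
Fixpoint sum_shapes (l : nat) (f : tree -> \bar R) : \bar R :=
  if l is l'.+1 then \sum_(0 <= c <oo) sum_seqs (sum_shapes l') c (fun ts => f (Node ts))
  else f Unexp.

Section OneLevel.
Variable S1 : (tree -> \bar R) -> \bar R.
Hypothesis S1_ge0 : forall f, (forall t, 0 <= f t) -> 0 <= S1 f.
Hypothesis S1D : forall f g, (forall t, 0 <= f t) -> (forall t, 0 <= g t) ->
  S1 (fun t => f t + g t) = S1 f + S1 g.
Hypothesis S1Z : forall (a : R) f, (0 <= a)%R -> (forall t, 0 <= f t) ->
  S1 (fun t => a%:E * f t) = a%:E * S1 f.

Lemma sum_seqs_ge0 c g : (forall ts, 0 <= g ts) -> 0 <= sum_seqs S1 c g.
Proof. by elim: c g => [|c IH] g g0 /=; [exact: g0|apply: S1_ge0 => t; exact: IH]. Qed.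

Lemma sum_seqsD c g h : (forall ts, 0 <= g ts) -> (forall ts, 0 <= h ts) ->
  sum_seqs S1 c (fun ts => g ts + h ts) = sum_seqs S1 c g + sum_seqs S1 c h.
Proof.
elim: c g h => [//|c IH] g h g0 h0 /=; rewrite -S1D.
- by congr S1; apply/funext => t; exact: IH.
- by move=> t; apply: sum_seqs_ge0.
- by move=> t; apply: sum_seqs_ge0.
Qed.

Lemma sum_seqsZ c (a : R) g : (0 <= a)%R -> (forall ts, 0 <= g ts) ->
  sum_seqs S1 c (fun ts => a%:E * g ts) = a%:E * sum_seqs S1 c g.
Proof.
move=> a0; elim: c g => [//|c IH] g g0 /=; rewrite -S1Z//.
  by congr S1; apply/funext => t; exact: IH.
by move=> t; apply: sum_seqs_ge0.
Qed.

End OneLevel.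

Lemma sum_shapes_ge0 l f : (forall t, 0 <= f t) -> 0 <= sum_shapes l f.
Proof.
elim: l f => [|l IH] f f0 /=; first exact: f0.
by apply: nneseries_ge0 => c _ _; apply: sum_seqs_ge0.
Qed.

Lemma sum_shapesD l f g : (forall t, 0 <= f t) -> (forall t, 0 <= g t) ->
  sum_shapes l (fun t => f t + g t) = sum_shapes l f + sum_shapes l g.
Proof.
elim: l f g => [//|l IH] f g f0 g0 /=; rewrite -nneseriesD.
- by apply: eq_eseriesr => c _; rewrite sum_seqsD//; exact: sum_shapes_ge0.
- by move=> c _ _; apply: sum_seqs_ge0 => //; exact: sum_shapes_ge0.
- by move=> c _ _; apply: sum_seqs_ge0 => //; exact: sum_shapes_ge0.
Qed.

Lemma sum_shapesZ l (a : R) f : (0 <= a)%R -> (forall t, 0 <= f t) ->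
  sum_shapes l (fun t => a%:E * f t) = a%:E * sum_shapes l f.
Proof.
elim: l a f => [//|l IH] a f a0 f0 /=; rewrite -nneseriesZl.
- apply: eq_eseriesr => c _; by rewrite sum_seqsZ//; exact: sum_shapes_ge0.
- by move=> c _; apply: sum_seqs_ge0 => //; exact: sum_shapes_ge0.
Qed.

Lemma sum_shapes0 l : sum_shapes l (fun=> 0) = 0.
Proof.
have e := @sum_shapesZ l 0%R (fun=> 0) (lexx _) (fun=> lexx _).
rewrite -[RHS](mul0e (sum_shapes l (fun=> 0))) -e; congr sum_shapes.
by apply/funext => t; rewrite mul0e.
Qed.

Fixpoint full (l : nat) (t : tree) : bool :=
  match l, t with
  | 0, Unexp => true
  | l'.+1, Node ts => all (full l') ts
  | _, _ => false
  end.

Lemma eq_sum_seqs S1 (P : pred tree) c g h :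
  (forall f f', (forall t, P t -> f t = f' t) -> S1 f = S1 f') ->
  (forall ts, size ts = c -> all P ts -> g ts = h ts) -> sum_seqs S1 c g = sum_seqs S1 c h.
Proof.
move=> S1P; elim: c g h => [|c IH] g h gh /=; first exact: gh.
by apply: S1P => t Pt; apply: IH => ts sz Pts; apply: gh => /=; rewrite ?sz// Pt.
Qed.

Lemma eq_sum_shapes l f g : (forall t, full l t -> f t = g t) -> sum_shapes l f = sum_shapes l g.
Proof.
elim: l f g => [|l IH] f g fg /=; first exact: fg.
apply: eq_eseriesr => c _; apply: (@eq_sum_seqs _ (full l)) => //.
by move=> ts _ fts; exact: fg.
Qed.

Section Integral.
Variables (d : measure_display) (X : measurableType d) (mu : {measure set X -> \bar R}).

Lemma sum_seqs_integral (S1 : (tree -> \bar R) -> \bar R) c (g : seq tree -> X -> \bar R) :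
  (forall f : tree -> X -> \bar R, (forall t, measurable_fun setT (f t)) ->
     (forall t x, 0 <= f t x) ->
     measurable_fun setT (fun x => S1 (f^~ x)) /\
     \int[mu]_x S1 (f^~ x) = S1 (fun t => \int[mu]_x f t x)) ->
  (forall f, (forall t, 0 <= f t) -> 0 <= S1 f) ->
  (forall ts, measurable_fun setT (g ts)) -> (forall ts x, 0 <= g ts x) ->
  measurable_fun setT (fun x => sum_seqs S1 c (g^~ x)) /\
  \int[mu]_x sum_seqs S1 c (g^~ x) = sum_seqs S1 c (fun ts => \int[mu]_x g ts x).
Proof.
move=> S1i S1p; elim: c g => [|c IH] g mg g0 /=; first by split => //; exact: mg.
have h t := IH (fun ts => g (t :: ts)) (fun ts => mg (t :: ts)) (fun ts => g0 (t :: ts)).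
have [|t x|h1 h2] := S1i (fun t x => sum_seqs S1 c (fun ts => g (t :: ts) x)).
- by move=> t; exact: (h t).1.
- by apply: sum_seqs_ge0.
split => //; rewrite h2; congr S1; apply/funext => t; exact: (h t).2.
Qed.

Lemma sum_shapes_integral l (f : tree -> X -> \bar R) :
  (forall t, measurable_fun setT (f t)) -> (forall t x, 0 <= f t x) ->
  measurable_fun setT (fun x => sum_shapes l (f^~ x)) /\
  \int[mu]_x sum_shapes l (f^~ x) = sum_shapes l (fun t => \int[mu]_x f t x).
Proof.
elim: l f => [|l IH] f mf f0 /=; first by split => //; exact: mf.
have h c := @sum_seqs_integral (sum_shapes l) c (fun ts => f (Node ts)) IH
  (@sum_shapes_ge0 l) (fun ts => mf (Node ts)) (fun ts => f0 (Node ts)).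
split.
  apply: (ge0_emeasurable_sum (h := fun c x => sum_seqs (sum_shapes l) c (fun ts => f (Node ts) x))
    (P := xpredT)) => [c x _ _|c _].
    by apply: sum_seqs_ge0 => //; exact: sum_shapes_ge0.
  exact: (h c).1.
rewrite (integral_nneseries mu measurableT
  (f := fun c x => sum_seqs (sum_shapes l) c (fun ts => f (Node ts) x))).
- by apply: eq_eseriesr => c _; exact: (h c).2.
- by move=> c; exact: (h c).1.
- by move=> c x _; apply: sum_seqs_ge0 => //; exact: sum_shapes_ge0.
Qed.

End Integral.

Lemma exp_eseries (x : R) : (0 <= x)%R -> \sum_(0 <= c <oo) (x ^+ c / c`!%:R)%:E = (expR x)%:E.
Proof.
move=> x0; apply: cvg_lim => //.
have -> : (fun n => \sum_(0 <= i < n) (x ^+ i / i`!%:R)%:E) = EFin \o series (exp_coeff x).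
  by apply/funext => n /=; rewrite /series/= sumEFin.
apply: cvg_EFin; first exact: nearW.
rewrite (_ : fine \o _ = series (exp_coeff x)); last by apply/funext.
exact: is_cvg_series_exp_coeff.
Qed.

(** Poisson thinning: with Poisson offspring of mean [g + h], the good children have Poisson law of
    mean [g]. *)
Lemma pois_eseries (g h : R) j : (0 <= g)%R -> (0 <= h)%R ->
  \sum_(0 <= c <oo) ((expR (- (g + h)) / c`!%:R)%:E *
     ('C(c, j)%:R * g ^+ j * h ^+ (c - j))%R%:E) = (pois j g)%:E.
Proof.
move=> g0 h0.
rewrite (@nneseries_split _ _ 0 j) => [|c _]; last first.
  by rewrite -EFinM lee_fin mulr_ge0 ?divr_ge0 ?expR_ge0 ?mulr_ge0 ?exprn_ge0.
rewrite add0n big_nat big1 ?add0e => [|c /andP[_ cj]]; last first.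
  by rewrite bin_small// !mul0r mule0.
rewrite -(@nneseries_addn _ _ j) => [|c]; last first.
  by rewrite -EFinM lee_fin mulr_ge0 ?divr_ge0 ?expR_ge0 ?mulr_ge0 ?exprn_ge0.
rewrite (eq_eseriesr (g := fun c => (expR (- (g + h)) * (g ^+ j / j`!%:R))%:E *
   (h ^+ c / c`!%:R)%:E)); last first.
  move=> c _; rewrite -!EFinM addnK; congr EFin.
  have := bin_fact (leq_addl c j); rewrite addnK => /(congr1 (fun x => x%:R : R)%R).
  rewrite !natrM => E.
  have n0 m : (m`!%:R != 0 :> R)%R by rewrite pnatr_eq0 -lt0n fact_gt0.
  rewrite -E; field; rewrite !n0/=; apply/eqP => C0.
  by have := n0 (c + j)%N; rewrite -E C0 mul0r eqxx.
rewrite nneseriesZl => [|c _]; last by rewrite lee_fin divr_ge0 ?exprn_ge0.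
rewrite exp_eseries// -EFinM /pois; congr EFin.
transitivity (expR (- g) * (g ^+ j / j`!%:R) * (expR h * expR (- h)))%R.
  by rewrite opprD expRD; ring.
by rewrite expRxMexpNx_1 mulr1.
Qed.

End ShapeSums.

(** [shape] is nested through lists, and the proofs need an induction hypothesis for each member of
    the list of sub-shapes. *)
Fixpoint tree_ind_all (P : tree -> Prop) (P0 : P Unexp)
  (PN : forall ts, (forall t, List.In t ts -> P t) -> P (Node ts)) (t : tree) : P t :=
  match t with
  | Unexp => P0
  | Node ts => PN ts
     ((fix all_in (s : seq tree) : forall t, List.In t s -> P t :=
        match s with
        | [::] => fun t h => match h with end
        | t' :: s' => fun t h => match h with
            | or_introl e => eq_ind t' P (tree_ind_all P0 PN t') t e
            | or_intror h' => all_in s' t h'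
            end
        end) ts)
  end.

Lemma measurable_expeRN (R : realType) d (X : measurableType d) (f : X -> \bar R) :
  measurable_fun setT f -> (forall x, 0 <= f x) -> measurable_fun setT (fun x => expeR (- f x)).
Proof.
move=> mf f0.
pose A := [set x | f x < +oo].
have -> : (fun x => expeR (- f x)) = (fun x => (\1_A x * expR (- fine (f x)))%R%:E).
  apply/funext => x; have := f0 x; rewrite indicE.
  case E : (f x) => [r| |]//= _.
    by rewrite mem_set ?mul1r// /A/= E ltry.
  by rewrite memNset ?mul0r// /A/= E ltxx.
apply/measurable_EFinP; apply: measurable_funM.
  apply: measurable_indic; rewrite -[X in measurable X]setTI; exact: emeasurable_fun_infty_o.
apply: measurableT_comp; first exact: measurable_expR.
apply: measurableT_comp => //; apply: measurableT_comp => //; exact: fine_measurable.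
Qed.

(** * From the process densities to the survival recursion *)

Section Density.
Variables (R : realType) (S : pseudoPMetricType R) (mu : probability (SB S) R).
Variables (kap : S -> S -> R) (k : nat).
Hypothesis Hkap : is_kernel kap.

Let kap_ge0 a b : (0 <= kap a b)%R. Proof. by have [_ []] := Hkap. Qed.

Let kap_meas : measurable_fun setT (fun z : (SB S * SB S)%type => kap z.1 z.2).
Proof. by have [_ []] := Hkap. Qed.

Lemma kap_meas2 (a : S) : measurable_fun setT (kap a : SB S -> R).
Proof.
have h : measurable_fun setT (fun y : SB S => ((a : SB S), y)) by exact: pair1_measurable.
exact: (measurableT_comp kap_meas h).
Qed.

Definition Kint (f : SB S -> \bar R) (a : SB S) : \bar R := \int[mu]_y ((kap a y)%:E * f y).

Lemma Kint_meas f : measurable_fun setT f -> (forall y, 0 <= f y) -> measurable_fun setT (Kint f).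
Proof.
move=> mf f0.
apply: (measurable_fun_fubini_tonelli_F (fun z : (SB S * SB S)%type => (kap z.1 z.2)%:E * f z.2)).
  apply: emeasurable_funM; first exact/measurable_EFinP.
  exact: measurableT_comp mf measurable_snd.
by move=> z; rewrite mule_ge0// lee_fin.
Qed.

Lemma Kint_ge0 f a : (forall y, 0 <= f y) -> 0 <= Kint f a.
Proof. by move=> f0; apply: integral_ge0 => y _; rewrite mule_ge0// lee_fin. Qed.

Lemma Kf_meas f a : measurable_fun setT f -> measurable_fun setT (fun y : SB S => (kap a y)%:E * f y).
Proof. by move=> mf; apply: emeasurable_funM => //; apply/measurable_EFinP; exact: kap_meas2. Qed.

Lemma lamE : lam mu kap = Kint (cst 1).
Proof. by apply/funext => a; apply: eq_integral => y _; rewrite mule1. Qed.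

Lemma lam_ge0 a : 0 <= lam mu kap a.
Proof. by rewrite lamE Kint_ge0// => y; rewrite lee01. Qed.

Lemma lam_meas : measurable_fun setT (lam mu kap : SB S -> \bar R).
Proof. by rewrite lamE; apply: Kint_meas => // y; rewrite lee01. Qed.

Fixpoint gdens (t : tree) (a : SB S) : \bar R :=
  match t with
  | Unexp => 1
  | Node ts => expeR (- lam mu kap a) * ((size ts)`!%:R^-1)%:E *
     (fix prodK (ts : seq tree) : \bar R :=
        if ts is t' :: ts' then (\int[mu]_y ((kap a y)%:E * gdens t' y)) * prodK ts' else 1) ts
  end.

Fixpoint prodK (ts : seq tree) (a : SB S) : \bar R :=
  if ts is t' :: ts' then Kint (gdens t') a * prodK ts' a else 1.

Lemma gdens_Node ts a :
  gdens (Node ts) a = expeR (- lam mu kap a) * ((size ts)`!%:R^-1)%:E * prodK ts a.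
Proof. by rewrite /=; congr (_ * _); elim: ts => // t ts IH /=; rewrite IH. Qed.

Lemma gw_density_setT t u a : gw_density mu kap (fun=> setT) t u a = gdens t a.
Proof.
elim/tree_ind_all: t u a => [//|ts IH] u a; rewrite gdens_Node /=; congr (_ * _).
elim: ts 0%N IH => // t ts IHs i IH /=; congr (_ * _).
  by apply: eq_integral => y _; rewrite IH//; left.
by apply: IHs => t' t's; apply: IH; right.
Qed.

Lemma gdens_ge0 t a : 0 <= gdens t a.
Proof.
elim/tree_ind_all: t a => [a|ts IH a]; first by rewrite lee01.
rewrite gdens_Node mule_ge0 ?mule_ge0 ?expeR_ge0 ?lee_fin ?invr_ge0//.
elim: ts IH => [_|t ts IHs IH] /=; first by rewrite lee01.
rewrite mule_ge0 ?Kint_ge0//; first by move=> y; apply: IH; left.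
by apply: IHs => t' t's; apply: IH; right.
Qed.

Lemma prodK_ge0 ts a : 0 <= prodK ts a.
Proof.
elim: ts => [|t ts IH] /=; first by rewrite lee01.
by rewrite mule_ge0// Kint_ge0// => y; exact: gdens_ge0.
Qed.

Lemma gdens_meas t : measurable_fun setT (gdens t).
Proof.
elim/tree_ind_all: t => [|ts IH]; first exact: measurable_cst.
have -> : gdens (Node ts) = (fun a => expeR (- lam mu kap a) * ((size ts)`!%:R^-1)%:E * prodK ts a).
  by apply/funext => a; exact: gdens_Node.
apply: emeasurable_funM.
  apply: emeasurable_funM => //; apply: measurable_expeRN; first exact: lam_meas.
  exact: lam_ge0.
elim: ts IH => [_|t ts IHs IH] /=; first exact: measurable_cst.
apply: emeasurable_funM; last by apply: IHs => t' t's; apply: IH; right.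
apply: Kint_meas; first by apply: IH; left.
by move=> y; exact: gdens_ge0.
Qed.

Lemma Kint_le f g a : measurable_fun setT f -> measurable_fun setT g ->
  (forall y, 0 <= f y) -> (forall y, f y <= g y) -> Kint f a <= Kint g a.
Proof.
move=> mf mg f0 fg; apply: ge0_le_integral => //.
- by move=> y _; rewrite mule_ge0// lee_fin.
- exact: Kf_meas.
- exact: Kf_meas.
- by move=> y _; rewrite lee_pmul// lee_fin.
Qed.

(** By induction the density of a node with [c] children is at most [pois c (lam a)], and it is 0
    where [lam] is infinite. This makes [Kint (gdens t) a] finite wherever [lam] is. *)
Lemma gdens_le1 t a : gdens t a <= 1.
Proof.
elim/tree_ind_all: t a => [//|ts IH] a; rewrite gdens_Node.
have [lfin|] := boolP (lam mu kap a \is a fin_num); last first.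
  rewrite ge0_fin_numE ?lam_ge0// -leNgt leye_eq => /eqP ->.
  by rewrite /= mul0e mul0e lee01.
set l := fine (lam mu kap a).
have lE : lam mu kap a = l%:E by rewrite /l fineK.
have l0 : (0 <= l)%R by rewrite -lee_fin -lE lam_ge0.
have : prodK ts a <= (l ^+ size ts)%:E.
  elim: ts IH => [//|t ts IHs IH] /=; rewrite exprS EFinM.
  apply: lee_pmul.
  - by apply: Kint_ge0 => y; exact: gdens_ge0.
  - exact: prodK_ge0.
  - rewrite -lE lamE; apply: Kint_le => //; first exact: gdens_meas.
      by move=> y; exact: gdens_ge0.
    by move=> y; apply: IH; left.
  - by apply: IHs => t' t's; apply: IH; right.
move=> h; rewrite lE /= -EFinM.
apply: (@le_trans _ _ ((expR (- l) / (size ts)`!%:R)%:E * (l ^+ size ts)%:E)).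
  by rewrite lee_pmul// ?lee_fin ?divr_ge0 ?expR_ge0// prodK_ge0.
rewrite -EFinM lee_fin; have := pois_le1 (size ts) l0; rewrite /pois; apply: le_trans.
by rewrite le_eqVlt; apply/orP; left; apply/eqP; ring.
Qed.

Fixpoint good_shape (l : nat) (t : tree) : bool :=
  if l is l'.+1 then (k.-1 <= (if t is Node ts then count (good_shape l') ts else 0))%N else true.

Definition good_count l (t : tree) : nat := if t is Node ts then count (good_shape l) ts else 0.

(** [fine] sends an infinite integral to 0; by [lam_fin_ae] this happens only on a null set. *)
Fixpoint qk (l : nat) : SB S -> R :=
  if l is l'.+1 then fun a => psi k.-1 (fine (Kint (fun y => (qk l' y)%:E) a)) else cst 1%R.

Lemma qk_ge0 l a : (0 <= qk l a)%R.
Proof.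
elim: l a => [|l IH] a; first exact: ler01.
by apply: psi_ge0; apply: fine_ge0; apply: Kint_ge0 => y; rewrite lee_fin.
Qed.

Lemma psi_fine_le1 m x : 0 <= x -> (psi m (fine x) <= 1 :> R)%R.
Proof. by move=> x0; apply: psi_le1; apply: fine_ge0. Qed.

Lemma qk_le1 l a : (qk l a <= 1)%R.
Proof.
case: l => [//|l]; apply: psi_fine_le1; apply: Kint_ge0 => y; rewrite lee_fin; exact: qk_ge0.
Qed.

Lemma psi_fine_meas m (f : SB S -> \bar R) : measurable_fun setT f ->
  measurable_fun setT (fun a => psi m (fine (f a))).
Proof.
move=> mf; apply: (measurableT_comp (f := psi m)).
  apply: continuous_measurable_fun => x; have [dx _] := is_derive_psi m x.
  by apply/differentiable_continuous/derivable1_diffP.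
apply: measurableT_comp => //; exact: fine_measurable.
Qed.

Lemma qk_meas l : measurable_fun setT (qk l).
Proof.
elim: l => [|l IH]; first exact: measurable_cst.
apply: psi_fine_meas; apply: Kint_meas; first exact/measurable_EFinP.
by move=> y; rewrite lee_fin qk_ge0.
Qed.

Hypothesis Hint : \int[(mu \x mu)%E]_z (kap z.1 z.2)%:E < +oo.

Lemma lam_fin_ae : {ae mu, forall a : SB S, lam mu kap a \is a fin_num}.
Proof.
have h : mu.-integrable setT (lam mu kap : SB S -> \bar R).
  apply/integrableP; split; first exact: lam_meas.
  rewrite (eq_integral (fun a : SB S => lam mu kap a)) => [|a _]; last by rewrite gee0_abs// lam_ge0.
  apply: le_lt_trans Hint; rewrite fubini_tonelli1//.
    exact/measurable_EFinP.
  by move=> z; rewrite lee_fin.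
have := integrable_ae measurableT h; apply: filterS => a; exact.
Qed.

Section OneStep.
Variables (l : nat) (a : SB S).
Hypothesis lfin : lam mu kap a \is a fin_num.
Hypothesis IHtot : {ae mu, forall y : SB S, sum_shapes l (gdens^~ y) = 1}.
Hypothesis IHgood : {ae mu, forall y : SB S,
  sum_shapes l (fun t => (good_shape l t)%:R%:E * gdens t y) = (qk l y)%:E}.

Let g := fine (Kint (fun y => (qk l y)%:E) a).
Let lm := fine (lam mu kap a).
Let h := (lm - g)%R.

Let qfin : Kint (fun y => (qk l y)%:E) a = g%:E.
Proof.
rewrite /g fineK// ge0_fin_numE; last by apply: Kint_ge0 => y; rewrite lee_fin qk_ge0.
have : lam mu kap a < +oo by rewrite -ge0_fin_numE// lam_ge0.
apply: le_lt_trans; rewrite lamE; apply: Kint_le => //.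
- by apply/measurable_EFinP; exact: qk_meas.
- by move=> y; rewrite lee_fin qk_ge0.
- by move=> y; rewrite lee_fin qk_le1.
Qed.

Let lmE : lam mu kap a = lm%:E. Proof. by rewrite /lm fineK. Qed.

Let g0 : (0 <= g)%R.
Proof. by apply: fine_ge0; apply: Kint_ge0 => y; rewrite lee_fin qk_ge0. Qed.

Let h0 : (0 <= h)%R.
Proof.
rewrite subr_ge0 -lee_fin -qfin -lmE lamE; apply: Kint_le => //.
- by apply/measurable_EFinP; exact: qk_meas.
- by move=> y; rewrite lee_fin qk_ge0.
- by move=> y; rewrite lee_fin qk_le1.
Qed.

Let w t := Kint (gdens t) a.

Let w_fin t : w t \is a fin_num.
Proof.
rewrite ge0_fin_numE; last by apply: Kint_ge0 => y; exact: gdens_ge0.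
have : lam mu kap a < +oo by rewrite -ge0_fin_numE// lam_ge0.
apply: le_lt_trans; rewrite lamE; apply: Kint_le => //.
- exact: gdens_meas.
- by move=> y; exact: gdens_ge0.
- by move=> y; exact: gdens_le1.
Qed.

Let w_ge0 t : 0 <= w t.
Proof. by apply: Kint_ge0 => y; exact: gdens_ge0. Qed.

(** Exchanges the sum over the shape below a child with the integral over its type; an identity
    valid for almost every type suffices under the integral. *)
Lemma sum_Kint (c : tree -> R) (F : SB S -> \bar R) : (forall t, (0 <= c t)%R) ->
  measurable_fun setT F ->
  {ae mu, forall y : SB S, sum_shapes l (fun t => (c t)%:E * gdens t y) = F y} ->
  (forall y, 0 <= F y) ->
  sum_shapes l (fun t => (c t)%:E * w t) = Kint F a.
Proof.
move=> c0 mF ae F0.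
have mcg t : measurable_fun setT (fun y : SB S => (c t)%:E * gdens t y).
  by apply: emeasurable_funM => //; exact: gdens_meas.
have cg0 t y : 0 <= (c t)%:E * gdens t y by rewrite mule_ge0 ?lee_fin ?gdens_ge0.
have [m1 _] := sum_shapes_integral mu l mcg cg0.
have mk t : measurable_fun setT (fun y : SB S => (kap a y)%:E * ((c t)%:E * gdens t y)).
  exact: Kf_meas.
have k0 t y : 0 <= (kap a y)%:E * ((c t)%:E * gdens t y) by rewrite mule_ge0// lee_fin.
have [m2 E] := sum_shapes_integral mu l mk k0.
transitivity (sum_shapes l (fun t => \int[mu]_y ((kap a y)%:E * ((c t)%:E * gdens t y)))).
  congr sum_shapes; apply/funext => t; rewrite /w /Kint -ge0_integralZl//.
  - by apply: eq_integral => y _; rewrite muleCA.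
  - by apply: Kf_meas; exact: gdens_meas.
  - by move=> y _; rewrite mule_ge0 ?lee_fin ?gdens_ge0.
  - by rewrite lee_fin.
rewrite -E; apply: ge0_ae_eq_integral => //.
- exact: Kf_meas.
- by move=> y _; apply: sum_shapes_ge0 => t.
- by move=> y _; rewrite mule_ge0// lee_fin.
- move: ae; apply: filterS => y <- _.
  by rewrite sum_shapesZ.
Qed.

Let b2e (b : bool) : \bar R := b%:R%:E.

Let sum_w : sum_shapes l w = (g + h)%:E.
Proof.
rewrite /h addrC subrK -lmE lamE -(@sum_Kint (fun=> 1%R))//.
- by congr sum_shapes; apply/funext => t; rewrite mul1e.
- apply: filterS IHtot => y yE; rewrite -[RHS]yE.
  by congr sum_shapes; apply/funext => t; rewrite mul1e.
Qed.

Let sum_good : sum_shapes l (fun t => b2e (good_shape l t) * w t) = g%:E.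
Proof.
rewrite -qfin (@sum_Kint (fun t => (good_shape l t)%:R) (fun y => (qk l y)%:E))//.
- by apply/measurable_EFinP; exact: qk_meas.
- by move=> y; rewrite lee_fin qk_ge0.
Qed.

Let sum_bad : sum_shapes l (fun t => b2e (~~ good_shape l t) * w t) = h%:E.
Proof.
have E : sum_shapes l w = sum_shapes l (fun t => b2e (good_shape l t) * w t) +
    sum_shapes l (fun t => b2e (~~ good_shape l t) * w t).
  rewrite -sum_shapesD.
  - congr sum_shapes; apply/funext => t.
    by rewrite /b2e; case: good_shape; rewrite /= ?mul1e ?mul0e ?adde0 ?add0e.
  - by move=> t; rewrite mule_ge0// lee_fin.
  - by move=> t; rewrite mule_ge0// lee_fin.
move: E; rewrite sum_w sum_good; case: (sum_shapes _ _) => [x| |] //.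
by rewrite -EFinD => -[/addrI ->].
Qed.

(** Binomial expansion over ordered children: the first child is good with weight [g] or bad with
    weight [h], and the induction is Pascal's rule. *)
Lemma sum_seqs_count c j :
  sum_seqs (sum_shapes l) c (fun ts => b2e (count (good_shape l) ts == j) * prodK ts a) =
  ('C(c, j)%:R * g ^+ j * h ^+ (c - j))%R%:E.
Proof.
elim: c j => [|c IH] j.
  case: j => [|j]; first by rewrite /b2e /= mule1 bin0 !expr0 !mulr1.
  by rewrite /b2e /= mule1 bin0n !mul0r.
rewrite [LHS]/=.
pose A : R := if j is j'.+1 then ('C(c, j')%:R * g ^+ j' * h ^+ (c - j'))%R else 0%R.
pose B : R := ('C(c, j)%:R * g ^+ j * h ^+ (c - j))%R.
have A0 : (0 <= A)%R.
  by rewrite /A; case: (j) => // j'; rewrite !mulr_ge0// exprn_ge0.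
have B0 : (0 <= B)%R by rewrite /B !mulr_ge0// exprn_ge0.
have F0 ts j' : 0 <= b2e (count (good_shape l) ts == j') * prodK ts a.
  by rewrite mule_ge0 ?prodK_ge0// lee_fin.
have -> : (fun t => sum_seqs (sum_shapes l) c (fun ts =>
     b2e (good_shape l t + count (good_shape l) ts == j)%N * (Kint (gdens t) a * prodK ts a))) =
   (fun t => A%:E * (b2e (good_shape l t) * w t) + B%:E * (b2e (~~ good_shape l t) * w t)).
  apply/funext => t; rewrite -/(w t) -(fineK (w_fin t)); set om := fine (w t).
  have om0 : (0 <= om)%R by rewrite fine_ge0.
  rewrite /b2e; case: (good_shape l t) => /=; last first.
    rewrite mul0e mule0 add0e mul1e -EFinM mulrC EFinM -IH -sum_seqsZ//.
    - congr sum_seqs; apply/funext => ts; by rewrite add0n muleCA.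
    - exact: sum_shapes_ge0.
    - by move=> b f b0 f0; exact: sum_shapesZ.
  rewrite mul0e mule0 adde0 mul1e -EFinM mulrC EFinM /A; case: (j) => [|j'].
    have z0 : sum_seqs (sum_shapes l) c (fun=> 0) = 0 :> \bar R.
      elim: (c) => [//|c' IHc] /=; rewrite -[RHS](sum_shapes0 R l); congr sum_shapes.
      by apply/funext => t'; exact: IHc.
    rewrite mule0 -[RHS]z0; congr sum_seqs; apply/funext => ts.
    by rewrite add1n /= mul0e.
  rewrite -IH -sum_seqsZ//.
  - congr sum_seqs; apply/funext => ts; by rewrite add1n eqSS muleCA.
  - exact: sum_shapes_ge0.
  - by move=> b f b0 f0; exact: sum_shapesZ.
rewrite sum_shapesD; last 2 first.
- by move=> t; rewrite mule_ge0 ?lee_fin// mule_ge0// lee_fin.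
- by move=> t; rewrite mule_ge0 ?lee_fin// mule_ge0// lee_fin.
rewrite !sum_shapesZ//; last 2 first.
- by move=> t; rewrite mule_ge0// lee_fin.
- by move=> t; rewrite mule_ge0// lee_fin.
rewrite sum_good sum_bad -!EFinM -EFinD; congr EFin.
rewrite /A /B; case: (j) => [|j'].
  by rewrite !bin0 !subn0 exprS; ring.
rewrite binS natrD subSS; case: (ltnP j' c) => jc.
  by rewrite -(subnSK jc) !exprS; ring.
by rewrite (bin_small (jc : (c < j'.+1)%N)) (exprS g j'); ring.
Qed.

Lemma sum_seqs_prodK c : sum_seqs (sum_shapes l) c (prodK^~ a) = ((g + h) ^+ c)%:E.
Proof.
elim: c => [//|c IH]; rewrite [LHS]/= exprS EFinM -sum_w.
rewrite [RHS]muleC -sum_shapesZ//; last by rewrite exprn_ge0// addr_ge0.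
congr sum_shapes; apply/funext => t; rewrite -IH.
rewrite -/(w t) -(fineK (w_fin t)) [RHS]muleC -sum_seqsZ//.
- exact: sum_shapes_ge0.
- by move=> b f b0 f0; exact: sum_shapesZ.
- by rewrite fine_ge0.
- by move=> ts; exact: prodK_ge0.
Qed.

Let node_sum (P : seq tree -> bool) (x : nat -> R) :
  (forall c, sum_seqs (sum_shapes l) c (fun ts => b2e (P ts) * prodK ts a) = (x c)%:E) ->
  \sum_(0 <= c <oo) sum_seqs (sum_shapes l) c (fun ts => b2e (P ts) * gdens (Node ts) a) =
  \sum_(0 <= c <oo) ((expR (- (g + h)) / c`!%:R)%:E * (x c)%:E).
Proof.
move=> xE; apply: eq_eseriesr => c _; rewrite -xE -sum_seqsZ//.
- apply: (@eq_sum_seqs _ _ xpredT) => [f f' ff'|ts <- _].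
    by apply: eq_sum_shapes => t _; exact: ff'.
  rewrite gdens_Node lmE /= -EFinM muleCA; congr (_ * _).
  by rewrite /h addrC subrK.
- exact: sum_shapes_ge0.
- by move=> b f b0 f0; exact: sum_shapesZ.
- by move=> ts; rewrite mule_ge0 ?prodK_ge0// lee_fin.
Qed.

Lemma sum_gdens : sum_shapes l.+1 (gdens^~ a) = 1.
Proof.
rewrite [LHS]/= (eq_eseriesr (g := fun c => sum_seqs (sum_shapes l) c
   (fun ts => b2e true * gdens (Node ts) a))); last first.
  by move=> c _; congr sum_seqs; apply/funext => ts; rewrite mul1e.
rewrite (@node_sum xpredT (fun c => (g + h) ^+ c)%R); last first.
  by move=> c; rewrite -sum_seqs_prodK; congr sum_seqs; apply/funext => ts; rewrite mul1e.
rewrite (eq_eseriesr (g := fun c => (expR (- (g + h)))%:E * ((g + h) ^+ c / c`!%:R)%:E)); last first.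
  by move=> c _; rewrite -!EFinM; congr EFin; ring.
rewrite nneseriesZl => [|c _]; last by rewrite lee_fin divr_ge0 ?exprn_ge0// addr_ge0.
rewrite exp_eseries; last exact: addr_ge0.
by rewrite -EFinM mulrC expRxMexpNx_1.
Qed.

Lemma sum_gdens_eq j :
  sum_shapes l.+1 (fun t => b2e (good_count l t == j) * gdens t a) = (pois j g)%:E.
Proof.
rewrite [LHS]/= (@node_sum (fun ts => count (good_shape l) ts == j)
  (fun c => 'C(c, j)%:R * g ^+ j * h ^+ (c - j))%R); last by move=> c; exact: sum_seqs_count.
exact: pois_eseries.
Qed.

(** The complement is a finite sum of Poisson probabilities, and the total mass is 1 by
    [sum_gdens]. *)
Lemma sum_gdens_ge m :
  sum_shapes l.+1 (fun t => b2e (m <= good_count l t)%N * gdens t a) = (psi m g)%:E.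
Proof.
have P0 (P : tree -> bool) t : 0 <= b2e (P t) * gdens t a.
  by rewrite mule_ge0 ?gdens_ge0// lee_fin.
have lt : sum_shapes l.+1 (fun t => b2e (good_count l t < m)%N * gdens t a) =
    (\sum_(j < m) pois j g)%:E.
  elim: m => [|m IH].
    rewrite big_ord0 -[RHS](sum_shapes0 R l.+1); congr sum_shapes.
    by apply/funext => t; rewrite ltn0 mul0e.
  rewrite big_ord_recr [RHS]/= EFinD -IH -sum_gdens_eq -sum_shapesD//.
  - congr sum_shapes; apply/funext => t; rewrite /b2e ltnS leq_eqVlt orbC.
    case: ltngtP => //=; by rewrite ?mul1e ?mul0e ?adde0 ?add0e.
  - by move=> t; exact: (P0 (fun t => good_count l t < m)%N).
  - by move=> t; exact: (P0 (fun t => good_count l t == m)).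
have : sum_shapes l.+1 (fun t => b2e (m <= good_count l t)%N * gdens t a) +
   sum_shapes l.+1 (fun t => b2e (good_count l t < m)%N * gdens t a) = 1.
  rewrite -sum_gdens -sum_shapesD.
  - congr sum_shapes; apply/funext => t; rewrite /b2e leqNgt.
    by case: ltnP => /= _; rewrite ?mul1e ?mul0e ?adde0 ?add0e.
  - by move=> t; exact: (P0 (fun t => m <= good_count l t)%N).
  - by move=> t; exact: (P0 (fun t => good_count l t < m)%N).
rewrite lt /psi; move: (sum_shapes _ _) => x.
case: x => [x| |] //= /eqP; rewrite -EFinD eqe => /eqP <-.
by rewrite addrK.
Qed.

End OneStep.

Lemma sum_shapes_ae l :
  {ae mu, forall y : SB S, sum_shapes l (gdens^~ y) = 1} /\
  {ae mu, forall y : SB S, sum_shapes l (fun t => (good_shape l t)%:R%:E * gdens t y) = (qk l y)%:E}.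
Proof.
elim: l => [|l [IH1 IH2]].
  by split; apply: aeW => y /=; rewrite ?mul1e.
split; move: lam_fin_ae; apply: filterS => y yfin; first exact: sum_gdens.
exact: (sum_gdens_ge yfin IH1 IH2 k.-1).
Qed.

Lemma integral_good l m :
  sum_shapes l.+1 (fun t => \int[mu]_a ((m <= good_count l t)%N%:R%:E * gdens t a)) =
  \int[mu]_a (psi m (fine (Kint (fun y => (qk l y)%:E) a)))%:E.
Proof.
have mf t : measurable_fun setT (fun a : SB S => (m <= good_count l t)%N%:R%:E * gdens t a).
  by apply: emeasurable_funM => //; exact: gdens_meas.
have f0 t a : 0 <= (m <= good_count l t)%N%:R%:E * gdens t a.
  by rewrite mule_ge0 ?gdens_ge0// lee_fin.
have [m1 <-] := sum_shapes_integral mu l.+1 mf f0.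
have [IH1 IH2] := sum_shapes_ae l.
apply: ge0_ae_eq_integral => //.
- apply/measurable_EFinP; apply: psi_fine_meas; apply: Kint_meas.
    by apply/measurable_EFinP; exact: qk_meas.
  by move=> y; rewrite lee_fin qk_ge0.
- by move=> a _; exact: sum_shapes_ge0.
- move=> a _; rewrite lee_fin psi_ge0// fine_ge0// Kint_ge0// => y.
  by rewrite lee_fin qk_ge0.
- move: lam_fin_ae; apply: filterS => a afin _; exact: sum_gdens_ge.
Qed.

End Density.

Lemma card_asbool n (Q : nat -> Prop) :
  #|[set i : 'I_n | `[< Q (val i) >]]| = count (fun i => `[< Q i >]) (iota 0 n).
Proof.
rewrite -sum1_count -[in iota 0 n](subn0 n) -/(index_iota 0 n) big_mkord sum1_card.
by apply: eq_card => i; rewrite [RHS]unfold_in; apply/idP/idP => [|h]; rewrite inE.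
Qed.

(** * Depth approximation of the infinite-tree event *)

Section Process.
Variables (R : realType) (S : pseudoPMetricType R) (mu : probability (SB S) R).
Variables (kap : S -> S -> R) (k : nat).
Hypothesis Hkap : is_kernel kap.
Hypothesis Hint : \int[(mu \x mu)%E]_z (kap z.1 z.2)%:E < +oo.
Variables (d : measure_display) (Om : measurableType d) (P : probability Om R).
Variables (T : seq nat -> Om -> S) (N : seq nat -> Om -> nat).
Hypothesis HGW : is_GW mu kap P T N.

Fixpoint goodp (l : nat) (u : seq nat) (w : Om) : bool :=
  if l is l'.+1 then (k.-1 <= count (fun i => goodp l' (rcons u i) w) (iota 0 (N u w)))%N
  else true.

Definition nchild l u w := count (fun i => goodp l (rcons u i) w) (iota 0 (N u w)).

Lemma goodp_dec l u w : goodp l.+1 u w -> goodp l u w.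
Proof.
elim: l u => [//|l IH] u /= h; apply: leq_trans h _.
by apply: sub_count => i; exact: IH.
Qed.

Lemma goodp_le l m u w : (l <= m)%N -> goodp m u w -> goodp l u w.
Proof.
move=> lm; rewrite -(subnK lm); elim: (m - l)%N => [//|j IH] h.
by apply: IH; exact: goodp_dec.
Qed.

Lemma measurable_count (b : nat -> Om -> bool) (s : seq nat) m :
  (forall i, measurable [set w | b i w]) -> measurable [set w | (m <= count (b^~ w) s)%N].
Proof.
move=> mb; elim: s m => [|i s IH] m /=.
  case: m => [|m]; first by rewrite (_ : [set _ | _] = setT)//; apply/seteqP; split.
  by rewrite (_ : [set _ | _] = set0)//; apply/seteqP; split.
rewrite (_ : [set _ | _] = ([set w | b i w] `&` [set w | (m.-1 <= count (b^~ w) s)%N]) `|`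
  [set w | (m <= count (b^~ w) s)%N]).
  by apply: measurableU => //; apply: measurableI.
apply/seteqP; split => w /=; case: (b i w) => /=; rewrite ?add0n ?add1n.
- by case: m => [|m] /=; rewrite ?ltnS; left.
- by right.
- by case: m => [//|m] /=; rewrite ltnS => -[[]//|/ltnW].
- by case=> [[]|].
Qed.

Lemma measurable_N u c : measurable [set w | N u w = c].
Proof.
have [_ [mN _]] := HGW; rewrite -[X in measurable X]setTI.
exact: (mN u measurableT [set c]).
Qed.

Lemma measurable_nchild m l u :
  (forall v, measurable [set w | goodp l v w]) -> measurable [set w | (m <= nchild l u w)%N].
Proof.
move=> mg; rewrite (_ : [set _ | _] = \bigcup_c ([set w | N u w = c] `&`
   [set w | (m <= count (fun i => goodp l (rcons u i) w) (iota 0 c))%N])).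
  apply: bigcupT_measurable => c; apply: measurableI; first exact: measurable_N.
  exact: (@measurable_count (fun i w => goodp l (rcons u i) w)).
apply/seteqP; split => [w h|w [c _ [<- //]]]; by exists (N u w).
Qed.

Lemma measurable_goodp l u : measurable [set w | goodp l u w].
Proof.
elim: l u => [|l IH] u; last exact: measurable_nchild.
by rewrite (_ : [set _ | _] = setT)//; apply/seteqP; split.
Qed.

Definition level (l : nat) : set Om := [set w | (k <= nchild l [::] w)%N].

Lemma measurable_level l : measurable (level l).
Proof. by apply: measurable_nchild => v; exact: measurable_goodp. Qed.

(** Finitely many children: a depth at which all the doomed ones have failed exists. This is where
    local finiteness enters, as in Koenig's lemma. *)
Lemma uniform_bad (s : seq nat) u w : exists L, forall i, i \in s ->
  goodp L (rcons u i) w -> forall l, goodp l (rcons u i) w.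
Proof.
elim: s => [|i s [L IH]]; first by exists 0%N.
have [h|/existsNP[l0 h]] := pselect (forall l, goodp l (rcons u i) w).
  by exists L => j; rewrite in_cons => /predU1P[-> _ //|js]; exact: IH.
exists (maxn L l0) => j; rewrite in_cons => /predU1P[->|js] g.
  by exfalso; apply: h; apply: goodp_le g; rewrite leq_maxr.
by apply: IH => //; apply: goodp_le g; rewrite leq_maxl.
Qed.

Lemma count_all m u w : (forall l, (m <= nchild l u w)%N) ->
  (m <= count (fun i => `[< forall l, goodp l (rcons u i) w >]) (iota 0 (N u w)))%N.
Proof.
have [L LP] := uniform_bad (iota 0 (N u w)) u w => /(_ L)/leq_trans; apply.
rewrite /nchild eq_leq//; apply: eq_in_count => i iN.
by apply/idP/asboolP => [|/(_ L)//]; exact: LP.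
Qed.

(** The particles good at every depth form an infinite subtree, since by [count_all] the same
    children can serve all depths. *)
Lemma goodp_inf_subtree u w : (forall l, goodp l u w) <-> inf_subtree N k.-1 u w.
Proof.
split=> [h|[D [Du DP]] l].
  exists [set v | forall l, goodp l v w]; split => // v vg.
  rewrite (@card_asbool _ (fun i => forall l, goodp l (rcons v i) w)); apply: count_all => l.
  exact: vg l.+1.
elim: l u Du => [//|l IH] u Du /=; have := DP u Du.
rewrite (@card_asbool _ (fun i => D (rcons u i))) => /leq_trans; apply.
by apply: sub_count => i /asboolP; exact: IH.
Qed.

Lemma beta_event_level : beta_event k N = \bigcap_l level l.
Proof.
apply/seteqP; split => w.
  rewrite /beta_event /= (@card_asbool _ (fun i => inf_subtree N k.-1 [:: i] w)) => h l _.
  apply: leq_trans h _; apply: sub_count => i /asboolP/goodp_inf_subtree; exact.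
move=> h; rewrite /beta_event /= (@card_asbool _ (fun i => inf_subtree N k.-1 [:: i] w)).
apply: leq_trans (count_all (fun l => h l I)) _.
by apply: sub_count => i /asboolP g; apply/asboolP/goodp_inf_subtree.
Qed.

Fixpoint fits (t : tree) (u : seq nat) (w : Om) : bool :=
  if t is Node ts then (N u w == size ts) &&
    (fix all_fit ts i := if ts is t' :: ts' then fits t' (rcons u i) w && all_fit ts' i.+1
                         else true) ts 0%N
  else true.

Fixpoint all_fit u w (ts : seq tree) i :=
  if ts is t' :: ts' then fits t' (rcons u i) w && all_fit u w ts' i.+1 else true.

Lemma fits_Node ts u w : fits (Node ts) u w = (N u w == size ts) && all_fit u w ts 0.
Proof. by rewrite /=; congr (_ && _); elim: ts 0%N => //= t ts IH i; rewrite IH. Qed.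

Lemma gw_event_fits t u w : gw_event T N (fun=> setT) t u w <-> fits t u w.
Proof.
elim/tree_ind_all: t u => [//|ts IH] u; rewrite fits_Node /=; split.
  case=> _ [-> h]; rewrite eqxx /=; elim: ts 0%N IH h => // t ts IHs i IH /= [h1 h2].
  apply/andP; split; first by apply/(IH t (or_introl erefl)).
  by apply: IHs => // t' t's; apply: IH; right.
case/andP=> /eqP -> h; split => //; split => //.
elim: ts 0%N IH h => // t ts IHs i IH /= /andP[h1 h2]; split; first by apply/(IH t (or_introl erefl)).
by apply: IHs => // t' t's; apply: IH; right.
Qed.

Lemma measurable_fits t u : measurable [set w | fits t u w].
Proof.
elim/tree_ind_all: t u => [|ts IH] u.
  by rewrite (_ : [set _ | _] = setT)//; apply/seteqP; split.
under eq_set do rewrite fits_Node.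
rewrite (_ : [set _ | _] = [set w | N u w = size ts] `&` [set w | all_fit u w ts 0]).
  apply: measurableI; first exact: measurable_N.
  elim: ts 0%N IH => [|t ts IHs] i IH /=.
    by rewrite (_ : [set _ | _] = setT)//; apply/seteqP; split.
  rewrite (_ : [set _ | _] = [set w | fits t (rcons u i) w] `&` [set w | all_fit u w ts i.+1]).
    apply: measurableI; first by apply: IH; left.
    by apply: IHs => t' t's; apply: IH; right.
  by apply/seteqP; split => w /= /andP.
apply/seteqP; split => w /=; first by case/andP=> /eqP.
by case=> -> ->; rewrite eqxx.
Qed.

Lemma sum_seqs_measure l c u i (C : set Om) :
  (forall u (C : set Om), measurable C ->
     P C = sum_shapes l (fun t => P (C `&` [set w | fits t u w]))) ->
  measurable C ->
  P C = sum_seqs (sum_shapes l) c (fun ts => P (C `&` [set w | all_fit u w ts i])).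
Proof.
move=> IH; elim: c i C => [|c IHc] i C mC /=; first by congr (P _); rewrite setIidl.
rewrite (IH (rcons u i) C mC); congr sum_shapes; apply/funext => t.
rewrite (IHc i.+1); last by apply: measurableI => //; exact: measurable_fits.
congr sum_seqs; apply/funext => ts; congr (P _); rewrite -setIA; congr (_ `&` _).
by apply/seteqP; split => w /= /andP.
Qed.

(** Each outcome fits exactly one shape whose branches all have length [l], so this is the law of
    total probability, unfolded first over [N u] and then over the children. *)
Lemma sum_shapes_measure l u (C : set Om) : measurable C ->
  P C = sum_shapes l (fun t => P (C `&` [set w | fits t u w])).
Proof.
elim: l u C => [|l IH] u C mC /=; first by congr (P _); rewrite setIidl.
have mCc c : measurable (C `&` [set w | N u w = c]).
  by apply: measurableI => //; exact: measurable_N.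
have {1}-> : C = \bigcup_c (C `&` [set w | N u w = c]).
  by apply/seteqP; split => [w Cw|w [c _ []]//]; exists (N u w).
rewrite measure_semi_bigcup//=; first last.
- by apply: bigcupT_measurable.
- by apply/trivIsetP => i j _ _ ij; apply/seteqP; split => // w [[_ /= ei] [_ /= ej]];
    by move: ij; rewrite -ei -ej eqxx.
apply: eq_eseriesr => c _; rewrite (@sum_seqs_measure l c u 0)//.
apply: (@eq_sum_seqs _ _ xpredT) => [f f' ff'|ts <- _].
  by apply: eq_sum_shapes => t _; exact: ff'.
congr (P _); rewrite -setIA; congr (_ `&` _).
have -> : [set w | fits (Node ts) u w] =
  [set w | (N u w == size ts) && all_fit u w ts 0].
  by apply/funext => w; rewrite /mkset fits_Node.
apply/seteqP; split => w /=; first by case=> -> ->; rewrite eqxx.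
by case/andP=> /eqP.
Qed.

Lemma count_all_fit l (ts : seq tree) u i w :
  (forall t u, full l t -> fits t u w -> goodp l u w = good_shape k l t) ->
  all (full l) ts -> all_fit u w ts i ->
  count (fun j => goodp l (rcons u j) w) (iota i (size ts)) = count (good_shape k l) ts.
Proof.
move=> IH; elim: ts i => //= t ts IHs i /andP[ft fts] /andP[h1 h2].
by rewrite (IH t)// IHs.
Qed.

Lemma goodp_fits l t u w : full l t -> fits t u w -> goodp l u w = good_shape k l t.
Proof.
elim: l t u => [//|l IH] [//|ts] u fts; rewrite fits_Node => /andP[/eqP Nu h] /=.
by rewrite Nu (@count_all_fit _ ts)// => t' u'; exact: IH.
Qed.

Lemma nchild_fits l t u w : full l.+1 t -> fits t u w -> nchild l u w = good_count k l t.
Proof.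
case: t => [//|ts] fts; rewrite fits_Node => /andP[/eqP Nu h].
by rewrite /nchild Nu (@count_all_fit _ ts)// => t' u'; exact: goodp_fits.
Qed.

(** On a full shape of depth [l.+1] the event is decided by the shape alone, and the probability of
    the shape is prescribed by [is_GW] with all type sets equal to [setT]. *)
Lemma level_prob l :
  P (level l) = \int[mu]_a (psi k (fine (Kint mu kap (fun y => (qk mu kap k l y)%:E) a)))%:E.
Proof.
rewrite -integral_good// (sum_shapes_measure l.+1 [::] (measurable_level l)).
apply: eq_sum_shapes => t ft.
rewrite ge0_integralZl_EFin//; last first.
- exact: gdens_meas.
- by move=> a _; exact: gdens_ge0.
have <- : P [set w | fits t [::] w] = \int[mu]_a gdens mu kap t a.
  have [_ [_ HP]] := HGW.
  rewrite -(_ : [set w | gw_event T N (fun=> setT) t [::] w] = [set w | fits t [::] w]).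
    by rewrite HP//; apply: eq_integral => a _; rewrite gw_density_setT.
  by apply/seteqP; split => w /gw_event_fits.
case: (leqP k (good_count k l t)) => h /=.
  rewrite mul1e; congr (P _); apply/seteqP; split => [w []//|w fw]; split => //.
  by rewrite /level /= (nchild_fits ft fw).
rewrite mul0e; apply/eqP; rewrite -measure_le0.
rewrite (_ : _ `&` _ = set0) ?measure0//; apply/seteqP; split => // w [/= + fw].
by rewrite /level /= (nchild_fits ft fw) leqNgt h.
Qed.

Lemma level_cvg : P \o level @ \oo --> P (beta_event k N).
Proof.
rewrite beta_event_level; apply: nonincreasing_cvg_mu => //.
- by apply: le_lt_trans (probability_le1 P _) _; [exact: measurable_level|exact: ltry].
- by move=> l; exact: measurable_level.
- by apply: bigcapT_measurable => l; exact: measurable_level.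
- apply/nonincreasing_seqP => l; apply/subsetPset => w; rewrite /level /= => h.
  by apply: leq_trans h _; apply: sub_count => i; exact: goodp_dec.
Qed.

End Process.

Section BetaLimit.
Variables (R : realType) (S : pseudoPMetricType R) (mu : probability (SB S) R).
Variables (kap : S -> S -> R) (k : nat) (b : R).
Hypothesis Hkap : is_kernel kap.
Hypothesis Hint : \int[(mu \x mu)%E]_z (kap z.1 z.2)%:E < +oo.
Hypothesis Hb : is_beta_plus mu k kap b.

Definition blevel l := \int[mu]_a (psi k (fine (Kint mu kap (fun y => (qk mu kap k l y)%:E) a)))%:E.

Lemma beta_plus_itv : (0 <= b <= 1)%R.
Proof.
have [[d [Om [P [T [N HGW]]]]] /(_ _ _ _ _ _ HGW)[mb Pb]] := Hb.
rewrite -!lee_fin -Pb measure_ge0/=; exact: probability_le1.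
Qed.

Lemma beta_plus_le l : b%:E <= blevel l.
Proof.
have [[d [Om [P [T [N HGW]]]]] /(_ _ _ _ _ _ HGW)[mb <-]] := Hb.
rewrite /blevel -(level_prob k Hkap Hint HGW); apply: le_measure.
- by rewrite inE.
- by rewrite inE; exact: (measurable_level k HGW).
- by rewrite beta_event_level; exact: bigcap_inf.
Qed.

Lemma beta_plus_approx (eps : R) : (0 < eps)%R -> exists l, blevel l <= (b + eps)%:E.
Proof.
move=> e0; have [[d [Om [P [T [N HGW]]]]] /(_ _ _ _ _ _ HGW)[mb Pb]] := Hb.
have := level_cvg (k := k) HGW; rewrite Pb => c.
have : \forall l \near \oo, P (level k N l) < (b + eps)%:E.
  have h : (b < b + eps)%R by rewrite ltrDl.
  exact: (c _ (@nbhs_open_ereal_lt _ b (fun x => x + eps)%R h)).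
case=> l _ /(_ l (leqnn l)) h; exists l.
by rewrite /blevel -(level_prob k Hkap Hint HGW) ltW.
Qed.

End BetaLimit.

(** * Finitary kernels as matrices *)

Section FiniteTypes.
Variables (R : realType) (S : pseudoPMetricType R) (mu : probability (SB S) R).
Variables (r : nat) (tau : S -> 'I_r).
Hypothesis tau_meas : forall i, measurable (tau @^-1` [set i] : set (SB S)).

Definition tmass i : R := fine (mu (tau @^-1` [set i] : set (SB S))).

Lemma tmassE i : mu (tau @^-1` [set i] : set (SB S)) = (tmass i)%:E.
Proof.
rewrite /tmass fineK// ge0_fin_numE ?measure_ge0//.
by apply: le_lt_trans (probability_le1 mu (tau_meas i)) _; exact: ltry.
Qed.

Lemma tmass_ge0 i : (0 <= tmass i)%R.
Proof. by rewrite fine_ge0. Qed.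

Lemma integral_types (g : 'I_r -> R) : (forall i, 0 <= g i)%R ->
  \int[mu]_a (g (tau a))%:E = (\sum_i tmass i * g i)%R%:E.
Proof.
move=> g0.
transitivity (\int[mu]_a (\sum_i (g i)%:E * (\1_(tau @^-1` [set i] : set (SB S)) a)%:E)).
  apply: eq_integral => a _.
  rewrite (bigD1 (tau a))//= indicE mem_set// mule1 big1 ?adde0// => i ia.
  by rewrite indicE memNset ?mule0//= => e; rewrite e eqxx in ia.
have mi i : measurable_fun setT (fun a => (\1_(tau @^-1` [set i] : set (SB S)) a)%:E : \bar R).
  by apply/measurable_EFinP; apply: measurable_indic; exact: tau_meas.
rewrite ge0_integral_sum//.
- rewrite -sumEFin; apply: eq_bigr => i _.
  rewrite ge0_integralZl_EFin//.
  by rewrite integral_indic// setIT [X in _ * X]tmassE -EFinM mulrC.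
- by move=> i; apply: emeasurable_funM.
- by move=> i a _; rewrite -EFinM lee_fin mulr_ge0.
Qed.

Lemma tmass_sum : (\sum_i tmass i = 1)%R.
Proof.
have := @integral_types (fun=> 1%R) (fun=> ler01).
rewrite integral_cst// mul1e => E; apply: EFin_inj.
rewrite -(probability_setT mu) E; congr EFin.
by apply: eq_bigr => i _; rewrite mulr1.
Qed.

Variables (kap : S -> S -> R) (K : 'I_r -> 'I_r -> R).
Hypothesis K_ge0 : forall i j, (0 <= K i j)%R.
Hypothesis kapE : forall a b, kap a b = K (tau a) (tau b).

Lemma Kint_types (q : 'I_r -> R) a : (forall i, 0 <= q i)%R ->
  Kint mu kap (fun y => (q (tau y))%:E) a = (Kop K tmass q (tau a))%:E.
Proof.
move=> q0; rewrite /Kint (eq_integral (fun y : SB S => (K (tau a) (tau y) * q (tau y))%R%:E)).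
  rewrite (@integral_types (fun j => K (tau a) j * q j)%R).
    by congr EFin; apply: eq_bigr => j _; ring.
  by move=> j; rewrite mulr_ge0.
by move=> y _; rewrite kapE EFinM.
Qed.

Lemma Kop_tmass_ge0 q i : (forall j, 0 <= q j)%R -> (0 <= Kop K tmass q i)%R.
Proof. exact: Kop_ge0 K_ge0 tmass_ge0 q i. Qed.

Lemma qseq_tmass_ge0 k l i : (0 <= qseq K tmass k l i)%R.
Proof. exact: qseq_ge0 K_ge0 tmass_ge0 k l i. Qed.

Lemma qk_types k l a : qk mu kap k l a = qseq K tmass k l (tau a).
Proof.
elim: l a => [//|l IH] a /=.
rewrite (_ : (fun y : SB S => (qk mu kap k l y)%:E) = (fun y : SB S => (qseq K tmass k l (tau y))%:E)).
  by rewrite Kint_types//; exact: qseq_tmass_ge0.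
by apply/funext => y; rewrite IH.
Qed.

Lemma blevel_types k l :
  blevel mu kap k l = (\sum_i tmass i * psi k (Kop K tmass (qseq K tmass k l) i))%R%:E.
Proof.
rewrite /blevel -(@integral_types (fun i => psi k (Kop K tmass (qseq K tmass k l) i))).
  apply: eq_integral => a _.
  rewrite (_ : (fun y : SB S => (qk mu kap k l y)%:E) = (fun y : SB S => (qseq K tmass k l (tau y))%:E)).
    by rewrite Kint_types//; exact: qseq_tmass_ge0.
  by apply/funext => y; rewrite qk_types.
by move=> i; apply: psi_ge0; apply: Kop_tmass_ge0 => j; exact: qseq_tmass_ge0.
Qed.

Lemma types_kernel_integrable : is_kernel kap ->
  \int[(mu \x mu)%E]_z (kap z.1 z.2)%:E < +oo.
Proof.
move=> [_ [kap0 mk]]; rewrite fubini_tonelli1; last 2 first.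
- exact/measurable_EFinP.
- by move=> z; rewrite lee_fin.
rewrite /fubini_F (eq_integral (fun a : SB S => (Kop K tmass (fun=> 1%R) (tau a))%:E)).
  rewrite integral_types ?ltry// => i; exact: Kop_tmass_ge0.
move=> a _; rewrite -Kint_types//; apply: eq_integral => y _ /=.
by rewrite mule1.
Qed.

(* A non-positive "intensity" gives every particle no children almost surely, because
   [expeR (- lam)] is then at least 1. *)
Lemma beta_plus_nonpos k (c b : R) : (0 < k)%N -> (c <= 0)%R ->
  is_beta_plus mu k (fun a a' => c * kap a a')%R b -> (b <= 0)%R.
Proof.
move=> k0 c0 [[d [Om [P [T [N HGW]]]]] /(_ _ _ _ _ _ HGW)[mb Pb]].
have [_ [mN HP]] := HGW.
pose h i := Kop K tmass (fun=> - c)%R i.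
have h0 i : (0 <= h i)%R by apply: Kop_tmass_ge0 => j; rewrite oppr_ge0.
have lamE a : lam mu (fun a a' => c * kap a a')%R a = (- h (tau a))%R%:E.
  rewrite EFinN -Kint_types => [|i]; last by rewrite oppr_ge0.
  rewrite /Kint -integral_ge0N => [|y _].
    by apply: eq_integral => y _; rewrite -EFinM -EFinN; congr EFin; ring.
  by rewrite -EFinM lee_fin mulr_ge0 ?oppr_ge0// kapE.
pose A := [set w | N [::] w = 0%N].
have mA : measurable A by rewrite -[X in measurable X]setTI; exact: (mN [::] measurableT [set 0%N]).
have PA : 1 <= P A.
  have -> : A = [set w | gw_event T N (fun=> setT) (Node [::]) [::] w].
    by apply/seteqP; split => w /= [] // _ [].
  rewrite HP// (eq_integral (fun a : SB S => (expR (h (tau a)))%:E)) => [|a _].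
    rewrite (@integral_types (fun i => expR (h i))) => [|i]; last exact: expR_ge0.
    rewrite lee_fin -tmass_sum; apply: ler_sum => i _.
    by rewrite ler_peMr ?tmass_ge0// -[leLHS]expR0 ler_expR.
  by rewrite /= lamE -EFinN opprK /= mule1 fact0 invr1 mule1.
have : P A + P (beta_event k N) <= 1.
  rewrite -measureU//; first by apply: probability_le1; exact: measurableU.
  apply/seteqP; split => // w [Aw]; rewrite /beta_event /= (@card_asbool _ (fun i =>
    inf_subtree N k.-1 [:: i] w)).
  by rewrite Aw /= leqNgt k0.
rewrite Pb => h1; have : 1 + b%:E <= 1 by apply: le_trans h1; exact: leeD2r.
by rewrite -EFinD lee_fin gerDl.
Qed.

End FiniteTypes.

(** The matrix is read off at one representative per part. The constant [c] is a crude bound of its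
    entries, kept at least 1 for the sparsity estimate. *)
Lemma regular_finitary_types (R : realType) (S : pseudoPMetricType R) (mu : probability (SB S) R)
  (kap : S -> S -> R) : regular_finitary mu kap ->
  exists (r : nat) (tau : S -> 'I_r) (K : 'I_r -> 'I_r -> R) (c : R),
  [/\ (forall i, measurable (tau @^-1` [set i] : set (SB S)) /\
                 mu (bdry (tau @^-1` [set i]) : set (SB S)) = 0),
      (forall a b, kap a b = K (tau a) (tau b)),
      (forall i j, 0 <= K i j)%R, (forall i j, K i j = K j i) &
      (1 <= c)%R /\ (forall i j, K i j <= c)%R].
Proof.
case=> -[kapC [kap0 mk]] [r [part [mpart [bpart [dpart [cpart kapP]]]]]].
pose tau a := projT1 (cid (cpart a)).
have tauP a : part (tau a) a by rewrite /tau; case: cid.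
have partE i : part i = tau @^-1` [set i].
  apply/seteqP; split => [a pa|a <-]//=; apply/eqP/negPn/negP => ne.
  have := dpart _ _ ne; rewrite -subset0; apply; split; [exact: tauP|exact: pa].
(* An empty part gets a default point; its row still satisfies the bounds, and no vertex has that
   type. *)
pose rep i := xget point (part i).
exists r, tau, (fun i j => kap (rep i) (rep j)), (1 + \sum_i \sum_j kap (rep i) (rep j))%R.
split => //.
- by move=> i; rewrite -partE.
- move=> a b; apply: (kapP (tau a) (tau b)) => //.
  + by apply: (@xgetPex _ point (part (tau a))); exists a.
  + by apply: (@xgetPex _ point (part (tau b))); exists b.
- have s0 i : (0 <= \sum_j kap (rep i) (rep j))%R by apply: sumr_ge0.
  split; first by rewrite lerDl sumr_ge0.
  move=> i j; apply: (@le_trans _ _ (\sum_i \sum_j kap (rep i) (rep j))%R); last by rewrite lerDr.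
  by rewrite (bigD1 i)//= (bigD1 j)//= -addrA lerDl addr_ge0// sumr_ge0.
Qed.

(** * Monotonicity of the survival probabilities in the kernel *)

Section Compare.
Variables (R : realType) (S : pseudoPMetricType R) (mu : probability (SB S) R).
Variables (kap kap' : S -> S -> R) (k : nat).
Hypotheses (Hkap : is_kernel kap) (Hkap' : is_kernel kap').
Hypothesis Hint : \int[(mu \x mu)%E]_z (kap z.1 z.2)%:E < +oo.
Hypothesis kap_le : forall a b, (kap' a b <= kap a b)%R.

Let kap_ge0 a b : (0 <= kap a b)%R. Proof. by have [_ []] := Hkap. Qed.
Let kap'_ge0 a b : (0 <= kap' a b)%R. Proof. by have [_ []] := Hkap'. Qed.

(** Finiteness of [lam] at [a] is what makes [fine] monotone here: an infinite integral would be
    read as 0. *)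
Let psi_Kint_le m (f f' : SB S -> R) a :
  measurable_fun setT f -> measurable_fun setT f' ->
  (forall y, 0 <= f y <= 1)%R -> (forall y, 0 <= f' y)%R ->
  {ae mu, forall y : SB S, (f' y <= f y)%R} ->
  lam mu kap a \is a fin_num ->
  (psi m (fine (Kint mu kap' (fun y => (f' y)%:E) a)) <=
   psi m (fine (Kint mu kap (fun y => (f y)%:E) a)))%R.
Proof.
move=> mf mf' f01 f'0 ff' la.
have f0 y : (0 <= f y)%R by case/andP: (f01 y).
have f1 y : (f y <= 1)%R by case/andP: (f01 y).
have fin : Kint mu kap (fun y => (f y)%:E) a < +oo.
  have : lam mu kap a < +oo by rewrite -ge0_fin_numE// (lam_ge0 mu Hkap).
  apply: le_lt_trans; rewrite lamE; apply: (Kint_le mu Hkap) => //; exact/measurable_EFinP.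
have le : Kint mu kap' (fun y => (f' y)%:E) a <= Kint mu kap (fun y => (f y)%:E) a.
  apply: ae_ge0_le_integral => //.
  - by move=> y _; rewrite -EFinM lee_fin mulr_ge0.
  - by apply: (Kf_meas Hkap'); exact/measurable_EFinP.
  - by move=> y _; rewrite -EFinM lee_fin mulr_ge0.
  - by apply: (Kf_meas Hkap); exact/measurable_EFinP.
  - by apply: filterS ff' => y h _; rewrite -!EFinM lee_fin ler_pM.
have K'0 : 0 <= Kint mu kap' (fun y => (f' y)%:E) a by apply: (Kint_ge0 _ Hkap').
apply: psi_mono; first exact: fine_ge0.
by apply: fine_le => //; rewrite ge0_fin_numE ?(le_lt_trans le)// (le_trans K'0).
Qed.

Lemma qk_compare l : {ae mu, forall a : SB S, (qk mu kap' k l a <= qk mu kap k l a)%R}.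
Proof.
elim: l => [|l IH]; first by apply: aeW => a /=.
apply: filterS (lam_fin_ae Hkap Hint) => a la /=; apply: psi_Kint_le => //.
- exact: qk_meas.
- exact: qk_meas.
- by move=> y; rewrite qk_ge0// qk_le1.
- by move=> y; rewrite qk_ge0.
Qed.

Lemma blevel_compare l : blevel mu kap' k l <= blevel mu kap k l.
Proof.
have p0 (kap0 : S -> S -> R) : is_kernel kap0 -> forall a : SB S,
    0 <= (psi k (fine (Kint mu kap0 (fun y => (qk mu kap0 k l y)%:E) a)))%:E.
  move=> H a; rewrite lee_fin psi_ge0// fine_ge0// (Kint_ge0 _ H)// => y.
  by rewrite lee_fin qk_ge0.
have pm (kap0 : S -> S -> R) : is_kernel kap0 -> measurable_fun setT (fun a : SB S =>
    (psi k (fine (Kint mu kap0 (fun y => (qk mu kap0 k l y)%:E) a)))%:E).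
  move=> H; apply/measurable_EFinP; apply: psi_fine_meas; apply: Kint_meas => //.
    by apply/measurable_EFinP; exact: qk_meas.
  by move=> y; rewrite lee_fin qk_ge0.
apply: ae_ge0_le_integral => //.
- by move=> a _; exact: p0.
- exact: pm.
- by move=> a _; exact: p0.
- exact: pm.
- apply: filterS (lam_fin_ae Hkap Hint) => a la _; rewrite lee_fin; apply: psi_Kint_le => //.
  + exact: qk_meas.
  + exact: qk_meas.
  + by move=> y; rewrite qk_ge0// qk_le1.
  + by move=> y; rewrite qk_ge0.
  + exact: qk_compare.
Qed.

End Compare.

Local Close Scope ereal_scope.

(** * Graphs on a vertex space *)

Lemma mem_asbool (T : Type) (Q : T -> Prop) (i : T) : (i \in [set i | `[< Q i >]]) = `[< Q i >].
Proof. by apply/idP/idP => [|h]; rewrite inE. Qed.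

Section Probability.
Variables (R : realType) (d : measure_display) (Om : measurableType d) (P : probability Om R).

Lemma integral_le_off (B : set Om) (f : Om -> R) (e M : R) :
  measurable B -> measurable_fun setT f -> 0 <= e -> 0 <= M ->
  (forall w, 0 <= f w <= M) -> (forall w, ~ B w -> f w <= e) ->
  (\int[P]_w (f w)%:E <= e%:E + M%:E * P B)%E.
Proof.
move=> mB mf e0 M0 f0 fe.
have m1 : measurable_fun setT (fun w => (\1_B w : R)%:E).
  by apply/measurable_EFinP; exact: measurable_indic.
apply: (@le_trans _ _ (\int[P]_w (e%:E + M%:E * (\1_B w)%:E))%E).
  apply: ge0_le_integral => //.
  - by move=> w _; rewrite lee_fin; case/andP: (f0 w).
  - exact/measurable_EFinP.
  - by apply: emeasurable_funD => //; exact: emeasurable_funM.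
  - move=> w _; rewrite -EFinM -EFinD lee_fin indicE.
    have [wB|wB] := boolP (w \in B).
      by rewrite mulr1 (le_trans (proj2 (andP (f0 w))))// lerDr.
    by rewrite mulr0 addr0 fe// => Bw; rewrite mem_set in wB.
rewrite ge0_integralD//.
- rewrite ge0_integralZl_EFin// integral_indic// setIT.
  rewrite integral_cst// (_ : (e%:E * _ = e%:E)%E)//.
  by rewrite -[RHS]mule1; congr (_ * _)%E; exact: probability_setT.
- by move=> w _; rewrite -EFinM lee_fin mulr_ge0.
- exact: emeasurable_funM.
Qed.

Lemma cvg0_lt (u : nat -> \bar R) (eta : R) : u @ \oo --> 0%E -> 0 < eta ->
  exists N, forall n, (N <= n)%N -> (u n < eta%:E)%E.
Proof.
move=> c e0; have h : 0 < 0 + eta by rewrite add0r.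
have [N _ NP] := c _ (@nbhs_open_ereal_lt R 0 (fun y => y + eta) h).
by exists N => n /NP /=; rewrite add0r.
Qed.

Lemma cvg0_le (u : nat -> \bar R) : (forall n, (0 <= u n)%E) ->
  (forall eta, 0 < eta -> exists N, forall n, (N <= n)%N -> (u n <= eta%:E)%E) ->
  u @ \oo --> 0%E.
Proof.
move=> u0 h; apply/fine_cvgP; split.
  have [N NP] := h 1 ltr01; exists N => // n /NP un.
  by rewrite ge0_fin_numE// (le_lt_trans un) ?ltry.
apply/cvgrPdist_le => e e0; have [N NP] := h e e0; exists N => // n /NP un /=.
rewrite sub0r normrN ger0_norm ?fine_ge0// -lee_fin fineK//.
by rewrite ge0_fin_numE// (le_lt_trans un) ?ltry.
Qed.

Variables (S : pseudoPMetricType R) (mu : probability (SB S) R).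
Variable x : forall n : nat, Om -> 'I_n -> S.
Arguments x : clear implicits.
Hypothesis Hx : vertex_space mu P x.

Lemma edgep01 (kap : S -> S -> R) n (y : 'I_n -> S) p : is_kernel kap -> 0 <= edgep kap y p <= 1.
Proof.
move=> [_ [k0 _]]; rewrite /edgep le_min ge_min lexx orbT ler01 !andbT.
by rewrite divr_ge0.
Qed.

Lemma edgep_meas (kap : S -> S -> R) n (p : 'I_n * 'I_n) : is_kernel kap ->
  measurable_fun setT (fun w => edgep kap (x n w) p).
Proof.
move=> [_ [_ mk]]; apply: measurable_minr => //; apply: measurable_funM => //.
have [mx _] := Hx.
have m2 : measurable_fun setT (fun w => (x n w p.1 : SB S, x n w p.2 : SB S)).
  by apply: measurable_fun_pair; exact: mx.
exact: (measurableT_comp mk m2).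
Qed.

Definition graph_mean (kap : S -> S -> R) n (f : {set 'I_n * 'I_n} -> R) (w : Om) : R :=
  Ex (edgep kap (x n w)) (pairsn n) f.

Lemma graph_mean_meas (kap : S -> S -> R) n f : is_kernel kap ->
  measurable_fun setT (graph_mean kap (n := n) f).
Proof.
move=> Hk; rewrite /graph_mean /Ex.
rewrite (_ : (fun w => _) = (fun w => \sum_(E : {set 'I_n * 'I_n}) if E \in powerset (pairsn n) then
   wt (edgep kap (x n w)) (pairsn n) E * f E else 0)); last first.
  by apply/funext => w; rewrite big_mkcond.
apply: measurable_sum => E; case: (E \in powerset (pairsn n)) => //.
apply: measurable_funM => //; rewrite /wt.
rewrite (_ : (fun w => _) = (fun w => \prod_(p : 'I_n * 'I_n) if p \in pairsn n then
   (if p \in E then edgep kap (x n w) p else 1 - edgep kap (x n w) p) else 1)); last first.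
  by apply/funext => w; rewrite big_mkcond.
apply: measurable_prod => p _; case: (p \in pairsn n) => //.
case: (p \in E); first exact: edgep_meas.
by apply: measurable_funB => //; exact: edgep_meas.
Qed.

Section GoodTypes.
Variables (r : nat) (tau : S -> 'I_r).
Hypothesis tauP : forall i, measurable (tau @^-1` [set i] : set (SB S)) /\
                 mu (bdry (tau @^-1` [set i]) : set (SB S)) = 0%E.

(** The parts have null boundary, so the vertex-space hypothesis applies to each; a union bound over
    the finitely many types gives one measurable exceptional set. *)
Lemma types_close_event delta eta : 0 < delta -> 0 < eta ->
  exists N, forall n, (N <= n)%N -> exists B, [/\ measurable B, (P B <= eta%:E)%E &
    forall w, ~ B w -> types_close (tmass mu tau) (fun i => tau (x n w i)) delta].
Proof.
move=> d0 e0; have [mx Hfreq] := Hx.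
pose A j := tau @^-1` [set j].
pose bad n j := [set w | delta < `| (#|[set i : 'I_n | `[< A j (x n w i) >]]|%:R / n%:R)
                                     - fine (mu (A j : set (SB S))) | ].
have mbad n j : measurable (bad n j).
  have mf : measurable_fun setT (fun w : Om =>
      `| (#|[set i : 'I_n | `[< A j (x n w i) >]]|%:R / n%:R) - fine (mu (A j : set (SB S))) | : R).
    apply: measurableT_comp => //; apply: measurable_funB => //; apply: measurable_funM => //.
    rewrite (_ : (fun w => _) = (fun w => \sum_(i < n) \1_(A j : set (SB S)) (x n w i)) :> (Om -> R)).
      apply: measurable_sum => i.
      have m1 : measurable_fun setT (\1_(A j : set (SB S)) : SB S -> R).
        by apply: measurable_indic; exact: (tauP j).1.
      exact: (measurableT_comp m1 (mx n i)).
    apply/funext => w; rewrite -sum1_card natr_sum big_mkcond; apply: eq_bigr => i _.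
    rewrite indicE mem_asbool; case: asboolP => h; first by rewrite mem_set.
    by rewrite memNset.
  have := mf measurableT _ (measurable_itv `]delta, +oo[%R); rewrite setTI.
  congr (measurable _); apply/seteqP; split => w /=; by rewrite in_itv /= andbT.
have bnd : exists N, forall n, (N <= n)%N -> forall j, (P (bad n j) < (eta / r.+1%:R)%:E)%E.
  have h j : exists N, forall n, (N <= n)%N -> (P (bad n j) < (eta / r.+1%:R)%:E)%E.
    by apply: (@cvg0_lt (fun n => P (bad n j))); [exact: Hfreq (tauP j).1 (tauP j).2 _ d0|
      rewrite divr_gt0].
  have {}h := boolp.choice h; case: h => Nj NP.
  exists (\max_j Nj j)%N => n nN j; apply: NP; apply: leq_trans nN; exact: leq_bigmax.
case: bnd => N NP; exists N => n nN.
have [B [mB PB BP]] : exists B, [/\ measurable B,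
    (P B <= ((size (enum 'I_r))%:R * (eta / r.+1%:R))%:E)%E &
    forall j w, j \in enum 'I_r -> bad n j w -> B w].
  elim: (enum 'I_r) => [|j s [B [mB PB BP]]].
    by exists set0; rewrite measure0 mul0r; split.
  exists (bad n j `|` B); split; first exact: measurableU.
    apply: le_trans (measureU2 _ (mbad n j) mB) _.
    rewrite /= -addn1 addnC natrD mulrDl mul1r EFinD; apply: leeD => //.
    by apply/ltW; exact: NP.
  move=> j' w; rewrite in_cons => /predU1P[->|js] bw; first by left.
  by right; exact: BP bw.
exists B; split => //.
  apply: le_trans PB _; rewrite lee_fin size_enum_ord mulrCA ler_piMr ?(ltW e0)//.
  by rewrite ler_pdivrMr// mul1r ler_nat.
move=> w nBw j; rewrite leNgt; apply/negP => lt; apply: nBw; apply: (BP j); first exact: mem_enum.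
rewrite /bad /=; move: lt; rewrite /tmass.
rewrite (_ : #|finset _| = #|[set i | `[< A j (x n w i) >]]|)//.
apply: eq_card => i; rewrite mem_asbool inE; apply/eqP/asboolP; exact.
Qed.

End GoodTypes.

End Probability.

(** * Lower tail and upper mean for the given kernel *)

Section Tails.
Variables (R : realType) (S : pseudoPMetricType R) (mu : probability (SB S) R).
Variables (d : measure_display) (Om : measurableType d) (P : probability Om R).
Variable x : forall n : nat, Om -> 'I_n -> S.
Arguments x : clear implicits.
Hypothesis Hx : vertex_space mu P x.
Variables (kap : S -> S -> R) (k : nat) (b : R).
Hypotheses (Hkap : is_kernel kap) (k2 : (2 <= k)%N).

Let edge01 (kap' : S -> S -> R) n (y : 'I_n -> S) :
  is_kernel kap' -> forall p, 0 <= edgep kap' y p <= 1.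
Proof. by move=> H p; exact: edgep01. Qed.

Lemma edgep_tprob (kap' : S -> S -> R) r (tau : S -> 'I_r) (K : 'I_r -> 'I_r -> R) n (y : 'I_n -> S) :
  (forall a a', kap' a a' = K (tau a) (tau a')) ->
  edgep kap' y = tprob K (fun i => tau (y i)).
Proof. by move=> kE; apply/funext => p; rewrite /edgep /tprob kE. Qed.

Lemma core_lower_tail :
  (exists (kapm : nat -> S -> S -> R) (c : nat -> R) (bm : nat -> R),
      (forall m, regular_finitary mu (kapm m)) /\
      (forall m a a', kapm m a a' <= kap a a') /\
      (forall m, c m < 1) /\
      (forall m, is_beta_plus mu k (fun a a' => c m * kapm m a a') (bm m)) /\
      bm @ \oo --> b) ->
  forall delta, 0 < delta -> exists N, forall n, (N <= n)%N ->
    (\int[P]_w (graph_mean x kap (fun E : {set 'I_n * 'I_n} =>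
       ((ck k E)%:R / n%:R < b - delta)%R%:R) w)%:E <= delta%:E)%E.
Proof.
move=> [kapm [c [bm [Hfin [Hle [Hc [Hbm Hcv]]]]]]] delta d0.
have d20 : 0 < delta / 2 by rewrite divr_gt0.
have [m bmP] : exists m, b - delta / 2 < bm m.
  move/cvgrPdist_lt: Hcv => /(_ _ d20)[N _ NP]; exists N.
  have := NP N (leqnn N); rewrite /= ltr_norml => /andP[_]; lra.
have [r [tau [K [C [tauP kapE K0 KC [C1 KC']]]]]] := regular_finitary_types (Hfin m).
have tau_meas i : measurable (tau @^-1` [set i] : set (SB S)) by exact: (tauP i).1.
have [cm0|cm0] := leP (c m) 0.
  (* Here [b - delta / 2 < bm m <= 0], so [b - delta] is negative and the event is empty. *)
  have bm0 := beta_plus_nonpos tau_meas K0 kapE (ltnW k2) cm0 (Hbm m).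
  exists 0%N => n _; rewrite (eq_integral (fun=> 0%E)) ?integral0 ?lee_fin ?(ltW d0)//.
  move=> w _; congr EFin; rewrite /graph_mean -[RHS](Ex_cst (edgep kap (x n w)) (pairsn n)).
  apply: eq_Ex => E _; rewrite [_ < _]ltNge (_ : (b - delta <= _) = true)//.
  have h0 : 0 <= (ck k E)%:R / n%:R :> R by rewrite divr_ge0.
  lra.
pose K' i j := c m * K i j.
have K'0 i j : 0 <= K' i j by rewrite mulr_ge0// ltW.
have kapE' a a' : c m * kapm m a a' = K' (tau a) (tau a') by rewrite kapE.
have Hm : is_kernel (kapm m) := (Hfin m).1.
have H' : is_kernel (fun a a' => c m * kapm m a a').
  have [s [n0 mm]] := Hm; split; first by move=> a a'; rewrite s.
  split; first by move=> a a'; rewrite mulr_ge0// ltW.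
  exact: measurable_funM.
have Hint' := types_kernel_integrable mu tau_meas K'0 kapE' H'.
have le l : bm m <= \sum_i tmass mu tau i * psi k (Kop K' (tmass mu tau) (qseq K' (tmass mu tau) k l) i).
  rewrite -lee_fin -(blevel_types mu tau_meas K'0 kapE'); exact: (beta_plus_le H' Hint' (Hbm m) l).
have mass0 := @tmass_ge0 _ _ mu _ tau.
(* The limit is taken for the thinned matrix [K'], so that [q] meets the hypothesis of
   [finitary_core_lower] for [K] with [x = c m]. *)
have [q [q0 q1 qfix qlim]] := qseq_limit K'0 mass0 k.
have bq := qlim _ le.
have KopE i : Kop K' (tmass mu tau) q i = c m * Kop K (tmass mu tau) q i.
  by rewrite /Kop mulr_sumr; apply: eq_bigr => j _; rewrite /K'; ring.
have qfix' i : q i <= psi k.-1 (c m * Kop K (tmass mu tau) q i) by rewrite -KopE.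
have [dl [N1 [dl0 lowP]]] := finitary_core_lower K0 KC' KC mass0 C1 k2 (ltW cm0) (Hc m) q0 q1 qfix' d20.
have [N2 N2P] := types_close_event Hx tauP dl0 d20.
exists (maxn 1 (maxn N1 N2)) => n; rewrite !geq_max => /and3P[n1 nN1 nN2].
have nn0 : 0 < n%:R :> R by rewrite ltr0n.
have [B [mB PB BP]] := N2P n nN2.
apply: (@le_trans _ _ ((delta / 2)%:E + 1%:E * P B)%E); last first.
  rewrite mul1e; apply: le_trans (leeD2l _ PB) _.
  by rewrite -EFinD lee_fin -splitr.
apply: integral_le_off => //.
- exact: graph_mean_meas Hx _ _ _ Hkap.
- exact: ltW.
- move=> w; apply/andP; split; first by apply: Ex_ge0 => [p|E _]; [exact: edge01|rewrite ler0n].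
  rewrite -[leRHS](Ex_cst (edgep kap (x n w)) (pairsn n)); apply: ler_Ex => [p|E _].
    exact: edge01.
  by case: (_ < _).
- move=> w nB; have cl := BP w nB.
  apply: le_trans (lowP n _ nN1 cl).
  rewrite -(edgep_tprob _ kapE).
  apply: (@le_trans _ _ (Ex (edgep (kapm m) (x n w)) (pairsn n)
     (fun E => ((ck k E)%:R / n%:R < b - delta)%R%:R))).
    (* The core grows with the graph, so having a small core is a decreasing event. *)
    apply: ler_Ex_p.
    + by move=> p; case/andP: (edge01 (x n w) Hm p).
    + by move=> p; case/andP: (edge01 (x n w) Hkap p).
    + move=> p; by rewrite /edgep le_min !ge_min lexx orbT andbT ler_wpM2r ?invr_ge0.
    + move=> E F EF; rewrite ler_nat; case: (ltP (_ / _)) => // h.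
      rewrite (_ : (_ < _) = true)//; apply: le_lt_trans h.
      by rewrite ler_wpM2r ?invr_ge0// ler_nat ck_mono.
  apply: ler_Ex => [p|E _]; first exact: edge01.
  rewrite ler_nat; case: (ltP (_ / _)) => // h.
  rewrite (_ : (_ < _) = true)// -ltr_pdivrMr//; apply: lt_le_trans h _.
  rewrite (eq_bigr (fun i => tmass mu tau i * psi k (Kop K' (tmass mu tau) q i))) => [|i _].
    by move: bq bmP; lra.
  by rewrite KopE.
Qed.

Lemma measurable_finset_sum (I : finType) (W : {set I}) (h : I -> Om -> R) :
  (forall i, measurable_fun setT (h i)) -> measurable_fun setT (fun w => \sum_(i in W) h i w).
Proof.
move=> mh; rewrite (_ : (fun w => _) = (fun w => \sum_i if i \in W then h i w else 0)).
  by apply: measurable_sum => i; case: (i \in W).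
by apply/funext => w; rewrite big_mkcond.
Qed.

(** The depth [l] is fixed first, from [beta_plus_approx] for [kap]; then [m], large enough for all
    path lengths up to [l.+1]; then [n]. By [blevel_compare] the depth-[l] probability for the
    finitary kernel is at most that for [kap]. *)
Lemma core_upper_mean :
  (\int[(mu \x mu)%E]_z (kap z.1 z.2)%:E < +oo)%E -> is_beta_plus mu k kap b ->
  (exists (kapm' : nat -> S -> S -> R)
          (q : forall (m n : nat), Om -> {set 'I_n * 'I_n} -> {set 'I_n * 'I_n} -> R),
      (forall m, regular_finitary mu (kapm' m)) /\
      (forall m a a', kapm' m a a' <= kapm' m.+1 a a') /\
      (forall m a a', kapm' m a a' <= kap a a') /\
      (forall m n (E' E : {set 'I_n * 'I_n}), measurable_fun setT (fun w => q m n w E' E)) /\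
      (forall m n w (E' E : {set 'I_n * 'I_n}), 0 <= q m n w E' E) /\
      (forall m n w (E' E : {set 'I_n * 'I_n}), q m n w E' E != 0 ->
          [/\ E' \subset E & E \subset pairsn n]) /\
      (forall m n w (E' : {set 'I_n * 'I_n}), E' \subset pairsn n ->
          \sum_(E in powerset (pairsn n)) q m n w E' E = gweight (kapm' m) (x n w) E') /\
      (forall m n w (E : {set 'I_n * 'I_n}), E \subset pairsn n ->
          \sum_(E' in powerset (pairsn n)) q m n w E' E = gweight kap (x n w) E) /\
      (forall (l : nat) (eps : R), (1 <= l)%N -> 0 < eps ->
         exists m0 : nat, forall m, (m0 <= m)%N ->
           exists n0 : nat, forall n, (n0 <= n)%N ->
             (\int[P]_w (\sum_(E' in powerset (pairsn n)) \sum_(E in powerset (pairsn n))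
                 q m n w E' E * (if eps * n%:R <= #|Vset l E' E|%:R then 1 else 0))%:E <= eps%:E)%E)) ->
  forall delta, 0 < delta -> exists N, forall n, (N <= n)%N ->
    (\int[P]_w (graph_mean x kap (fun E : {set 'I_n * 'I_n} => (ck k E)%:R / n%:R) w)%:E <=
     (b + delta)%:E)%E.
Proof.
move=> Hint Hb [kapm [q [Hfin [_ [Hle [mq [q0 [qs [qg' [qg Hpath]]]]]]]]]] delta d0.
have d40 : 0 < delta / 4 by rewrite divr_gt0.
have d80 : 0 < delta / 8 by rewrite divr_gt0.
have [l hl] := beta_plus_approx Hkap Hint Hb d40.
pose H := l.+1; pose e := delta / 8 / H%:R.
have H0 : 0 < H%:R :> R by rewrite ltr0n.
have e0 : 0 < e by rewrite divr_gt0.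
have [M MP] := boolp.choice (fun j : nat => Hpath j.+1 e (ltn0Sn j) e0).
pose m := (\max_(j < H) M j)%N.
have hj (j : 'I_H) : exists n0, forall n, (n0 <= n)%N ->
    (\int[P]_w (\sum_(E' in powerset (pairsn n)) \sum_(E in powerset (pairsn n))
       q m n w E' E * (if e * n%:R <= #|Vset j.+1 E' E|%:R then 1 else 0))%:E <= e%:E)%E.
  by apply: (MP j m); exact: (leq_bigmax (F := fun j : 'I_H => M j)).
have [n0 n0P] := boolp.choice hj.
have [r [tau [K [C [tauP kapE K0 KC [C1 KC']]]]]] := regular_finitary_types (Hfin m).
have tau_meas i : measurable (tau @^-1` [set i] : set (SB S)) by exact: (tauP i).1.
have mass0 := @tmass_ge0 _ _ mu _ tau.
have C0 : 0 <= C := le_trans ler01 C1.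
have [dl [N1 [dl0 upP]]] := finitary_core_upper k K0 KC' KC mass0 C0 l d40.
have [N2 N2P] := types_close_event Hx tauP dl0 d80.
have Hm : is_kernel (kapm m) := (Hfin m).1.
exists (maxn 1 (maxn (maxn N1 N2) (\max_j n0 j)))%N => n.
rewrite !geq_max => /and3P[n1 /andP[nN1 nN2] nj].
have nn0 : 0 < n%:R :> R by rewrite ltr0n.
pose X (E' : {set 'I_n * 'I_n}) : R :=
  (#|finset (fun v : 'I_n => chord (adj E') H finset.set0 finset.set0 (finset.setT :\ v)%SET v)| +
   #|finset (fun v : 'I_n => (loc (adj E') k (nseq H false) k (finset.setT :\ v)%SET v).1)|)%:R / n%:R.
have X0 E' : 0 <= X E' by rewrite divr_ge0.
have X2 E' : X E' <= 2.
  rewrite ler_pdivrMr// natrD -[2]/(1 + 1) mulrDl mul1r.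
  by apply: lerD; rewrite ler_nat; apply: leq_trans (max_card _) _; rewrite card_ord.
pose V (j : 'I_H) w : R := \sum_(E' in powerset (pairsn n)) \sum_(E in powerset (pairsn n))
       q m n w E' E * (if e * n%:R <= #|Vset j.+1 E' E|%:R then 1 else 0).
have V0 j w : 0 <= V j w.
  by apply: sumr_ge0 => E' _; apply: sumr_ge0 => E _; rewrite mulr_ge0//; case: ifP.
have mV j : measurable_fun setT (V j).
  apply: measurable_finset_sum => E'; apply: measurable_finset_sum => E.
  by apply: measurable_funM => //; exact: mq.
have G0 w : 0 <= graph_mean x (kapm m) X w.
  by apply: Ex_ge0 => [p|E _]; [exact: edge01|exact: X0].
have mG : measurable_fun setT (graph_mean x (kapm m) X) := graph_mean_meas Hx _ Hm.
have le w : graph_mean x kap (fun E : {set 'I_n * 'I_n} => (ck k E)%:R / n%:R) w <=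
    H%:R * e + \sum_(j < H) V j w + graph_mean x (kapm m) X w.
  apply: (coupling_core_le (q := q m n w) (g := gweight kap (x n w))
    (g' := gweight (kapm m) (x n w)) n1 (ltW e0)).
  - exact: q0.
  - exact: qs.
  - exact: qg'.
  - exact: qg.
  - rewrite -[RHS](Ex_cst (edgep (kapm m) (x n w)) (pairsn n) 1); apply: eq_bigr => E _.
    by rewrite mulr1.
  - by [].
apply: (@le_trans _ _ (\int[P]_w ((H%:R * e)%:E + \sum_(j < H) (V j w)%:E +
    (graph_mean x (kapm m) X w)%:E))%E).
  apply: ge0_le_integral => //.
  - by move=> w _; rewrite lee_fin; apply: Ex_ge0 => [p|E _]; [exact: edge01|rewrite divr_ge0].
  - by apply/measurable_EFinP; exact: (graph_mean_meas Hx _ Hkap).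
  - apply: emeasurable_funD; last exact/measurable_EFinP.
    apply: emeasurable_funD => //; apply: emeasurable_sum => j; exact/measurable_EFinP.
  - by move=> w _; rewrite sumEFin -!EFinD lee_fin; exact: le.
have mS : measurable_fun setT (fun w => (\sum_(j < H) (V j w)%:E)%E).
  by apply: emeasurable_sum => j; exact/measurable_EFinP.
have S0 w : (0 <= \sum_(j < H) (V j w)%:E)%E by rewrite sumEFin lee_fin sumr_ge0.
have He0 : 0 <= H%:R * e by rewrite mulr_ge0// ltW.
rewrite ge0_integralD//; last 4 first.
- by move=> w _; rewrite adde_ge0// lee_fin.
- exact: emeasurable_funD.
- by move=> w _; rewrite lee_fin.
- exact/measurable_EFinP.
rewrite ge0_integralD//.
rewrite ge0_integral_sum//; last 2 first.
- by move=> j; exact/measurable_EFinP.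
- by move=> j w _; rewrite lee_fin.
rewrite integral_cst// (_ : ((H%:R * e)%:E * _ = (H%:R * e)%:E)%E); last first.
  by rewrite -[RHS]mule1; congr (_ * _)%E; exact: probability_setT.
have hV : (\sum_(j < H) \int[P]_w (V j w)%:E <= (H%:R * e)%:E)%E.
  apply: (@le_trans _ _ (\sum_(j < H) e%:E)%E).
    apply: lee_sum => j _; apply: n0P; apply: leq_trans nj; exact: leq_bigmax.
  by rewrite sumEFin sumr_const card_ord mulr_natl.
pose sg := \sum_i tmass mu tau i * psi k (Kop K (tmass mu tau) (qseq K (tmass mu tau) k l) i).
have sgE : blevel mu (kapm m) k l = sg%:E := blevel_types mu tau_meas K0 kapE k l.
have sgb : sg <= b + delta / 4.
  rewrite -lee_fin -sgE; apply: le_trans hl; exact: blevel_compare.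
have sg0 : 0 <= sg.
  apply: sumr_ge0 => i _; rewrite mulr_ge0 ?psi_ge0//.
  by apply: Kop_tmass_ge0 => // j; exact: qseq_tmass_ge0.
have [B [mB PB BP]] := N2P n nN2.
have hG : (\int[P]_w (graph_mean x (kapm m) X w)%:E <= (sg + delta / 4)%:E + 2%:E * P B)%E.
  apply: integral_le_off => //.
  - by rewrite addr_ge0// ltW.
  - move=> w; rewrite G0 /= -[leRHS](Ex_cst (edgep (kapm m) (x n w)) (pairsn n)).
    by apply: ler_Ex => [p|E _]; [exact: edge01|exact: X2].
  - move=> w nB; rewrite /graph_mean (edgep_tprob _ kapE); exact: upP nN1 (BP w nB).
(* The budget is [delta / 8] twice for missing paths, [delta / 4] for stopping at depth [l],
   [delta / 4] for the finitary estimate, and [2 * (delta / 8)] for atypical types, where only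
   [X <= 2] is known. *)
apply: le_trans (leeD (leeD2l _ hV) hG) _.
apply: (@le_trans _ _ ((H%:R * e)%:E + (H%:R * e)%:E + ((sg + delta / 4)%:E + 2%:E * (delta / 8)%:E))%E).
  by rewrite leeD2l// leeD2l// lee_pmul.
rewrite -!EFinM -!EFinD lee_fin /e.
have -> : H%:R * (delta / 8 / H%:R) = delta / 8 by field; rewrite lt0r_neq0.
by move: sgb; lra.
Qed.

End Tails.

(** An upward deviation is paid by the excess of [y] over [b], a downward one by the lower-tail
    indicator, whose weight [1 + eps] covers the extreme case [y = 0], [b = 1]. *)
Lemma deviation_le {R : realType} (y b eps delta : R) :
  0 <= b <= 1 -> 0 <= y -> 0 < eps -> 0 < delta -> delta <= eps ->
  eps * (eps < `|y - b|)%R%:R + b <= y + (delta + (1 + eps) * (y < b - delta)%R%:R).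
Proof.
move=> /andP[b0 b1] y0 e0 d0 de.
have [h|h] := ltP eps `|y - b|; have [h'|h'] := ltP y (b - delta);
  rewrite /= ?mulr1 ?mulr0 ?add0r ?addr0; try lra.
move: h; rewrite lter_normr => /orP[]; lra.
Qed.

Theorem theorem10 (k : nat) (hk : (2 <= k)%N)
  (R : realType) (S : pseudoPMetricType R)
  (HS : hausdorff_space S) (Hsep : separable S)
  (mu : probability (SB S) R)
  (d : measure_display) (Om : measurableType d) (P : probability Om R)
  (x : forall n : nat, Om -> 'I_n -> S) (Hx : vertex_space mu P x)
  (kap : S -> S -> R) (Hkap : is_kernel kap)
  (Hcont : (mu \x mu)%E.-negligible
             [set z : SB S * SB S | ~ {for (z : S * S), continuous (fun z : S * S => kap z.1 z.2)}])
  (Hint : (\int[(mu \x mu)%E]_z (kap z.1 z.2)%:E < +oo)%E)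
  (Hedge : (fun n : nat => ((n%:R)^-1)%:E * graphE P kap x n (fun E => #|E|%:R))%E
              @ \oo --> ((2^-1)%:E * \int[(mu \x mu)%E]_z (kap z.1 z.2)%:E)%E)
  (b : R) (Hb : is_beta_plus mu k kap b)
  (Hi : exists (kapm : nat -> S -> S -> R) (c : nat -> R) (bm : nat -> R),
      (forall m, regular_finitary mu (kapm m)) /\
      (forall m a a', kapm m a a' <= kap a a') /\
      (forall m, c m < 1) /\
      (forall m, is_beta_plus mu k (fun a a' => c m * kapm m a a') (bm m)) /\
      bm @ \oo --> b)
  (Hii : exists (kapm' : nat -> S -> S -> R)
                (q : forall (m n : nat), Om -> {set 'I_n * 'I_n} -> {set 'I_n * 'I_n} -> R),
      (forall m, regular_finitary mu (kapm' m)) /\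
      (forall m a a', kapm' m a a' <= kapm' m.+1 a a') /\
      (forall m a a', kapm' m a a' <= kap a a') /\
      (* q m n w is a coupling, given w (hence given the types x n w), of
         G^V(n, kapm' m) (first component) and G^V(n, kap) (second component)
         with G^V(n, kapm' m) a subgraph of G^V(n, kap) *)
      (forall m n (E' E : {set 'I_n * 'I_n}), measurable_fun setT (fun w => q m n w E' E)) /\
      (forall m n w (E' E : {set 'I_n * 'I_n}), 0 <= q m n w E' E) /\
      (forall m n w (E' E : {set 'I_n * 'I_n}), q m n w E' E != 0 ->
          [/\ E' \subset E & E \subset pairsn n]) /\
      (forall m n w (E' : {set 'I_n * 'I_n}), E' \subset pairsn n ->
          \sum_(E in powerset (pairsn n)) q m n w E' E = gweight (kapm' m) (x n w) E') /\
      (forall m n w (E : {set 'I_n * 'I_n}), E \subset pairsn n ->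
          \sum_(E' in powerset (pairsn n)) q m n w E' E = gweight kap (x n w) E) /\
      (forall (l : nat) (eps : R), (1 <= l)%N -> 0 < eps ->
         exists m0 : nat, forall m, (m0 <= m)%N ->
           exists n0 : nat, forall n, (n0 <= n)%N ->
             (\int[P]_w (\sum_(E' in powerset (pairsn n)) \sum_(E in powerset (pairsn n))
                 q m n w E' E * (if eps * n%:R <= #|Vset l E' E|%:R then 1 else 0))%:E <= eps%:E)%E))
  : forall eps : R, 0 < eps ->
      (fun n : nat => graphPr P kap x n (fun E => eps < `| (ck k E)%:R / n%:R - b |))
        @ \oo --> 0%E.
Proof.
move=> eps e0.
have b01 := beta_plus_itv Hb.
have E01 n (w : Om) p : 0 <= edgep kap (x n w) p <= 1 by exact: edgep01.
have mean_ge0 n f w : (forall E, 0 <= f E) -> 0 <= graph_mean x kap (n := n) f w.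
  by move=> f0; apply: Ex_ge0.
have mm n f : measurable_fun setT (graph_mean x kap (n := n) f) := graph_mean_meas Hx _ Hkap.
apply: cvg0_le => [n|eta eta0].
  by apply: integral_ge0 => w _; rewrite lee_fin; apply: mean_ge0.
(* The total error is [(3 + eps) * delta]: one [delta] from the upper mean, one from [deviation_le],
   and [1 + eps] times the lower tail. *)
pose delta := Num.min eps (eps * eta / (3 + eps)).
have e30 : 0 < 3 + eps by rewrite addr_gt0.
have d0 : 0 < delta by rewrite lt_min e0 divr_gt0// mulr_gt0.
have de : delta <= eps by rewrite ge_min lexx.
have deta : (3 + eps) * delta <= eps * eta.
  by rewrite mulrC -ler_pdivlMr// ge_min lexx orbT.
have [N1 LP] := core_lower_tail Hx Hkap hk Hi d0.
have [N2 UP] := core_upper_mean Hx Hkap Hint Hb Hii d0.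
exists (maxn N1 N2) => n; rewrite geq_max => /andP[nN1 nN2].
pose L (E : {set 'I_n * 'I_n}) : R := ((ck k E)%:R / n%:R < b - delta)%R%:R.
pose Y (E : {set 'I_n * 'I_n}) : R := (ck k E)%:R / n%:R.
have hL : (\int[P]_w (graph_mean x kap L w)%:E <= delta%:E)%E := LP n nN1.
have hU : (\int[P]_w (graph_mean x kap Y w)%:E <= (b + delta)%:E)%E := UP n nN2.
pose I (E : {set 'I_n * 'I_n}) : R := (eps < `|(ck k E)%:R / n%:R - b|)%R%:R.
have Y0 E : 0 <= Y E by rewrite /Y divr_ge0.
have le w : eps * graph_mean x kap I w + b <=
    graph_mean x kap Y w + (delta + (1 + eps) * graph_mean x kap L w).
  rewrite /graph_mean -!ExZ -(Ex_cst (edgep kap (x n w)) (pairsn n) b).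
  rewrite -(Ex_cst (edgep kap (x n w)) (pairsn n) delta) -!ExD.
  by apply: ler_Ex => // E _; exact: deviation_le.
have GI0 w : 0 <= graph_mean x kap I w by apply: mean_ge0.
have GL0 w : 0 <= graph_mean x kap L w by apply: mean_ge0 => E; rewrite /L.
have GY0 w : 0 <= graph_mean x kap Y w by apply: mean_ge0.
have b0 : 0 <= b by case/andP: b01.
have e10 : 0 <= 1 + eps by rewrite addr_ge0// ltW.
have mE (f : {set 'I_n * 'I_n} -> R) (c : R) :
    measurable_fun setT (fun w => (c%:E * (graph_mean x kap f w)%:E)%E).
  by apply: emeasurable_funM => //; exact/measurable_EFinP.
have cst (c : R) : (\int[P]_w c%:E = c%:E)%E.
  rewrite integral_cst//; rewrite -[RHS]mule1; congr (_ * _)%E; exact: probability_setT.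
have ile : ((eps%:E * \int[P]_w (graph_mean x kap I w)%:E) + b%:E <=
   \int[P]_w (graph_mean x kap Y w)%:E +
   (delta%:E + (1 + eps)%:E * \int[P]_w (graph_mean x kap L w)%:E))%E.
  have mI := mE I eps; have mL := mE L (1 + eps).
  have mY : measurable_fun setT (fun w => (graph_mean x kap Y w)%:E) by exact/measurable_EFinP.
  have pI w : (0 <= eps%:E * (graph_mean x kap I w)%:E)%E by rewrite -EFinM lee_fin mulr_ge0// ltW.
  have pL w : (0 <= (1 + eps)%:E * (graph_mean x kap L w)%:E)%E by rewrite -EFinM lee_fin mulr_ge0.
  have Z f c : 0 <= c -> (forall w, 0 <= graph_mean x kap (n := n) f w) ->
      (c%:E * \int[P]_w (graph_mean x kap f w)%:E =
       \int[P]_w (c%:E * (graph_mean x kap f w)%:E))%E.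
    move=> c0 f0; rewrite ge0_integralZl_EFin//; first by move=> w _; rewrite lee_fin.
    exact/measurable_EFinP.
  rewrite -(cst b) -(cst delta) (Z I)// ?(ltW e0)// (Z L)// -!ge0_integralD//; last 4 first.
  - by move=> w _; rewrite lee_fin.
  - by move=> w _; rewrite adde_ge0// lee_fin ltW.
  - exact: emeasurable_funD.
  - by move=> w _; rewrite lee_fin ltW.
  apply: ge0_le_integral => //.
  - by move=> w _; rewrite adde_ge0.
  - exact: emeasurable_funD.
  - by apply: emeasurable_funD => //; exact: emeasurable_funD.
  - by move=> w _; rewrite -!EFinM -!EFinD lee_fin.
have {}ile : (eps%:E * \int[P]_w (graph_mean x kap I w)%:E + b%:E <= (b + (3 + eps) * delta)%:E)%E.
  apply: le_trans ile _; apply: (@le_trans _ _ ((b + delta)%:E + (delta%:E + (1 + eps)%:E * delta%:E))%E).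
    by apply: leeD => //; rewrite leeD2l// lee_pmul// ?lee_fin// integral_ge0// => w _; rewrite lee_fin.
  rewrite -EFinM -!EFinD lee_fin; lra.
(* [graphPr] unfolds to this integral, as [gweight] is [wt] at [edgep] by conversion. *)
change (\int[P]_w (graph_mean x kap I w)%:E <= eta%:E)%E.
have A0 : (0 <= \int[P]_w (graph_mean x kap I w)%:E)%E.
  by apply: integral_ge0 => w _; rewrite lee_fin.
move: A0 ile; case: (\int[P]_w _)%E => [a| |]//.
  rewrite lee_fin => a0; rewrite -EFinM -EFinD !lee_fin => h.
  rewrite -(ler_pM2l e0); lra.
by rewrite gt0_muley ?lte_fin.
Qed.
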